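(* Let $R$ be an associative ring with unit, let $A=R[x]/(x^2)$ be regarded as a $\mathbb{Z}$-graded ring with $R$ in degree $0$ and $x$ in degree $-1$, and let $r$ be a positive integer. Let $\Phi$ be the isomorphism from the category of graded left $A$-modules to the category of chain complexes of left $R$-modules which sends $M=\bigoplus_{n} M_n$ to the complex $(M_n)_{n\in\mathbb{Z}}$ with boundary $y\mapsto x\cdot y$, and let $\Psi$ be its inverse. Then $\Psi$ maps: (1) dg-$r$-projective complexes into Gorenstein-$r$-projective $A$-modules, (2) dg-$r$-injective complexes into Gorenstein-$r$-injective $A$-modules, and (3) dg-$r$-flat complexes into Gorenstein-$r$-flat $A$-modules. If $R$ is a left and right Noetherian ring of finite global dimension, then $\Phi$ maps: (1') Gorenstein-$r$-projective $A$-modules into dg-$r$-projective complexes, (2') Gorenstein-$r$-injective $A$-modules into dg-$r$-injective complexes, and (3') Gorenstein-$r$-flat $A$-modules into dg-$r$-flat complexes.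
   Context: Chain complexes are unbounded ($\mathbb{Z}$-indexed). ''$A$-module'' means $\mathbb{Z}$-graded left $A$-module, and morphisms of graded modules preserve degree; on morphisms $\Phi(f)_n=f|_{M_n}$. For a class $\mathcal{A}$ of left $R$-modules, $\mathcal{A}^\perp=\{B:\mathrm{Ext}^1_R(A,B)=0\ \forall A\in\mathcal{A}\}$, ${}^\perp\mathcal{A}=\{B:\mathrm{Ext}^1_R(B,A)=0\ \forall A\in\mathcal{A}\}$, and $\widetilde{\mathcal{A}}$ is the class of exact complexes $X$ whose cycle modules $Z_m(X)$ lie in $\mathcal{A}$ for all $m$. A cotorsion pair $(\mathcal{A},\mathcal{B})$ is a pair with $\mathcal{A}={}^\perp\mathcal{B}$ and $\mathcal{B}=\mathcal{A}^\perp$. Given such a pair, $\mathrm{dg}\widetilde{\mathcal{A}}$ is the class of complexes $X$ with $X_m\in\mathcal{A}$ for all $m$ and such that every chain map $X\to B$ with $B\in\widetilde{\mathcal{B}}$ is null homotopic; $\mathrm{dg}\widetilde{\mathcal{B}}$ is the class of complexes $X$ with $X_m\in\mathcal{B}$ for all $m$ and such that every chain map $A\to X$ with $A\in\widetilde{\mathcal{A}}$ is null homotopic. Let $\mathcal{P}_r$, $\mathcal{I}_r$, $\mathcal{F}_r$ be the classes of left $R$-modules of projective, injective, flat dimension at most $r$. A complex is dg-$r$-projective if it is in $\mathrm{dg}\widetilde{\mathcal{P}_r}$ (for the cotorsion pair $(\mathcal{P}_r,(\mathcal{P}_r)^\perp)$), dg-$r$-injective if it is in $\mathrm{dg}\widetilde{\mathcal{I}_r}$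 (for $({}^\perp(\mathcal{I}_r),\mathcal{I}_r)$), and dg-$r$-flat if it is in $\mathrm{dg}\widetilde{\mathcal{F}_r}$ (for $(\mathcal{F}_r,(\mathcal{F}_r)^\perp)$). In the category of graded $A$-modules: $X$ is Gorenstein-projective if there is an exact sequence $\cdots\to P_1\to P_0\to P^0\to P^1\to\cdots$ of projectives, remaining exact under $\mathrm{Hom}(-,P)$ for every projective $P$, with $X=\mathrm{Ker}(P^0\to P^1)$; $X$ is Gorenstein-injective if there is an exact sequence $\cdots\to I_1\to I_0\to I^0\to I^1\to\cdots$ of injectives, remaining exact under $\mathrm{Hom}(I,-)$ for every injective $I$, with $X=\mathrm{Ker}(I^0\to I^1)$; $X$ is Gorenstein-flat if there is an exact sequence $\cdots\to F_1\to F_0\to F^0\to F^1\to\cdots$ of flat modules, remaining exact under $I\otimes_A-$ for every injective graded right $A$-module $I$, with $X=\mathrm{Ker}(F^0\to F^1)$. $X$ is Gorenstein-$r$-projective (resp. Gorenstein-$r$-flat) if there is an exact sequence $0\to C_r\to\cdots\to C_0\to X\to0$ with all $C_i$ Gorenstein-projective (resp. Gorenstein-flat), and Gorenstein-$r$-injective if there is an exact sequence $0\to X\to D^0\to\cdots\to D^r\to0$ with all $D^i$ Gorenstein-injective. *)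

(* Defs.v *)
From HB Require Import structures.
From mathcomp Require Import all_boot all_order all_algebra.
From mathcomp Require Import generic_quotient boolp.

Set Implicit Arguments.
Unset Strict Implicit.
Unset Printing Implicit Defensive.

Import GRing.Theory.
Local Open Scope ring_scope.
Local Open Scope quotient_scope.

Definition epi (U V : Type) (f : U -> V) := forall y, exists x, f x = y.

(* Exactness at V of U -> V -> W. *)
Definition exact (U V : Type) (W : zmodType) (f : U -> V) (g : V -> W) :=
  forall y, g y = 0 <-> exists x, f x = y.

Definition trivial_mod (V : zmodType) := forall v : V, v = 0.

(* Right modules over A are left modules over the converse ring A^c; the
   action m.a of a : A on m : M is a *: m. *)

(* The tensor product M (x)_A N is the set of formal sums of pairs (m, n),
   represented by sequences of pairs, modulo the least congruence making
   (m, n) biadditive and A-balanced. *)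
Section Tensor.
Variables (A : pzRingType) (M : lmodType A^c) (N : lmodType A).

Inductive tens_rel : seq (M * N) -> seq (M * N) -> Prop :=
| tens_refl s : tens_rel s s
| tens_sym s t : tens_rel s t -> tens_rel t s
| tens_trans s t u : tens_rel s t -> tens_rel t u -> tens_rel s u
| tens_cat s s' t t' :
    tens_rel s s' -> tens_rel t t' -> tens_rel (s ++ t) (s' ++ t')
| tens_comm s t : tens_rel (s ++ t) (t ++ s)
| tens_0l n : tens_rel [:: (0, n)] [::]
| tens_Dl m m' n : tens_rel [:: (m + m', n)] [:: (m, n); (m', n)]
| tens_Dr m n n' : tens_rel [:: (m, n + n')] [:: (m, n); (m, n')]
| tens_bal (a : A) m n : tens_rel [:: ((a : A^c) *: m, n)] [:: (m, a *: n)].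

Definition tens_relb : rel (seq (M * N)) := fun s t => `[< tens_rel s t >].

Lemma tens_relb_refl : reflexive tens_relb.
Proof. by move=> s; apply/asboolP; apply: tens_refl. Qed.

Lemma tens_relb_sym : symmetric tens_relb.
Proof. by move=> s t; apply/asboolP/asboolP; apply: tens_sym. Qed.

Lemma tens_relb_trans : transitive tens_relb.
Proof.
by move=> t s u /asboolP st /asboolP tu; apply/asboolP/(tens_trans st tu).
Qed.

Canonical tens_equiv :=
  EquivRel tens_relb tens_relb_refl tens_relb_sym tens_relb_trans.

Definition tensor := {eq_quot tens_equiv}.
HB.instance Definition _ := Choice.on tensor.

Definition tens_class (s : seq (M * N)) : tensor := \pi_{eq_quot tens_equiv} s.

Lemma tens_classP s t : tens_class s = tens_class t <-> tens_rel s t.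
Proof.
split=> [/eqP|st]; first by rewrite /tens_class eqmodE => /asboolP.
by apply/eqP; rewrite /tens_class eqmodE; apply/asboolP.
Qed.

Lemma tens_reprK (u : tensor) : tens_class (repr u) = u.
Proof. exact: reprK. Qed.

Definition tens_zero : tensor := tens_class [::].
Definition tens_add (u v : tensor) : tensor := tens_class (repr u ++ repr v).
Definition tens_opp (u : tensor) : tensor :=
  tens_class [seq (- p.1, p.2) | p <- repr u].

Lemma tens_addE s t : tens_add (tens_class s) (tens_class t) = tens_class (s ++ t).
Proof. by apply/tens_classP/tens_cat; apply/tens_classP; rewrite tens_reprK. Qed.

Fact tens_addA : associative tens_add.
Proof.
move=> u v w; rewrite -[u]tens_reprK -[v]tens_reprK -[w]tens_reprK.
by rewrite !tens_addE catA.
Qed.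

Fact tens_addC : commutative tens_add.
Proof.
move=> u v; rewrite -[u]tens_reprK -[v]tens_reprK !tens_addE.
by apply/tens_classP/tens_comm.
Qed.

Fact tens_add0 : left_id tens_zero tens_add.
Proof. by move=> u; rewrite -[u]tens_reprK tens_addE. Qed.

Fact tens_addN : left_inverse tens_zero tens_opp tens_add.
Proof.
move=> u; rewrite -{2}[u]tens_reprK tens_addE; apply/tens_classP.
elim: (repr u) => [|[m n] s IHs] /=; first exact: tens_refl.
set s' := map _ s in IHs *.
apply: (@tens_trans _ ([:: (- m, n); (m, n)] ++ (s' ++ s))).
  apply: (tens_cat (s := [:: (- m, n)]) (s' := [:: (- m, n)])
    (t := s' ++ (m, n) :: s) (t' := (m, n) :: s' ++ s)).
    exact: tens_refl.
  rewrite -cat_rcons -cats1 -cat_cons -cat1s.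
  exact: tens_cat (tens_comm _ _) (tens_refl _).
rewrite -[[::]]/([::] ++ [::]); apply: (tens_cat _ IHs).
by apply: (tens_trans (tens_sym (tens_Dl _ _ _))); rewrite addNr; apply: tens_0l.
Qed.

HB.instance Definition _ :=
  GRing.isZmodule.Build tensor tens_addA tens_addC tens_add0 tens_addN.

End Tensor.

Definition tens_map (A : pzRingType) (M M' : lmodType A^c) (N N' : lmodType A)
    (f : {linear M -> M'}) (g : {linear N -> N'}) (u : tensor M N) :
    tensor M' N' :=
  tens_class [seq (f p.1, g p.2) | p <- repr u].

Lemma tens_mapE (A : pzRingType) (M M' : lmodType A^c) (N N' : lmodType A)
    (f : {linear M -> M'}) (g : {linear N -> N'}) (s : seq (M * N)) :
  tens_map f g (tens_class s) = tens_class [seq (f p.1, g p.2) | p <- s].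
Proof.
apply/tens_classP; have: tens_rel (repr (tens_class s)) s by apply/tens_classP; rewrite tens_reprK.
move: (repr _) => t; elim=> {s t} /=.
- by move=> s; apply: tens_refl.
- by move=> s t _; apply: tens_sym.
- by move=> s t u _ IHs _; apply: tens_trans.
- by move=> s s' t t' _ IHs _ IHt; rewrite !map_cat; apply: tens_cat.
- by move=> s t; rewrite !map_cat; apply: tens_comm.
- by move=> n; rewrite linear0; apply: tens_0l.
- by move=> m m' n; rewrite linearD; apply: tens_Dl.
- by move=> m n n'; rewrite linearD; apply: tens_Dr.
by move=> a m n; rewrite !linearZ; apply: tens_bal.
Qed.

Section Modules.
Variable R : pzRingType.
Implicit Types (M N P : lmodType R) (K : lmodType R -> Prop) (r : nat).

Definition projective P :=
  forall M N (g : {linear M -> N}) (f : {linear P -> N}), epi g ->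
  exists h : {linear P -> M}, forall x, g (h x) = f x.

Definition injective_mod P :=
  forall M N (g : {linear M -> N}) (f : {linear M -> P}), injective g ->
  exists h : {linear N -> P}, forall x, h (g x) = f x.

Definition flat P :=
  forall (M N : lmodType R^c) (f : {linear M -> N}), injective f ->
  injective (tens_map f (idfun : {linear P -> P})).

(* ... -> C 1 -> C 0 -> M -> 0 *)
Definition left_resolution M (C : nat -> lmodType R)
    (d : forall i, {linear C i.+1 -> C i}) (e : {linear C 0%N -> M}) :=
  [/\ epi e, exact (d 0%N) e & forall i, exact (d i.+1) (d i)].

(* 0 -> M -> D 0 -> D 1 -> ... *)
Definition right_resolution M (D : nat -> lmodType R)
    (d : forall i, {linear D i -> D i.+1}) (e : {linear M -> D 0%N}) :=
  [/\ injective e, exact e (d 0%N) & forall i, exact (d i) (d i.+1)].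

(* A resolution of length at most r is one whose terms of index > r vanish. *)
Definition left_dim_le K r M :=
  exists (C : nat -> lmodType R) (d : forall i, {linear C i.+1 -> C i})
    (e : {linear C 0%N -> M}),
  [/\ left_resolution d e, forall i, (i <= r)%N -> K (C i)
    & forall i, (r < i)%N -> trivial_mod (C i)].

Definition right_dim_le K r M :=
  exists (D : nat -> lmodType R) (d : forall i, {linear D i -> D i.+1})
    (e : {linear M -> D 0%N}),
  [/\ right_resolution d e, forall i, (i <= r)%N -> K (D i)
    & forall i, (r < i)%N -> trivial_mod (D i)].

Definition proj_dim_le := left_dim_le projective.
Definition inj_dim_le := right_dim_le injective_mod.
Definition flat_dim_le := left_dim_le flat.

(* Ext^1_R(M, N) = H^1(Hom(C, N)) = 0 for the projective resolutions C of M. *)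
Definition Ext1_zero M N :=
  forall (C : nat -> lmodType R) (d : forall i, {linear C i.+1 -> C i})
    (e : {linear C 0%N -> M}),
  left_resolution d e -> (forall i, projective (C i)) ->
  forall g : {linear C 1%N -> N}, (forall x, g (d 1%N x) = 0) ->
  exists h : {linear C 0%N -> N}, forall x, g x = h (d 0%N x).

Definition right_perp K N := forall M, K M -> Ext1_zero M N.
Definition left_perp K M := forall N, K N -> Ext1_zero M N.

Definition left_noetherian :=
  forall I : nat -> {pred R^o},
  (forall n, GRing.submod_closed (I n)) ->
  (forall n, {subset I n <= I n.+1}) ->
  exists m, forall n, (m <= n)%N -> I n =i I m.

Definition finite_left_gldim := exists n, forall M, proj_dim_le n M.

End Modules.

Definition right_noetherian (R : pzRingType) := left_noetherian R^c.

Section Kernel.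
Variables (R : pzRingType) (M N : lmodType R) (f : {linear M -> N}).

Definition ker_pred : {pred M} := [pred x | f x == 0].

Fact ker_pred_closed : GRing.submod_closed ker_pred.
Proof.
split=> [|a u v]; rewrite !inE ?linear0 // => /eqP fu /eqP fv.
by rewrite linearP fu fv scaler0 addr0.
Qed.

HB.instance Definition _ := GRing.isSubmodClosed.Build R M ker_pred ker_pred_closed.

Record ker := Ker { ker_val : M; ker_valP : ker_val \in ker_pred }.

HB.instance Definition _ := [isSub for ker_val].
HB.instance Definition _ := [Choice of ker by <:].
HB.instance Definition _ := [SubChoice_isSubLmodule of ker by <:].
End Kernel.

(* Complexes X with differentials X_(n+1) -> X_n, for n in Z; indexing the
   differential by its target avoids casts between X_(n-1+1) and X_n. *)
Record complex (R : pzRingType) := Complex {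
  cobj :> int -> lmodType R;
  cdiff : forall n, {linear cobj (n + 1) -> cobj n};
  cdiffK : forall n x, cdiff n (cdiff (n + 1) x) = 0 }.

Record chain_map (R : pzRingType) (X Y : complex R) := ChainMap {
  cmap :> forall n, {linear X n -> Y n};
  cmapE : forall n x, cmap n (cdiff X n x) = cdiff Y n (cmap (n + 1) x) }.

Section Complexes.
Variable R : pzRingType.
Implicit Types (X Y : complex R) (K L : lmodType R -> Prop) (r : nat).

Definition null_homotopic X Y (f : chain_map X Y) :=
  exists s : forall n, {linear X n -> Y (n + 1)},
  forall n x, f (n + 1) x = cdiff Y (n + 1) (s (n + 1) x) + s n (cdiff X n x).

Definition exact_complex X := forall n, exact (cdiff X (n + 1)) (cdiff X n).

(* The class K~; the cycle module Z_(n+1)(X) is the kernel of cdiff X n. *)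
Definition tilde K X := exact_complex X /\ forall n, K (ker (cdiff X n)).

(* dg K~ and dg L~ for a cotorsion pair (K, L). *)
Definition dg_left K L X :=
  (forall n, K (X n)) /\
  forall Y, tilde L Y -> forall f : chain_map X Y, null_homotopic f.

Definition dg_right K L X :=
  (forall n, L (X n)) /\
  forall Y, tilde K Y -> forall f : chain_map Y X, null_homotopic f.

Definition dg_projective r :=
  dg_left (@proj_dim_le R r) (right_perp (@proj_dim_le R r)).
Definition dg_injective r :=
  dg_right (left_perp (@inj_dim_le R r)) (@inj_dim_le R r).
Definition dg_flat r :=
  dg_left (@flat_dim_le R r) (right_perp (@flat_dim_le R r)).

End Complexes.

(* V is the internal direct sum of the additive subgroups p n. *)
Definition is_grading (V : zmodType) (p : int -> {pred V}) :=
  [/\ forall n, zmod_closed (p n),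
      forall v, exists (s : seq int) (c : int -> V),
        (forall n, c n \in p n) /\ v = \sum_(n <- s) c n
    & forall (s : seq int) (c : int -> V), uniq s -> (forall n, c n \in p n) ->
        \sum_(n <- s) c n = 0 -> forall n, n \in s -> c n = 0].

Lemma sum_single (n : int) (V : zmodType) (s : seq int) (c : int -> V) :
  uniq s -> n \in s -> (forall m, m != n -> c m = 0) ->
  \sum_(m <- s) c m = c n.
Proof.
by move=> us ns c0; rewrite (bigD1_seq n) //= big1 ?addr0 // => m /c0.
Qed.

Record gradedRing := GradedRing {
  gring :> pzRingType;
  rdeg : int -> {pred gring};
  rdeg_grading : is_grading rdeg;
  rdeg1 : 1 \in rdeg 0;
  rdegM : forall i j a b,
    a \in rdeg i -> b \in rdeg j -> a * b \in rdeg (i + j) }.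

Arguments rdeg : clear implicits.

Record gradedModule (A : gradedRing) := GradedModule {
  gmod :> lmodType A;
  mdeg : int -> {pred gmod};
  mdeg_grading : is_grading mdeg;
  mdegZ : forall i j a m,
    a \in rdeg A i -> m \in mdeg j -> a *: m \in mdeg (i + j) }.

Arguments mdeg {A} M : rename.

Record gradedHom (A : gradedRing) (M N : gradedModule A) := GradedHom {
  ghom :> {linear M -> N};
  ghom_deg : forall n x, x \in mdeg M n -> ghom x \in mdeg N n }.

Section OppositeRing.
Variable A : gradedRing.

Fact opp_rdegM i j (a b : A^c) :
  a \in rdeg A i -> b \in rdeg A j -> a * b \in rdeg A (i + j).
Proof. by move=> ai bj; rewrite addrC; apply: rdegM. Qed.

Definition opp_gring : gradedRing :=
  @GradedRing A^c (rdeg A) (rdeg_grading A) (rdeg1 A) opp_rdegM.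
End OppositeRing.

Section GradedModules.
Variable A : gradedRing.
Implicit Types M N P : gradedModule A.

Definition gr_projective P :=
  forall M N (g : gradedHom M N) (f : gradedHom P N), epi g ->
  exists h : gradedHom P M, forall x, g (h x) = f x.

Definition gr_injective P :=
  forall M N (g : gradedHom M N) (f : gradedHom M P), injective g ->
  exists h : gradedHom N P, forall x, h (g x) = f x.

End GradedModules.

Section Gorenstein.
Variable A : gradedRing.
Implicit Types (M N P X : gradedModule A) (K : gradedModule A -> Prop).
Implicit Types (r : nat).

Definition gr_flat P :=
  forall (M N : gradedModule (opp_gring A)) (f : gradedHom M N),
  injective f ->
  injective (@tens_map A M N P P f (idfun : {linear P -> P})).

(* A complex ... -> T (-1) -> T 0 -> T 1 -> ... that is exact; the modules
   P^i (resp. P_i) are T i (resp. T (- i - 1)). *)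
Definition gr_exact (T : int -> gradedModule A)
    (d : forall n, gradedHom (T n) (T (n + 1))) :=
  forall n, exact (d n) (d (n + 1)).

Definition is_kernel X M N (i : gradedHom X M) (f : gradedHom M N) :=
  injective i /\ exact i f.

Definition Gorenstein_projective X :=
  exists (T : int -> gradedModule A) (d : forall n, gradedHom (T n) (T (n + 1))),
  [/\ forall n, gr_projective (T n),
      gr_exact d,
      forall P, gr_projective P ->
        forall n (g : gradedHom (T (n + 1)) P),
        (forall x, g (d n x) = 0) <->
        exists h : gradedHom (T (n + 1 + 1)) P, forall x, h (d (n + 1) x) = g x
    & exists i : gradedHom X (T 0), is_kernel i (d 0)].

Definition Gorenstein_injective X :=
  exists (T : int -> gradedModule A) (d : forall n, gradedHom (T n) (T (n + 1))),
  [/\ forall n, gr_injective (T n),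
      gr_exact d,
      forall P, gr_injective P ->
        forall n (g : gradedHom P (T (n + 1))),
        (forall x, d (n + 1) (g x) = 0) <->
        exists h : gradedHom P (T n), forall x, d n (h x) = g x
    & exists i : gradedHom X (T 0), is_kernel i (d 0)].

Definition Gorenstein_flat X :=
  exists (T : int -> gradedModule A) (d : forall n, gradedHom (T n) (T (n + 1))),
  [/\ forall n, gr_flat (T n),
      gr_exact d,
      forall I : gradedModule (opp_gring A), gr_injective I ->
        forall n, exact (@tens_map A I I _ _ (idfun : {linear I -> I}) (d n))
          (@tens_map A I I _ _ (idfun : {linear I -> I}) (d (n + 1)))
    & exists i : gradedHom X (T 0), is_kernel i (d 0)].

(* As for modules, sequences of length r are padded by zero modules. *)
Definition gr_left_dim_le K r X :=
  exists (C : nat -> gradedModule A) (d : forall i, gradedHom (C i.+1) (C i))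
    (e : gradedHom (C 0%N) X),
  [/\ [/\ epi e, exact (d 0%N) e & forall i, exact (d i.+1) (d i)],
      forall i, (i <= r)%N -> K (C i)
    & forall i, (r < i)%N -> trivial_mod (C i)].

Definition gr_right_dim_le K r X :=
  exists (D : nat -> gradedModule A) (d : forall i, gradedHom (D i) (D i.+1))
    (e : gradedHom X (D 0%N)),
  [/\ [/\ injective e, exact e (d 0%N) & forall i, exact (d i) (d i.+1)],
      forall i, (i <= r)%N -> K (D i)
    & forall i, (r < i)%N -> trivial_mod (D i)].

Definition Gorenstein_r_projective r := gr_left_dim_le Gorenstein_projective r.
Definition Gorenstein_r_injective r := gr_right_dim_le Gorenstein_injective r.
Definition Gorenstein_r_flat r := gr_left_dim_le Gorenstein_flat r.

End Gorenstein.

(* R[x]/(x^2): the pair (a, b) is the class of a + b x. *)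
Definition dnum (R : Type) : Type := (R * R)%type.

Section DualNumbers.
Variable R : pzRingType.

HB.instance Definition _ := GRing.Zmodule.copy (dnum R) (R * R)%type.

Definition dn_one : dnum R := (1, 0).
Definition dn_mul (u v : dnum R) : dnum R :=
  (u.1 * v.1, u.1 * v.2 + u.2 * v.1).

Fact dn_mulA : associative dn_mul.
Proof.
move=> u v w; congr (_, _); rewrite /= ?mulrA //.
by rewrite mulrDr mulrDl !mulrA addrA.
Qed.

Fact dn_mul1 : left_id dn_one dn_mul.
Proof. by case=> a b; congr (_, _); rewrite /= ?mul1r // mul0r addr0. Qed.

Fact dn_mulr1 : right_id dn_one dn_mul.
Proof. by case=> a b; congr (_, _); rewrite /= ?mulr1 // mulr0 add0r. Qed.

Fact dn_mulDl : left_distributive dn_mul +%R.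
Proof. by move=> u v w; congr (_, _); rewrite /= !mulrDl // addrACA. Qed.

Fact dn_mulDr : right_distributive dn_mul +%R.
Proof. by move=> u v w; congr (_, _); rewrite /= !mulrDr // addrACA. Qed.

HB.instance Definition _ := GRing.Zmodule_isPzRing.Build (dnum R)
  dn_mulA dn_mul1 dn_mulr1 dn_mulDl dn_mulDr.

Definition dn_const (a : R) : dnum R := (a, 0).
Definition dn_x : dnum R := (0, 1).

Definition dn_deg (n : int) : {pred dnum R} :=
  [pred u : dnum R | ((n == 0) || (u.1 == 0)) && ((n == -1) || (u.2 == 0))].

Lemma dn_sum (s : seq int) (c : int -> dnum R) :
  \sum_(n <- s) c n = (\sum_(n <- s) (c n).1, \sum_(n <- s) (c n).2).
Proof.
by elim: s => [|n s IHs]; rewrite ?big_nil // !big_cons IHs.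
Qed.

Fact dn_deg_grading : is_grading dn_deg.
Proof.
split.
- move=> n; split=> [|u v]; rewrite !inE /= ?eqxx ?orbT //.
  case/andP=> u1 u2 /andP[v1 v2]; apply/andP; split.
    by case: (n == 0) u1 v1 => //= /eqP-> /eqP->; rewrite subr0.
  by case: (n == -1) u2 v2 => //= /eqP-> /eqP->; rewrite subr0.
- move=> u; exists [:: 0; -1].
  exists (fun n => (if n == 0 then u.1 else 0, if n == -1 then u.2 else 0)).
  split=> [n|].
    by rewrite inE /=; case: (n == 0); case: (n == -1); rewrite ?eqxx.
  rewrite dn_sum !big_cons !big_nil /= !addr0 add0r.
  by case: u.
- move=> s c us cP; rewrite dn_sum => -[s1 s2] n ns.
  have c1 m : m != 0 -> (c m).1 = 0.
    by move=> m0; have := cP m; rewrite inE (negPf m0) /= => /andP[/eqP].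
  have c2 m : m != -1 -> (c m).2 = 0.
    by move=> m0; have := cP m; rewrite inE (negPf m0) /= => /andP[_ /eqP].
  suff [cn1 cn2] : (c n).1 = 0 /\ (c n).2 = 0.
    by move: cn1 cn2; case: (c n) => a b /= -> ->.
  split.
    have [n0|/c1//] := eqVneq n 0; rewrite -[RHS]s1; apply/esym/sum_single => //.
    by move=> m; rewrite n0; apply: c1.
  have [n0|/c2//] := eqVneq n (-1); rewrite -[RHS]s2; apply/esym/sum_single => //.
  by move=> m; rewrite n0; apply: c2.
Qed.

Fact dn_deg1 : 1 \in dn_deg 0.
Proof. by rewrite inE /= ?eqxx ?orbT. Qed.

Fact dn_degM i j (u v : dnum R) :
  u \in dn_deg i -> v \in dn_deg j -> u * v \in dn_deg (i + j).
Proof.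
rewrite !inE /= => /andP[u1 u2] /andP[v1 v2]; apply/andP; split.
  have [i0|i0] := eqVneq i 0; last first.
    by move: u1; rewrite (negPf i0) /= => /eqP->; rewrite mul0r eqxx orbT.
  have [j0|j0] := eqVneq j 0; first by rewrite i0 j0 addr0 eqxx.
  by move: v1; rewrite (negPf j0) /= => /eqP->; rewrite mulr0 eqxx orbT.
have [//|/= ij] := eqVneq (i + j) (-1).
have -> : u.1 * v.2 = 0.
  have [i0|i0] := eqVneq i 0; last first.
    by move: u1; rewrite (negPf i0) /= => /eqP->; rewrite mul0r.
  move: v2; rewrite -[j]add0r -[X in X + j]i0 (negPf ij) /= => /eqP->.
  by rewrite mulr0.
have -> : u.2 * v.1 = 0.
  have [j0|j0] := eqVneq j 0; last first.
    by move: v1; rewrite (negPf j0) /= => /eqP->; rewrite mulr0.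
  move: u2; rewrite -[i]addr0 -[X in i + X]j0 (negPf ij) /= => /eqP->.
  by rewrite mul0r.
by rewrite addr0.
Qed.

(* R in degree 0 and x in degree -1. *)
Definition dn_gring : gradedRing :=
  @GradedRing (dnum R) dn_deg dn_deg_grading dn_deg1 dn_degM.

Lemma dn_const_deg a : dn_const a \in rdeg dn_gring 0.
Proof. by rewrite inE /= ?eqxx ?orbT. Qed.

Lemma dn_x_deg : dn_x \in rdeg dn_gring (-1).
Proof. by rewrite inE /= ?eqxx ?orbT. Qed.

Lemma dn_constM a b : dn_const (a * b) = dn_const a * dn_const b.
Proof. by congr (_, _); rewrite /= mulr0 mul0r addr0. Qed.

Lemma dn_constD a b : dn_const (a + b) = dn_const a + dn_const b.
Proof. by congr (_, _); rewrite /= addr0. Qed.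

Lemma dn_xC a : dn_x * dn_const a = dn_const a * dn_x.
Proof. by congr (_, _); rewrite /= ?mul0r ?mulr0 // mul1r mulr1 addrC. Qed.

Lemma dn_xx : dn_x * dn_x = 0.
Proof. by congr (_, _); rewrite /= ?mul0r ?mulr0 // addr0. Qed.

Lemma dn_decomp (u : dnum R) : u = dn_const u.1 + dn_const u.2 * dn_x.
Proof.
by case: u => a b; congr (_, _); rewrite /= ?mulr0 ?mul0r ?mulr1 ?addr0 ?add0r.
Qed.

End DualNumbers.

Section PolyQuotient.
Variable R : nzRingType.

Definition poly_dnum (p : {poly R}) : dnum R := (p`_0, p`_1).

Lemma poly_dnum_is_additive : {morph poly_dnum : p q / p + q}.
Proof. by move=> p q; rewrite /poly_dnum !coefD. Qed.

Lemma poly_dnum_is_multiplicative : {morph poly_dnum : p q / p * q}.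
Proof.
move=> p q; rewrite /poly_dnum !coefM !big_ord_recl !big_ord0 /= !addr0.
by congr (_, _).
Qed.

Lemma poly_dnum1 : poly_dnum 1 = 1.
Proof. by rewrite /poly_dnum !coef1. Qed.

Lemma poly_dnum_epi : epi poly_dnum.
Proof.
case=> a b; exists (a%:P + b *: 'X).
by rewrite /poly_dnum !coefD !coefZ !coefC !coefX /= mulr0 mulr1 addr0 add0r.
Qed.

Lemma poly_dnum_eq0 p : poly_dnum p = 0 <-> exists q, p = q * 'X^2.
Proof.
split=> [[p0 p1]|[q ->]]; last by rewrite /poly_dnum !coefMXn.
exists (drop_poly 2 p); rewrite -[LHS](poly_take_drop 2).
suff -> : take_poly 2 p = 0 by rewrite add0r.
by apply/polyP=> -[|[|i]]; rewrite coef_take_poly coef0.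
Qed.
End PolyQuotient.

Section Phi.
Variables (R : pzRingType) (M : gradedModule (dn_gring R)).

Section Homogeneous.
Variable n : int.

Definition homog_pred : {pred M} := mdeg M n.

Fact homog_closed : zmod_closed homog_pred.
Proof. by case: (mdeg_grading M) => + _ _; apply. Qed.

HB.instance Definition _ := GRing.isZmodClosed.Build M homog_pred homog_closed.

Record homog := Homog { homog_val : M; homog_valP : homog_val \in homog_pred }.

HB.instance Definition _ := [isSub for homog_val].
HB.instance Definition _ := [Choice of homog by <:].
HB.instance Definition _ := [SubChoice_isSubZmodule of homog by <:].

Fact homog_scale_subproof (a : R) (u : homog) :
  (dn_const a : dn_gring R) *: homog_val u \in homog_pred.
Proof. by have := mdegZ (dn_const_deg a) (homog_valP u); rewrite add0r. Qed.

Definition homog_scale a u := Homog (homog_scale_subproof a u).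

Fact homog_scaleA a b u :
  homog_scale a (homog_scale b u) = homog_scale (a * b) u.
Proof. by apply: val_inj; rewrite /= scalerA dn_constM. Qed.

Fact homog_scale1 : left_id 1 homog_scale.
Proof. by move=> u; apply: val_inj; rewrite /= (scale1r (val u)). Qed.

Fact homog_scaleDr : right_distributive homog_scale +%R.
Proof. by move=> a u v; apply: val_inj; rewrite /= scalerDr. Qed.

Fact homog_scaleDl u : {morph homog_scale^~ u : a b / a + b}.
Proof. by move=> a b; apply: val_inj; rewrite /= dn_constD scalerDl. Qed.

HB.instance Definition _ := GRing.Zmodule_isLmodule.Build R homog
  homog_scaleA homog_scale1 homog_scaleDr homog_scaleDl.
End Homogeneous.

Fact Phi_diff_subproof n (u : homog (n + 1)) :
  (dn_x R : dn_gring R) *: homog_val u \in homog_pred n.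
Proof.
have := mdegZ (dn_x_deg R) (homog_valP u).
by rewrite (_ : -1 + (n + 1) = n) // addrC addrK.
Qed.

Definition Phi_diff n (u : homog (n + 1)) : homog n :=
  Homog (Phi_diff_subproof u).

Fact Phi_diff_linear n : linear (@Phi_diff n).
Proof.
move=> a u v; apply: val_inj; rewrite /= scalerDr; congr (_ + _).
by rewrite !scalerA dn_xC.
Qed.

HB.instance Definition _ n :=
  GRing.isLinear.Build R (homog (n + 1)) (homog n) *:%R (@Phi_diff n)
    (@Phi_diff_linear n).

Fact Phi_diffK n (u : homog (n + 1 + 1)) : Phi_diff (Phi_diff u) = 0.
Proof. by apply: val_inj; rewrite /= scalerA dn_xx scale0r. Qed.

Definition Phi : complex R :=
  @Complex R (fun n => homog n) (fun n => @Phi_diff n) Phi_diffK.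

End Phi.

Section PhiMorphism.
Variables (R : pzRingType) (M N : gradedModule (dn_gring R)).
Variable f : gradedHom M N.

Definition Phi_map_fun n (u : homog M n) : homog N n :=
  Homog (ghom_deg f (homog_valP u)).

Fact Phi_map_linear n : linear (@Phi_map_fun n).
Proof. by move=> a u v; apply: val_inj; rewrite /= linearP. Qed.

HB.instance Definition _ n :=
  GRing.isLinear.Build R (homog M n) (homog N n) *:%R (@Phi_map_fun n)
    (@Phi_map_linear n).

Fact Phi_mapE n (u : homog M (n + 1)) :
  Phi_map_fun (Phi_diff u) = Phi_diff (Phi_map_fun u).
Proof. by apply: val_inj; rewrite /= linearZ. Qed.

Definition Phi_map : chain_map (Phi M) (Phi N) :=
  @ChainMap R (Phi M) (Phi N) (fun n => @Phi_map_fun n) Phi_mapE.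
End PhiMorphism.

(* Psi X is the direct sum of the X_n, on which x acts by the differential. *)
Section Psi.
Variables (R : pzRingType) (X : complex R).

Record dsum := DSum {
  dsum_fun :> forall n, X n;
  dsum_supp : exists s : seq int, forall n, n \notin s -> dsum_fun n = 0 }.

Lemma dsumP (f g : dsum) : (forall n, f n = g n) -> f = g.
Proof.
case: f g => [f fP] [g gP] /= fg.
have {}fg : f = g by apply: functional_extensionality_dep.
by case: g / fg gP => gP; rewrite (Prop_irrelevance fP gP).
Qed.

HB.instance Definition _ := gen_eqMixin dsum.
HB.instance Definition _ := gen_choiceMixin dsum.

Fact dsum_zero_supp :
  exists s : seq int, forall n, n \notin s -> (0 : X n) = 0.
Proof. by exists [::]. Qed.

Fact dsum_opp_supp (f : dsum) :
  exists s : seq int, forall n, n \notin s -> - f n = 0.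
Proof. by case: (dsum_supp f) => s sP; exists s => n /sP->; rewrite oppr0. Qed.

Fact dsum_add_supp (f g : dsum) :
  exists s : seq int, forall n, n \notin s -> f n + g n = 0.
Proof.
case: (dsum_supp f) (dsum_supp g) => s sP [t tP]; exists (s ++ t) => n.
by rewrite mem_cat negb_or => /andP[/sP-> /tP->]; rewrite addr0.
Qed.

Definition dsum_zero := DSum dsum_zero_supp.
Definition dsum_opp f := DSum (dsum_opp_supp f).
Definition dsum_add f g := DSum (dsum_add_supp f g).

Fact dsum_addA : associative dsum_add.
Proof. by move=> f g h; apply: dsumP => n /=; rewrite addrA. Qed.
Fact dsum_addC : commutative dsum_add.
Proof. by move=> f g; apply: dsumP => n /=; rewrite addrC. Qed.
Fact dsum_add0 : left_id dsum_zero dsum_add.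
Proof. by move=> f; apply: dsumP => n /=; rewrite add0r. Qed.
Fact dsum_addN : left_inverse dsum_zero dsum_opp dsum_add.
Proof. by move=> f; apply: dsumP => n /=; rewrite addNr. Qed.

HB.instance Definition _ :=
  GRing.isZmodule.Build dsum dsum_addA dsum_addC dsum_add0 dsum_addN.

Fact dsum_scale_supp (a : dnum R) (f : dsum) :
  exists s : seq int, forall n, n \notin s ->
    a.1 *: f n + a.2 *: cdiff X n (f (n + 1)) = 0.
Proof.
case: (dsum_supp f) => s sP; exists (s ++ [seq n - 1 | n <- s]) => n.
rewrite mem_cat negb_or => /andP[/sP-> ns]; rewrite sP; last first.
  apply: contra ns => ns; apply/mapP; exists (n + 1) => //.
  by rewrite addrK.
by rewrite linear0 !scaler0 addr0.
Qed.

Definition dsum_scale a f := DSum (dsum_scale_supp a f).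

Fact dsum_scaleA a b f : dsum_scale a (dsum_scale b f) = dsum_scale (a * b) f.
Proof.
apply: dsumP => n /=; rewrite linearD !linearZ_LR cdiffK scaler0 addr0 scalerDr.
by rewrite !scalerA scalerDl addrA.
Qed.

Fact dsum_scale1 : left_id 1 dsum_scale.
Proof. by move=> f; apply: dsumP => n /=; rewrite scale1r scale0r addr0. Qed.

Fact dsum_scaleDr : right_distributive dsum_scale +%R.
Proof.
by move=> a f g; apply: dsumP => n /=; rewrite linearD !scalerDr addrACA.
Qed.

Fact dsum_scaleDl f : {morph dsum_scale^~ f : a b / a + b}.
Proof. by move=> a b; apply: dsumP => n /=; rewrite !scalerDl addrACA. Qed.

HB.instance Definition _ := GRing.Zmodule_isLmodule.Build (dnum R) dsum
  dsum_scaleA dsum_scale1 dsum_scaleDr dsum_scaleDl.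

Definition dsum_deg (n : int) : {pred dsum} :=
  [pred f : dsum | `[< forall m, m != n -> f m = 0 >]].

Lemma dsum_sum (s : seq int) (c : int -> dsum) m :
  (\sum_(n <- s) c n) m = \sum_(n <- s) c n m.
Proof. by elim: s => [|n s IHs]; rewrite ?big_nil // !big_cons -IHs. Qed.

Fact dsum_comp_supp (f : dsum) (n : int) :
  exists s : seq int, forall m, m \notin s -> (if m == n then f m else 0) = 0.
Proof.
by exists [:: n] => m; rewrite inE => /negPf->.
Qed.

Definition dsum_comp f n := DSum (dsum_comp_supp f n).

Fact dsum_deg_grading : is_grading dsum_deg.
Proof.
split.
- move=> n; split=> [|f g]; first by rewrite inE; apply/asboolP.
  rewrite !inE => /asboolP f0 /asboolP g0; apply/asboolP => m mn /=.
  by rewrite f0 // g0 // oppr0 addr0.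
- move=> f; case: (dsum_supp f) => s sP; exists (undup s), (dsum_comp f); split.
    by move=> n; rewrite inE; apply/asboolP => m /= /negPf->.
  apply: dsumP => m; rewrite dsum_sum /=.
  have [ms|ms] := boolP (m \in undup s); last first.
    rewrite mem_undup in ms; rewrite sP // big1_seq // => n /andP[_].
    rewrite mem_undup => ns.
    by case: eqP => // mn; rewrite mn ns in ms.
  rewrite (@sum_single m) ?undup_uniq ?eqxx // => n nm.
  by rewrite eq_sym (negPf nm).
- move=> s c us cP s0 n ns; apply: dsumP => m.
  have [->|mn] := eqVneq m n; last first.
    by have := cP n; rewrite inE => /asboolP/(_ m mn).
  rewrite -[RHS]/((0 : dsum) n) -s0 dsum_sum; apply/esym/sum_single => // k kn.
  by have := cP k; rewrite inE => /asboolP/(_ n); apply; rewrite eq_sym.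
Qed.

Fact dsum_degZ i j (a : dn_gring R) (f : dsum) :
  a \in rdeg (dn_gring R) i -> f \in dsum_deg j ->
  a *: f \in dsum_deg (i + j).
Proof.
rewrite !inE /= => /andP[a1 a2] /asboolP fj; apply/asboolP => m mij /=.
have -> : a.1 *: f m = 0.
  have [i0|i0] := eqVneq i 0; last first.
    by move: a1; rewrite (negPf i0) /= => /eqP->; rewrite scale0r.
  by rewrite fj ?scaler0 // -[j]add0r -[X in X + j]i0.
have -> : a.2 *: cdiff X m (f (m + 1)) = 0.
  have [i0|i0] := eqVneq i (-1); last first.
    by move: a2; rewrite (negPf i0) /= => /eqP->; rewrite scale0r.
  rewrite fj ?linear0 ?scaler0 //; apply: contra mij => /eqP<-.
  by rewrite i0 addrC addrK.
by rewrite addr0.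
Qed.

Definition Psi : gradedModule (dn_gring R) :=
  @GradedModule (dn_gring R) dsum dsum_deg dsum_deg_grading dsum_degZ.

End Psi.

Section PhiPsi.
Variables (R : pzRingType) (X : complex R).

Let ev n (u : homog (Psi X) n) : X n := (homog_val u : dsum X) n.

Fact ev_linear n : linear (@ev n).
Proof. by move=> a u v; rewrite /ev /= scale0r addr0. Qed.

HB.instance Definition _ n :=
  GRing.isLinear.Build R (homog (Psi X) n) (X n) *:%R (@ev n) (@ev_linear n).

Fact ev_diff n (u : homog (Psi X) (n + 1)) :
  ev (Phi_diff u) = cdiff X n (ev u).
Proof. by rewrite /ev /= scale0r scale1r add0r. Qed.

Fact dsum_single_supp n (x : X n) : exists s : seq int, forall m, m \notin s ->
  (if @eqP _ n m is ReflectT e then ecast k (X k) e x else 0) = 0.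
Proof.
by exists [:: n] => m; rewrite inE => mn; case: eqP => // e; rewrite e eqxx in mn.
Qed.

Definition dsum_single n (x : X n) := DSum (dsum_single_supp x).

Lemma dsum_singleE n (x : X n) : dsum_single x n = x.
Proof. by rewrite /=; case: eqP => // e; rewrite eq_axiomK. Qed.

Fact dsum_single_deg n (x : X n) : dsum_single x \in mdeg (Psi X) n.
Proof.
rewrite inE; apply/asboolP => m mn /=.
by case: eqP => // e; rewrite e eqxx in mn.
Qed.

Lemma Phi_PsiK : exists f : chain_map (Phi (Psi X)) X, forall n, bijective (f n).
Proof.
exists (@ChainMap R (Phi (Psi X)) X (fun n => @ev n) ev_diff) => n.
exists (fun x => Homog (dsum_single_deg x)) => [u|x]; last exact: dsum_singleE.
apply/val_inj/dsumP => m; have [->|mn] := eqVneq m n; first exact: dsum_singleE.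
have := dsum_single_deg (ev u); have := homog_valP u; rewrite !inE.
by move=> /asboolP/(_ m mn) u0 /asboolP/(_ m mn) v0; rewrite [RHS]u0 [LHS]v0.
Qed.
End PhiPsi.

Section PsiPhi.
Variables (R : pzRingType) (M : gradedModule (dn_gring R)).
Notation PM := (dsum (Phi M)).

Lemma sum_supp (V : zmodType) (s t : seq int) (c : int -> V) :
  uniq s -> uniq t -> (forall n, n \notin s -> c n = 0) ->
  (forall n, n \notin t -> c n = 0) -> \sum_(n <- s) c n = \sum_(n <- t) c n.
Proof.
have filt (r : seq int) : \sum_(n <- r) c n = \sum_(n <- r | c n != 0) c n.
  by rewrite [RHS]big_mkcond; apply: eq_bigr => n _; case: eqP.
move=> us ut s0 t0; rewrite filt [RHS]filt -big_filter -[RHS]big_filter.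
apply/perm_big/uniq_perm.
- exact: filter_uniq.
- exact: filter_uniq.
- move=> n; rewrite !mem_filter; have [//|cn] := eqVneq (c n) 0.
  have [/t0|] := boolP (n \notin t); first by move/eqP; rewrite (negPf cn).
  have [/s0|] := boolP (n \notin s); first by move/eqP; rewrite (negPf cn).
  by rewrite !negbK => -> ->.
Qed.

Definition supp (f : PM) : seq int := undup (projT1 (cid (dsum_supp f))).

Lemma suppP (f : PM) n : n \notin supp f -> f n = 0.
Proof. by rewrite mem_undup; case: cid => s /= sP /sP. Qed.

Definition total (f : Psi (Phi M)) : M :=
  \sum_(n <- supp f) homog_val ((f : PM) n).

Lemma totalE (f : PM) s : uniq s -> (forall n, n \notin s -> f n = 0) ->
  total f = \sum_(n <- s) homog_val (f n).
Proof.
move=> us sP; apply: sum_supp; rewrite ?undup_uniq // => n ns.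
  by rewrite suppP.
by rewrite sP.
Qed.

Lemma totalD (f g : PM) : total (f + g) = total f + total g.
Proof.
pose s := undup (supp f ++ supp g).
have fs n : n \notin s -> f n = 0.
  by rewrite mem_undup mem_cat negb_or => /andP[/suppP].
have gs n : n \notin s -> g n = 0.
  by rewrite mem_undup mem_cat negb_or => /andP[_ /suppP].
rewrite (totalE (undup_uniq _) fs) (totalE (undup_uniq _) gs) -big_split.
by rewrite (@totalE (f + g) s) ?undup_uniq // => n ns /=; rewrite fs ?gs ?addr0.
Qed.

Lemma totalZ (a : dnum R) (f : PM) : total (a *: f) = (a : dn_gring R) *: total f.
Proof.
pose s := undup (supp f ++ [seq n - 1 | n <- supp f]).
have fs n : n \notin s -> f n = 0.
  by rewrite mem_undup mem_cat negb_or => /andP[/suppP].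
have fs1 n : n \notin s -> f (n + 1) = 0.
  rewrite mem_undup mem_cat negb_or => /andP[_ ns]; apply: suppP.
  by apply: contra ns => ns; apply/mapP; exists (n + 1); rewrite ?addrK.
have fs2 n : n \notin [seq n + 1 | n <- s] -> f n = 0.
  move=> ns; apply: suppP; apply: contra ns => ns; apply/mapP.
  exists (n - 1); rewrite ?subrK // mem_undup mem_cat; apply/orP; right.
  by apply/mapP; exists n.
have us : uniq s := undup_uniq _.
rewrite (@totalE (a *: f) s) //; last first.
  by move=> n ns /=; rewrite fs // fs1 // linear0 !scaler0 addr0.
rewrite [in RHS](dn_decomp a) scalerDl {1}(totalE us fs) (totalE _ fs2); last first.
  by rewrite map_inj_uniq //; apply: addIr.
rewrite big_map !scaler_sumr -big_split; apply: eq_bigr => n _ /=.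
by rewrite -scalerA.
Qed.

Fact total_linear : linear total.
Proof. by move=> a f g; rewrite -totalZ -totalD. Qed.

HB.instance Definition _ :=
  GRing.isLinear.Build (dnum R) (Psi (Phi M)) M *:%R total total_linear.

Fact total_deg n (f : PM) : f \in mdeg (Psi (Phi M)) n -> total f \in mdeg M n.
Proof.
rewrite inE => /asboolP fn; rewrite (@totalE f [:: n]) //; last first.
  by move=> m; rewrite inE; apply: fn.
by rewrite big_seq1; apply: (homog_valP (f n)).
Qed.

Fact total_inj : injective total.
Proof.
suff inj0 (f : PM) : total f = 0 -> f = 0.
  move=> f g fg; apply/eqP; rewrite -subr_eq0; apply/eqP/inj0.
  by rewrite -scaleN1r totalD totalZ fg scaleN1r subrr.
move=> f0; apply: dsumP => n; have [ns|/suppP//] := boolP (n \in supp f).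
case: (mdeg_grading M) => _ _ /(_ (supp f) (fun n => homog_val (f n))) ind.
apply: val_inj; apply: (ind _ _ f0 n ns); first exact: undup_uniq.
by move=> m; apply: (homog_valP (f m)).
Qed.

Fact total_epi : epi total.
Proof.
move=> v; case: (mdeg_grading M) => _ /(_ v)[s [c [cP ->]]] _.
elim: s => [|n s [f IHs]]; first by exists 0; rewrite big_nil linear0.
exists (dsum_single (X := Phi M) (Homog (cP n)) + f).
rewrite big_cons -IHs totalD (@totalE (dsum_single _) [:: n]) //.
  by rewrite big_seq1 dsum_singleE.
by move=> m mn; have := dsum_single_deg (X := Phi M) (Homog (cP n));
  rewrite inE => /asboolP; apply; rewrite inE in mn.
Qed.

Lemma Psi_PhiK : exists f : gradedHom (Psi (Phi M)) M, injective f /\ epi f.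
Proof.
exists (@GradedHom (dn_gring R) (Psi (Phi M)) M total total_deg).
by split; [apply: total_inj | apply: total_epi].
Qed.

End PsiPhi.

(* Main.v *)
From HB Require Import structures.
From mathcomp Require Import all_boot all_order all_algebra.
From mathcomp Require Import generic_quotient boolp zify.
Require Import Defs.

(** A graded module over A = R[x]/(x^2) is a complex, and A is a Frobenius
    extension of R: the induced and the coinduced module of an R-module V are
    both V * V with x (v, w) = (0, v). This makes the Gorenstein classes over A
    as simple as they can be.

    If M is any graded A-module, the cones of the identity of its shifts form an
    unbounded exact sequence in which M is a kernel, and the sequence has an
    R-linear contraction rho ([cres_rhoE]). A cone is both induced and coinduced,
    so it is graded projective, injective or flat as soon as the components M_n
    are so over R. A graded projective or injective module P is a summand of a
    cone, so it has an R-linear contraction s with x s + s x = 1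
    ([gr_projective_contractible], [gr_injective_contractible]). Averaging rho
    against s makes Hom(T, P), Hom(P, T) and P (x) T contractible over A, where T
    is the sequence of cones. Hence M is Gorenstein-projective (injective,
    flat) whenever its components are projective (injective, flat) over R.

    Now let X be a complex whose terms have projective or flat dimension at most r,
    as those of a dg-r-projective or dg-r-flat complex do. Covering X by a
    contractible complex of projectives lowers the dimension of all terms by one
    ([left_dim_syzygy]); after r steps a complex with terms in the class remains,
    and the steps splice to the required resolution ([Psi_left_dim]). For
    injectives one embeds X into a contractible complex of injectives instead
    ([disk_envelope], [Psi_right_dim]). Projective and flat modules are treated
    together as resolving classes; that flat modules form such a class rests on
    the purity lemma [flat_pure].

    In the other direction let every left R-module have projective dimension at
    most l. The components of projective, injective and flat graded modules are of
    the same kind over R, so the components of a Gorenstein module are cycles of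
    unbounded exact complexes over R. Such cycles are l-th syzygies (cosyzygies),
    hence projective, flat or injective themselves ([syzygy_left],
    [syzygy_injective]), and the terms of Phi M have dimension at most r. It
    remains to see that maps X -> B (or Y -> X) are null homotopic for exact B
    (or Y) with cycles in the orthogonal class. The terms of B are then orthogonal
    to the terms of X, so that a short exact sequence of complexes ending in X
    gives a short exact sequence of Hom complexes into B. Dimension shifting
    first in X, then in the cycles of B, reduces to the case of a zero complex
    ([null_dg_left], [null_dg_right]). *)

Set Implicit Arguments.
Unset Strict Implicit.
Unset Printing Implicit Defensive.

Import GRing.Theory.
Local Open Scope ring_scope.

(** * Linear maps *)

Section LinearMaps.
Variable R : pzRingType.
Implicit Types U V W : lmodType R.

Definition linear_map U V (f : U -> V) (f_lin : linear f) : {linear U -> V} :=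
  HB.pack f (GRing.isLinear.Build R U V *:%R f f_lin).

Lemma epi_factor U V W (p : {linear U -> V}) (f : {linear U -> W}) :
  epi p -> (forall x, p x = 0 -> f x = 0) ->
  exists g : {linear V -> W}, forall x, g (p x) = f x.
Proof.
move=> pE f0; have [s sK] := choice pE.
have fs x y : p x = p y -> f x = f y.
  by move=> pxy; apply/eqP; rewrite -subr_eq0 -linearB f0 ?linearB ?pxy ?subrr.
have gl : linear (f \o s).
  by move=> a u v /=; rewrite -linearP; apply: fs; rewrite linearP !sK.
by exists (linear_map gl) => x /=; apply: fs; rewrite sK.
Qed.

Lemma mono_factor U V W (i : {linear U -> V}) (f : {linear W -> V}) :
  injective i -> (forall x, exists y, i y = f x) ->
  exists g : {linear W -> U}, forall x, i (g x) = f x.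
Proof.
move=> iI /choice[s sK].
have gl : linear s.
  by move=> a u v /=; apply: iI; rewrite linearP !sK linearP.
by exists (linear_map gl).
Qed.

Lemma linear_inj0 U V (f : {linear U -> V}) :
  (forall x, f x = 0 -> x = 0) -> injective f.
Proof.
move=> f0 x y fxy; apply/eqP; rewrite -subr_eq0; apply/eqP/f0.
by rewrite linearB fxy subrr.
Qed.

Lemma inj0 U V (f : {linear U -> V}) x : injective f -> f x = 0 -> x = 0.
Proof. by move=> fI fx; apply: fI; rewrite fx linear0. Qed.

Lemma exact0 U V W (f : {linear U -> V}) (g : {linear V -> W}) x :
  exact f g -> g (f x) = 0.
Proof. by move=> fg; apply/fg; exists x. Qed.

Lemma copair_linear U V W (f : {linear U -> W}) (g : {linear V -> W}) :
  linear (fun x : (U * V)%type => f x.1 + g x.2).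
Proof. by move=> a x y /=; rewrite !linearP scalerDr addrACA. Qed.

Definition copair U V W (f : {linear U -> W}) (g : {linear V -> W}) :
  {linear (U * V)%type -> W} := linear_map (copair_linear f g).

Lemma pair_map_linear U V W (f : {linear W -> U}) (g : {linear W -> V}) :
  linear (fun x => (f x, g x)).
Proof. by move=> a x y; rewrite !linearP. Qed.

Definition pair_map U V W (f : {linear W -> U}) (g : {linear W -> V}) :
  {linear W -> (U * V)%type} := linear_map (pair_map_linear f g).

Definition kerv U V (f : {linear U -> V}) : {linear ker f -> U} := val.

Lemma kervP U V (f : {linear U -> V}) x : f (kerv f x) = 0.
Proof. by have := ker_valP x; rewrite inE => /eqP. Qed.

Lemma kerv_inj U V (f : {linear U -> V}) : injective (kerv f).
Proof. exact: val_inj. Qed.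

Lemma kerv_onto U V (f : {linear U -> V}) x :
  f x = 0 -> exists y, kerv f y = x.
Proof. by move=> /eqP fx; exists (Ker fx). Qed.

Lemma kerv_exact U V (f : {linear U -> V}) : exact (kerv f) f.
Proof.
move=> y; split=> [|[x <-]]; [exact: kerv_onto | exact: kervP].
Qed.

Section KerLift.
Variables (U V W : lmodType R) (f : {linear U -> V}) (g : {linear W -> U}).
Hypothesis fg0 : forall x, f (g x) = 0.

Fact ker_lift_subproof x : g x \in ker_pred f.
Proof. by rewrite inE fg0. Qed.

Definition ker_lift_fun x := Ker (ker_lift_subproof x).

Fact ker_lift_linear : linear ker_lift_fun.
Proof. by move=> a x y; apply: val_inj; rewrite /= linearP. Qed.

Definition ker_lift : {linear W -> ker f} := linear_map ker_lift_linear.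
End KerLift.

Definition short_exact U V W (i : {linear U -> V}) (p : {linear V -> W}) :=
  [/\ injective i, exact i p & epi p].

Lemma short_exact_ker U V (p : {linear U -> V}) : epi p -> short_exact (kerv p) p.
Proof. by split; [apply: kerv_inj | apply: kerv_exact |]. Qed.

Lemma zero_linear U V : linear (fun _ : U => 0 : V).
Proof. by move=> a x y; rewrite scaler0 addr0. Qed.

Lemma trivial_zero : trivial_mod 'rV[R]_0.
Proof. by move=> v; apply/matrixP => i []. Qed.

End LinearMaps.

Lemma linear_inverse (R : pzRingType) (U V : lmodType R) (f : {linear U -> V}) :
  injective f -> epi f ->
  exists g : {linear V -> U}, (forall x, g (f x) = x) /\ forall y, f (g y) = y.
Proof.
move=> fI fE; have [g gK] := mono_factor (f := idfun) fI fE.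
by exists g; split=> // x; apply: fI; rewrite gK.
Qed.

(** * Finitely supported sums *)

Section FiniteSums.
Variables (K : eqType) (V : zmodType).
Implicit Types (c : K -> V) (s : seq K).

Definition finsupp c := exists s, forall k, k \notin s -> c k = 0.

(** The support of c is not part of the data, so it is chosen; the sum does not
    depend on the choice, and is 0 by convention if there is none. *)
Definition fsum c : V :=
  if pselect (finsupp c) is left cP
  then \sum_(k <- undup (projT1 (cid cP))) c k else 0.

Lemma fsumE c s : uniq s -> (forall k, k \notin s -> c k = 0) ->
  fsum c = \sum_(k <- s) c k.
Proof.
move=> us s0; rewrite /fsum; case: pselect => [cP|[]]; last by exists s.
case: cid => t t0 /=.
have filt (r : seq K) : \sum_(n <- r) c n = \sum_(n <- r | c n != 0) c n.
  by rewrite [RHS]big_mkcond; apply: eq_bigr => n _; case: eqP.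
rewrite filt [RHS]filt -big_filter -[RHS]big_filter.
apply/perm_big/uniq_perm.
- by rewrite filter_uniq ?undup_uniq.
- exact: filter_uniq.
move=> k; rewrite !mem_filter mem_undup; have [//|ck] := eqVneq (c k) 0.
have [/t0/eqP|] := boolP (k \notin t); first by rewrite (negPf ck).
have [/s0/eqP|] := boolP (k \notin s); first by rewrite (negPf ck).
by rewrite !negbK => -> ->.
Qed.

Lemma fsumD c c' : finsupp c -> finsupp c' ->
  fsum (fun k => c k + c' k) = fsum c + fsum c'.
Proof.
move=> [s sP] [t tP]; pose r := undup (s ++ t).
have r1 k : k \notin r -> c k = 0.
  by rewrite mem_undup mem_cat negb_or => /andP[/sP].
have r2 k : k \notin r -> c' k = 0.
  by rewrite mem_undup mem_cat negb_or => /andP[_ /tP].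
have ur : uniq r := undup_uniq _.
rewrite (fsumE ur r1) (fsumE ur r2) -big_split; apply: fsumE => // k kr.
by rewrite r1 ?r2 ?addr0.
Qed.

Lemma fsum_single k c : (forall k', k' != k -> c k' = 0) -> fsum c = c k.
Proof.
by move=> ck; rewrite (@fsumE c [:: k]) ?big_seq1 // => k'; rewrite inE => /ck.
Qed.

End FiniteSums.

Lemma fsum_morph (K : eqType) (V W : zmodType) (f : {additive V -> W})
  (c : K -> V) : finsupp c -> fsum (fun k => f (c k)) = f (fsum c).
Proof.
move=> [s sP]; have s1 k : k \notin undup s -> c k = 0 by rewrite mem_undup => /sP.
rewrite (fsumE (undup_uniq s) s1) raddf_sum; apply: fsumE; rewrite ?undup_uniq //.
by move=> k /s1->; rewrite raddf0.
Qed.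

(** * Free modules *)

Section Free.
Variables (R : pzRingType) (K : eqType).

Record free := Free { free_fun :> K -> R; free_supp : finsupp free_fun }.

Lemma freeP (f g : free) : (forall k, f k = g k) -> f = g.
Proof.
case: f g => [f fP] [g gP] /= fg.
have {}fg : f = g by apply: functional_extensionality_dep.
by case: g / fg gP => gP; rewrite (Prop_irrelevance fP gP).
Qed.

HB.instance Definition _ := gen_eqMixin free.
HB.instance Definition _ := gen_choiceMixin free.

Fact free_zero_supp : finsupp (fun _ : K => 0 : R).
Proof. by exists [::]. Qed.

Fact free_opp_supp (f : free) : finsupp (fun k => - f k).
Proof. by case: (free_supp f) => s sP; exists s => k /sP->; rewrite oppr0. Qed.

Fact free_add_supp (f g : free) : finsupp (fun k => f k + g k).
Proof.
case: (free_supp f) (free_supp g) => s sP [t tP]; exists (s ++ t) => k.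
by rewrite mem_cat negb_or => /andP[/sP-> /tP->]; rewrite addr0.
Qed.

Fact free_scale_supp a (f : free) : finsupp (fun k => a * f k).
Proof. by case: (free_supp f) => s sP; exists s => k /sP->; rewrite mulr0. Qed.

Definition free_zero := Free free_zero_supp.
Definition free_opp f := Free (free_opp_supp f).
Definition free_add f g := Free (free_add_supp f g).
Definition free_scale a f := Free (free_scale_supp a f).

Fact free_addA : associative free_add.
Proof. by move=> f g h; apply: freeP => k /=; rewrite addrA. Qed.
Fact free_addC : commutative free_add.
Proof. by move=> f g; apply: freeP => k /=; rewrite addrC. Qed.
Fact free_add0 : left_id free_zero free_add.
Proof. by move=> f; apply: freeP => k /=; rewrite add0r. Qed.
Fact free_addN : left_inverse free_zero free_opp free_add.
Proof. by move=> f; apply: freeP => k /=; rewrite addNr. Qed.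

HB.instance Definition _ :=
  GRing.isZmodule.Build free free_addA free_addC free_add0 free_addN.

Fact free_scaleA a b f : free_scale a (free_scale b f) = free_scale (a * b) f.
Proof. by apply: freeP => k /=; rewrite mulrA. Qed.
Fact free_scale1 : left_id 1 free_scale.
Proof. by move=> f; apply: freeP => k /=; rewrite mul1r. Qed.
Fact free_scaleDr : right_distributive free_scale +%R.
Proof. by move=> a f g; apply: freeP => k /=; rewrite mulrDr. Qed.
Fact free_scaleDl f : {morph free_scale^~ f : a b / a + b}.
Proof. by move=> a b; apply: freeP => k /=; rewrite mulrDl. Qed.

HB.instance Definition _ := GRing.Zmodule_isLmodule.Build R free
  free_scaleA free_scale1 free_scaleDr free_scaleDl.

Fact free_basis_supp (k0 : K) : finsupp (fun k : K => (k == k0)%:R : R).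
Proof. by exists [:: k0] => k; rewrite inE => /negPf->. Qed.

Definition free_basis k0 := Free (free_basis_supp k0).

Lemma free_coord_linear k : linear (fun f : free => f k : R^o).
Proof. by []. Qed.

Definition free_coord k : {linear free -> R^o} := linear_map (free_coord_linear k).

Lemma free_decomp (f : free) s : uniq s -> (forall k, k \notin s -> f k = 0) ->
  f = \sum_(k <- s) f k *: free_basis k.
Proof.
move=> us s0; apply: freeP => k.
have -> : (\sum_(j <- s) f j *: free_basis j) k = \sum_(j <- s) f j * (k == j)%:R.
  by elim: (s) => [|j t IHt]; rewrite ?big_nil // !big_cons -IHt.
have [ks|ks] := boolP (k \in s).
  rewrite (bigD1_seq k) //= eqxx mulr1 big1 ?addr0 // => j.
  by rewrite eq_sym => /negPf->; rewrite mulr0.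
rewrite s0 // big1_seq // => j /andP[_ js].
have [kj|_] := eqVneq k j; last by rewrite mulr0.
by rewrite kj js in ks.
Qed.

Section Eval.
Variables (M : lmodType R) (m : K -> M).

Let term_supp (f : free) : finsupp (fun k => f k *: m k).
Proof. by case: (free_supp f) => s sP; exists s => k /sP->; rewrite scale0r. Qed.

Lemma free_eval_linear : linear (fun f : free => fsum (fun k => f k *: m k)).
Proof.
move=> a f g; have asupp : finsupp (fun k => a *: (f k *: m k)).
  by have [s sP] := term_supp f; exists s => k /sP->; rewrite scaler0.
rewrite -(fsum_morph ( *:%R a) (term_supp f)) -fsumD //.
by congr fsum; apply: functional_extensionality_dep => k /=;
  rewrite scalerDl scalerA.
Qed.

Definition free_eval : {linear free -> M} := linear_map free_eval_linear.

Lemma free_evalE k : free_eval (free_basis k) = m k.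
Proof.
rewrite /= (@fsum_single _ _ k) ?eqxx ?scale1r // => j /negPf->.
by rewrite scale0r.
Qed.
End Eval.

Lemma free_linear_ext (M : lmodType R) (f g : {linear free -> M}) :
  (forall k, f (free_basis k) = g (free_basis k)) -> forall x, f x = g x.
Proof.
move=> fg x; have [s sP] := free_supp x.
rewrite (@free_decomp x (undup s)) ?undup_uniq //; last first.
  by move=> k; rewrite mem_undup => /sP.
by rewrite !linear_sum; apply: eq_bigr => k _; rewrite !linearZ fg.
Qed.

Lemma free_projective : projective free.
Proof.
move=> M N g f gE; have [m mP] := choice (fun k => gE (f (free_basis k))).
exists (free_eval m); apply: (free_linear_ext (f := g \o free_eval m)) => k.
by rewrite [LHS]/= -[RHS]mP -free_evalE.
Qed.

End Free.

Lemma enough_projectives (R : pzRingType) (M : lmodType R) :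
  exists (P : lmodType R) (p : {linear P -> M}), projective P /\ epi p.
Proof.
exists (free R M), (free_eval (@id M)); split; first exact: free_projective.
by move=> y; exists (free_basis R y); rewrite free_evalE.
Qed.

(** * Modules of bounded dimension *)

Section Dimension.
Variables (R : pzRingType) (K : lmodType R -> Prop).
Implicit Types M N C : lmodType R.

Lemma left_dimS k N C M (i : {linear N -> C}) (p : {linear C -> M}) :
  short_exact i p -> K C -> left_dim_le K k N -> left_dim_le K k.+1 M.
Proof.
case=> iI ip pE KC [D [d [e [[eE de dd] KD D0]]]].
pose C' j : lmodType R := if j is j'.+1 then D j' else C.
pose d' j : {linear C' j.+1 -> C' j} :=
  match j with 0 => i \o e | j'.+1 => d j' end.
exists C', d', p; split; [split=> // | by case | by case].
- move=> y; rewrite ip; split=> [[x <-]|[x <-]]; last by exists (e x).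
  by have [z <-] := eE x; exists z.
- case=> [|j] y; last exact: dd.
  apply: iff_trans (de y); rewrite /=.
  by split=> [/(inj0 iI)//|->]; rewrite linear0.
Qed.

Lemma left_dimS_inv k M : left_dim_le K k.+1 M ->
  exists (N C : lmodType R) (i : {linear N -> C}) (p : {linear C -> M}),
  [/\ short_exact i p, K C & left_dim_le K k N].
Proof.
move=> [C [d [e [[eE de dd] KC C0]]]].
exists (ker e), (C 0%N), (kerv e), e; split; [exact: short_exact_ker|exact: KC|].
pose e' := ker_lift (fun x => exact0 x de).
exists (fun j => C j.+1), (fun j => d j.+1), e'; split.
- split=> // [y|y]; last first.
    rewrite -dd; split=> [y0|dy]; last exact: val_inj.
    by have := congr1 (kerv e) y0.
  have [x xP] := (de (kerv e y)).1 (kervP y).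
  by exists x; apply: kerv_inj.
- by move=> j jk; apply: KC.
- by move=> j jk; apply: C0.
Qed.

Lemma left_dimW k k' M : (forall N, trivial_mod N -> K N) -> (k <= k')%N ->
  left_dim_le K k M -> left_dim_le K k' M.
Proof.
move=> K0 kk [C [d [e [res KC C0]]]]; exists C, d, e; split=> //.
- by move=> j _; have [/KC//|/C0/K0] := leqP j k.
- by move=> j jk; apply/C0/(leq_ltn_trans kk).
Qed.

End Dimension.

Lemma left_dim_sub (R : pzRingType) (K K' : lmodType R -> Prop) k M :
  (forall N, K N -> K' N) -> left_dim_le K k M -> left_dim_le K' k M.
Proof.
by move=> KK [C [d [e [res KC C0]]]]; exists C, d, e; split=> // j /KC/KK.
Qed.

(** What dimension shifting needs from a class of modules. Projective and flat
    modules both qualify, which lets the two cases be treated at once. *)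
Definition resolving (R : pzRingType) (K : lmodType R -> Prop) :=
  [/\ forall P, projective P -> K P,
      forall (L E F : lmodType R) (i : {linear L -> E}) (p : {linear E -> F}),
        short_exact i p -> K L -> K F -> K E
    & forall (L E F : lmodType R) (i : {linear L -> E}) (p : {linear E -> F}),
        short_exact i p -> K E -> K F -> K L].

Section Resolving.
Variables (R : pzRingType) (K : lmodType R -> Prop).
Hypothesis K_res : resolving K.
Implicit Types L M N E F G : lmodType R.

Lemma trivial_projective M : trivial_mod M -> projective M.
Proof.
move=> M0 N N' g f gE; exists (linear_map (@zero_linear _ M N)) => x.
by rewrite [x]M0 !linear0.
Qed.

Lemma resolving_trivial M : trivial_mod M -> K M.
Proof. by move=> /trivial_projective; case: K_res => + _ _; apply. Qed.

(** An isomorphism is the kernel of a map to zero. *)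
Lemma resolving_iso M N (f : {linear M -> N}) :
  injective f -> epi f -> K N -> K M.
Proof.
move=> fI fE KN; case: K_res => _ _ Kker.
apply: (Kker _ _ _ f (linear_map (@zero_linear _ N 'rV[R]_0))) => //; last exact/resolving_trivial/trivial_zero.
by split=> // y; exists 0; rewrite [y]trivial_zero linear0.
Qed.

Lemma left_dim0 M : left_dim_le K 0 M <-> K M.
Proof.
split=> [[C [d [e [[eE de dd] KC C0]]]]|KM].
  have eI : injective e.
    apply: linear_inj0 => x /de[y <-].
    by rewrite (C0 1%N isT y) linear0.
  have [f [fe ef]] := linear_inverse eI eE.
  apply: (@resolving_iso _ _ f); last exact: KC.
    exact: can_inj ef.
  by move=> x; exists (e x).
pose C j : lmodType R := if j is _.+1 then 'rV[R]_0 else M.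
exists C, (fun j => linear_map (@zero_linear _ (C j.+1) (C j))), idfun.
split; [split | by case | by case=> // j _; apply: trivial_zero].
- by move=> y; exists y.
- by move=> y; split=> [y0|[_ <-]//]; exists 0.
- by move=> j y; split=> // _; exists 0; rewrite [y]trivial_zero.
Qed.

Lemma inl_linear M N : linear (fun x : M => (x, 0 : N)).
Proof. by move=> a x y; congr (_, _); rewrite /= scaler0 addr0. Qed.

Lemma inr_linear M N : linear (fun x : N => (0 : M, x)).
Proof. by move=> a x y; congr (_, _); rewrite /= scaler0 addr0. Qed.

Lemma short_exact_prod M N :
  short_exact (linear_map (@inl_linear M N)) (snd : {linear (M * N)%type -> N}).
Proof.
split=> [x y [//]|[x y] /=|y]; last by exists (0, y).
by split=> [->|[z [_ <-]]//]; exists x.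
Qed.

Lemma resolving_prod M N : K M -> K N -> K (M * N)%type.
Proof.
by move=> KM KN; case: K_res => _ Kext _; apply: Kext (short_exact_prod M N) _ _.
Qed.

(** A first step H -> L of a resolution of L and a projective cover P of E cover E
    together. The kernel is again an extension, of the kernel of P -> F by the
    kernel of H -> L, which allows induction. *)
Lemma left_dim_ext k L E F (i : {linear L -> E}) (p : {linear E -> F}) :
  short_exact i p -> left_dim_le K k L -> K F -> left_dim_le K k E.
Proof.
case: (K_res) => Kproj Kext Kker.
elim: k L E F i p => [|k IHk] L E F i p ip.
  by rewrite !left_dim0; apply: Kext ip.
move=> /left_dimS_inv[N [H [j [h [jh KH dN]]]]] KF.
have [P [q [/Kproj KP qE]]] := enough_projectives E.
case: ip jh => iI ip pE [jI jh hE].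
pose c := copair (i \o h) q.
have cE : epi c.
  by move=> y; have [x <-] := qE y; exists (0, x); rewrite /= !linear0 add0r.
apply: left_dimS (short_exact_ker cE) (resolving_prod KH KP) _.
have KpP : K (ker (p \o q)).
  apply: Kker (short_exact_ker _) KP KF.
  by move=> y; have [x <-] := pE y; have [z <-] := qE x; exists z.
have j0 x : c ((linear_map (@inl_linear H P) \o j) x) = 0.
  by rewrite /= (exact0 _ jh) !linear0 addr0.
have s0 (x : ker c) : (p \o q) (((snd : {linear (H * P)%type -> P}) \o kerv c) x) = 0.
  have /eqP := kervP x; rewrite /= addrC addr_eq0 => /eqP->.
  by rewrite linearN (exact0 _ ip) oppr0.
apply: (IHk _ _ _ (ker_lift j0) (ker_lift s0)) => //; split.
- by move=> x y /(congr1 val)[] /jI.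
- move=> y; split=> [y0|[x <-]]; last exact: val_inj.
  have /= y2 : (kerv c y).2 = 0 := congr1 val y0.
  have := kervP y; rewrite /= y2 linear0 addr0 => /(inj0 iI)/jh[x xP].
  by exists x; apply: val_inj; rewrite /= xP; case: (val y) y2 => a b /= ->.
- move=> y; have /ip[l lP] : p (q (kerv _ y)) = 0 := kervP y.
  have [x xP] := hE (- l).
  have xy : c (x, kerv _ y) = 0 by rewrite /= xP linearN lP addNr.
  by have [z zP] := kerv_onto xy; exists z; apply: kerv_inj; apply: (congr1 snd zP).
Qed.

(** The first step of a resolution of E maps onto F as well; its kernel there is
    the first step of a resolution of L with the same second syzygy. *)
Lemma left_dim_ker k L E F (i : {linear L -> E}) (p : {linear E -> F}) :
  short_exact i p -> left_dim_le K k E -> K F -> left_dim_le K k L.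
Proof.
case: (K_res) => Kproj Kext Kker; case: k => [|k] ip.
  by rewrite !left_dim0; apply: Kker ip.
move=> /left_dimS_inv[N [G [j [q [[jI jq qE] KG dN]]]]] KF.
case: ip => iI ip pE.
have pqE : epi (p \o q).
  by move=> y; have [x <-] := pE y; have [z <-] := qE x; exists z.
have [g gP] : exists g : {linear ker (p \o q) -> L},
    forall x, i (g x) = (q \o kerv (p \o q)) x.
  by apply: mono_factor => // x; apply/ip; apply: (kervP x).
have j0 x : (p \o q) (j x) = 0 by rewrite /= (exact0 _ jq) linear0.
apply: (@left_dimS _ _ _ _ _ _ (ker_lift j0) g) dN; last first.
  exact: Kker (short_exact_ker pqE) KG KF.
split.
- by move=> x y /(congr1 val) /jI.
- move=> y; split=> [y0|[x <-]].
    have /jq[x xP] : q (kerv _ y) = 0 by rewrite -[LHS]gP y0 linear0.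
    by exists x; apply: kerv_inj.
  by apply: iI; rewrite gP linear0 /= (exact0 _ jq).
- move=> y; have [x xP] := qE (i y).
  have xk : (p \o q) x = 0 by rewrite /= xP (exact0 _ ip).
  have [z zP] := kerv_onto xk; exists z; apply: iI.
  by rewrite gP -xP -zP.
Qed.

(** Any two K-presentations of M have a common pullback, so the dimension of
    the syzygy does not depend on the presentation. *)
Lemma left_dim_syzygy k L G M (i : {linear L -> G}) (p : {linear G -> M}) :
  short_exact i p -> K G -> left_dim_le K k.+1 M -> left_dim_le K k L.
Proof.
move=> [iI ip pE] KG /left_dimS_inv[N [F [j [q [[jI jq qE] KF dN]]]]].
pose E := ker (copair p q).
have i0 x : copair p q ((linear_map (@inl_linear G F) \o i) x) = 0.
  by rewrite /= (exact0 _ ip) linear0 addr0.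
have j0 x : copair p q ((linear_map (@inr_linear G F) \o j) x) = 0.
  by rewrite /= (exact0 _ jq) linear0 addr0.
pose p1 : {linear E -> G} := (fst : {linear (G * F)%type -> G}) \o kerv (copair p q).
pose p2 : {linear E -> F} := (snd : {linear (G * F)%type -> F}) \o kerv (copair p q).
have dE : left_dim_le K k E.
  apply: (@left_dim_ext _ _ _ _ (ker_lift j0) p1) => //; split.
  - by move=> x y /(congr1 val)[] /jI.
  - move=> y; split=> [/= y1|[x <-]//].
    have := kervP y; rewrite /= y1 linear0 add0r => /jq[x xP].
    by exists x; apply: kerv_inj; rewrite /= xP; case: (val y) y1 => a b /= ->.
  - move=> y; have [x xP] := qE (- p y).
    have /kerv_onto[z zP] : copair p q (y, x) = 0 by rewrite /= xP subrr.
    by exists z; apply: (congr1 fst zP).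
apply: (@left_dim_ker _ _ _ _ (ker_lift i0) p2) dE KF; split.
- by move=> x y /(congr1 val)[] /iI.
- move=> y; split=> [/= y1|[x <-]//].
  have := kervP y; rewrite /= y1 linear0 addr0 => /ip[x xP].
  by exists x; apply: kerv_inj; rewrite /= xP; case: (val y) y1 => a b /= ->.
- move=> y; have [x xP] := pE (- q y).
  have /kerv_onto[z zP] : copair p q (x, y) = 0 by rewrite /= xP addNr.
  by exists z; apply: (congr1 snd zP).
Qed.

Lemma left_dim_iso k M N (f : {linear M -> N}) :
  injective f -> epi f -> left_dim_le K k N -> left_dim_le K k M.
Proof.
move=> fI fE dN.
apply: (@left_dim_ker _ _ _ _ f (linear_map (@zero_linear _ N 'rV[R]_0))) => //; last exact/resolving_trivial/trivial_zero.
by split=> // y; exists 0; rewrite [y]trivial_zero linear0.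
Qed.

End Resolving.

Lemma projective_split (R : pzRingType) (E F : lmodType R)
  (p : {linear E -> F}) : projective F -> epi p ->
  exists s : {linear F -> E}, forall x, p (s x) = x.
Proof. by move=> Fproj pE; apply: (Fproj _ _ p idfun). Qed.

Lemma projective_retract (R : pzRingType) (P Q : lmodType R)
  (i : {linear P -> Q}) (p : {linear Q -> P}) :
  (forall x, p (i x) = x) -> projective Q -> projective P.
Proof.
move=> pi Qproj M N g f /(Qproj _ _ g (f \o p))[h hP].
by exists (h \o i) => x; rewrite /= hP /= pi.
Qed.

Lemma projective_prod (R : pzRingType) (P Q : lmodType R) :
  projective P -> projective Q -> projective (P * Q)%type.
Proof.
move=> Pp Qp M N g f gE.
have [h1 h1P] := Pp _ _ g (f \o linear_map (@inl_linear _ P Q)) gE.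
have [h2 h2P] := Qp _ _ g (f \o linear_map (@inr_linear _ P Q)) gE.
exists (copair h1 h2) => -[x y]; rewrite /= linearD h1P h2P /= -linearD.
by congr (f (_, _)); rewrite /= ?addr0 ?add0r.
Qed.

Lemma split_retraction (R : pzRingType) (L E F : lmodType R)
  (i : {linear L -> E}) (p : {linear E -> F}) (s : {linear F -> E}) :
  injective i -> exact i p -> (forall x, p (s x) = x) ->
  exists r : {linear E -> L}, forall x, i (r x) = x - s (p x).
Proof.
move=> iI ip sP; have rl : linear (fun x => x - s (p x)).
  by move=> a x y; rewrite !linearP scalerDr addrACA.
apply: (@mono_factor _ _ _ _ i (linear_map rl)) => // x; apply/ip.
by rewrite /= linearB sP subrr.
Qed.

Lemma resolving_projective (R : pzRingType) : resolving (@projective R).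
Proof.
split=> // L E F i p [iI ip pE].
  move=> Lp Fp; have [s sP] := projective_split Fp pE.
  have [r rP] := split_retraction iI ip sP.
  apply: (@projective_retract _ _ _ (pair_map r p) (copair i s)).
    by move=> x; rewrite /= rP subrK.
  exact: projective_prod.
move=> Ep Fp; have [s sP] := projective_split Fp pE.
have [r rP] := split_retraction iI ip sP.
apply: (@projective_retract _ _ _ i r) => // x.
by apply: iI; rewrite rP (exact0 _ ip) linear0 subr0.
Qed.

(** * Tensor products and flat modules *)

Section Tensors.
Variables (A : pzRingType) (M : lmodType A^c) (N : lmodType A).

Definition pure (m : M) (n : N) : tensor M N := tens_class [:: (m, n)].

Lemma tens_classD (s t : seq (M * N)) :
  tens_class (s ++ t) = tens_class s + tens_class t.
Proof. exact: esym (tens_addE s t). Qed.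

Lemma tens_cons m n s : tens_class ((m, n) :: s) = pure m n + tens_class s.
Proof. by rewrite -[LHS]/(tens_class ([:: (m, n)] ++ s)) tens_classD. Qed.

Lemma tens_class1 m n : tens_class [:: (m, n)] = pure m n.
Proof. by []. Qed.

Lemma tens_class2 m n m' n' :
  tens_class [:: (m, n); (m', n')] = pure m n + pure m' n'.
Proof. by rewrite tens_cons. Qed.

Lemma pureDl m m' n : pure (m + m') n = pure m n + pure m' n.
Proof. by rewrite -tens_cons; apply/tens_classP/tens_Dl. Qed.

Lemma pureDr m n n' : pure m (n + n') = pure m n + pure m n'.
Proof. by rewrite -tens_cons; apply/tens_classP/tens_Dr. Qed.

Lemma pure_bal (a : A) m n : pure ((a : A^c) *: m) n = pure m (a *: n).
Proof. exact/tens_classP/tens_bal. Qed.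

Lemma pure0l n : pure 0 n = 0.
Proof. exact/tens_classP/tens_0l. Qed.

Lemma pure0r m : pure m 0 = 0.
Proof. by rewrite -(scale0r (0 : N)) -pure_bal scale0r pure0l. Qed.

Lemma tensor_ind (P : tensor M N -> Prop) :
  P 0 -> (forall m n u, P u -> P (pure m n + u)) -> forall u, P u.
Proof.
move=> P0 PD u; rewrite -[u]tens_reprK.
by elim: (repr u) => [|[m n] s IHs]; rewrite ?tens_cons //; apply: PD.
Qed.

Lemma tensor_ext (G : zmodType) (f g : {additive tensor M N -> G}) :
  (forall m n, f (pure m n) = g (pure m n)) -> forall u, f u = g u.
Proof.
move=> fg; elim/tensor_ind => [|m n u IHu]; first by rewrite !raddf0.
by rewrite !raddfD fg IHu.
Qed.

Section Lift.
Variables (G : zmodType) (b : M -> N -> G).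
Hypothesis bDl : forall m m' n, b (m + m') n = b m n + b m' n.
Hypothesis bDr : forall m n n', b m (n + n') = b m n + b m n'.
Hypothesis bal : forall (a : A) m n, b ((a : A^c) *: m) n = b m (a *: n).

Definition tens_lift_fun (u : tensor M N) : G := \sum_(p <- repr u) b p.1 p.2.

Lemma tens_lift_class s : tens_lift_fun (tens_class s) = \sum_(p <- s) b p.1 p.2.
Proof.
have b0 n : b 0 n = 0 by apply: (addIr (b 0 n)); rewrite -bDl !add0r.
rewrite /tens_lift_fun.
have : tens_rel (repr (tens_class s)) s by apply/tens_classP; rewrite tens_reprK.
move: (repr _) => t; elim=> {s t} //=.
- by move=> s t u _ -> _ ->.
- by move=> s s' t t' _ IHs _ IHt; rewrite !big_cat IHs IHt.
- by move=> s t; rewrite !big_cat /= addrC.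
- by move=> n; rewrite big_seq1 big_nil b0.
- by move=> m m' n; rewrite big_seq1 big_cons big_seq1 bDl.
- by move=> m n n'; rewrite big_seq1 big_cons big_seq1 bDr.
- by move=> a m n; rewrite !big_seq1 bal.
Qed.

Lemma tens_lift_additive : zmod_morphism tens_lift_fun.
Proof.
have D u v : tens_lift_fun (u + v) = tens_lift_fun u + tens_lift_fun v.
  rewrite -[u]tens_reprK -[v]tens_reprK -tens_classD !tens_lift_class.
  by rewrite big_cat.
by move=> u v; rewrite -{2}(subrK v u) (D (u - v)) addrK.
Qed.

Definition tens_lift : {additive tensor M N -> G} :=
  HB.pack tens_lift_fun (GRing.isZmodMorphism.Build _ _ _ tens_lift_additive).

Lemma tens_lift_pure m n : tens_lift (pure m n) = b m n.
Proof. by rewrite /= tens_lift_class big_seq1. Qed.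
End Lift.
End Tensors.

Section TensorMaps.
Variable A : pzRingType.

Lemma tens_map_pure (M M' : lmodType A^c) (N N' : lmodType A)
    (f : {linear M -> M'}) (g : {linear N -> N'}) m n :
  tens_map f g (pure m n) = pure (f m) (g n).
Proof. exact: tens_mapE. Qed.

Lemma tens_map_additive (M M' : lmodType A^c) (N N' : lmodType A)
    (f : {linear M -> M'}) (g : {linear N -> N'}) :
  zmod_morphism (tens_map f g).
Proof.
have D u v : tens_map f g (u + v) = tens_map f g u + tens_map f g v.
  rewrite -[u]tens_reprK -[v]tens_reprK -tens_classD !tens_mapE.
  by rewrite map_cat tens_classD.
by move=> u v; rewrite -{2}(subrK v u) (D (u - v)) addrK.
Qed.

HB.instance Definition _ (M M' : lmodType A^c) (N N' : lmodType A)
    (f : {linear M -> M'}) (g : {linear N -> N'}) :=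
  GRing.isZmodMorphism.Build (tensor M N) (tensor M' N') (tens_map f g)
    (tens_map_additive f g).

Lemma tens_map_comp (M M' M'' : lmodType A^c) (N N' N'' : lmodType A)
    (f : {linear M -> M'}) (f' : {linear M' -> M''})
    (g : {linear N -> N'}) (g' : {linear N' -> N''}) u :
  tens_map f' g' (tens_map f g u) = tens_map (f' \o f) (g' \o g) u.
Proof.
move: u; apply: (@tensor_ext _ _ _ _ (tens_map f' g' \o tens_map f g)) => m n /=.
by rewrite !tens_map_pure.
Qed.

Lemma tens_map_eq (M M' : lmodType A^c) (N N' : lmodType A)
    (f f' : {linear M -> M'}) (g g' : {linear N -> N'}) :
  f =1 f' -> g =1 g' -> tens_map f g =1 tens_map f' g'.
Proof.
by move=> ff gg; apply: tensor_ext => m n; rewrite /= !tens_map_pure ff gg.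
Qed.

Lemma tens_map_id (M : lmodType A^c) (N : lmodType A)
    (f : {linear M -> M}) (g : {linear N -> N}) :
  f =1 id -> g =1 id -> tens_map f g =1 id.
Proof.
move=> fid gid; apply: (@tensor_ext _ _ _ _ (tens_map f g) idfun) => m n.
by rewrite /= tens_map_pure fid gid.
Qed.

Lemma tens_map_epi (M M' : lmodType A^c) (N N' : lmodType A)
    (f : {linear M -> M'}) (g : {linear N -> N'}) :
  epi f -> epi g -> epi (tens_map f g).
Proof.
move=> fE gE; elim/tensor_ind => [|m n u [v <-]]; first by exists 0; rewrite raddf0.
have [x <-] := fE m; have [y <-] := gE n.
by exists (pure x y + v); rewrite raddfD /= tens_map_pure.
Qed.

(** Right exactness: two sums of pure tensors that are congruent downstairs
    lift, along any set-theoretic section, to sums that are congruent modulo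
    the image of the kernel. *)
Lemma tens_right_exact_l (M' M M'' : lmodType A^c) (N : lmodType A)
    (i : {linear M' -> M}) (p : {linear M -> M''}) u :
  exact i p -> epi p -> tens_map p (idfun : {linear N -> N}) u = 0 ->
  exists v, tens_map i (idfun : {linear N -> N}) v = u.
Proof.
move=> ip pE; have [s sK] := choice pE.
pose im (w : tensor M N) := exists v, tens_map i (idfun : {linear N -> N}) v = w.
have im0 : im 0 by exists 0; rewrite raddf0.
have imD w w' : im w -> im w' -> im (w + w').
  by move=> [v <-] [v' <-]; exists (v + v'); rewrite raddfD.
have imN w : im w -> im (- w) by move=> [v <-]; exists (- v); rewrite raddfN.
have im1 m n : p m = 0 -> im (pure m n).
  by move=> /ip[x <-]; exists (pure x n); rewrite tens_map_pure.
pose S (t : seq (M'' * N)) : tensor M N := tens_class [seq (s q.1, q.2) | q <- t].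
have pureN m n : - pure m n = pure (- m) n :> tensor M N.
  by apply/eqP; rewrite eq_sym -addr_eq0 -pureDl addNr pure0l.
have SP t t' : tens_rel t t' -> im (S t - S t').
  elim=> {t t'}.
  - by move=> t; rewrite subrr.
  - by move=> t t' _ /imN; rewrite opprB.
  - by move=> t t' t'' _ h _ h'; rewrite -(subrKA (S t')); apply: imD.
  - move=> t t' q q' _ h _ h'; rewrite /S !map_cat !tens_classD.
    by rewrite [X in im X](_ : _ = (S t - S t') + (S q - S q'));
      [apply: imD | rewrite addrACA -opprD].
  - move=> t t'; rewrite /S !map_cat !tens_classD.
    by rewrite [X in im (X - _)]addrC subrr.
  - by move=> n; rewrite subr0; apply: im1; rewrite sK.
  - move=> m m' n; rewrite /S /= tens_class2 tens_class1 -pureDl.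
    by rewrite pureN -pureDl; apply: im1; rewrite linearB linearD /= !sK subrr.
  - move=> m n n'; rewrite /S /= tens_class2 tens_class1 -pureDr.
    by rewrite subrr.
  - move=> a m n; rewrite /S /= !tens_class1 -pure_bal pureN -pureDl.
    by apply: im1; rewrite linearB linearZ /= !sK subrr.
move=> pu; suff lift w : im (w - S (repr (tens_map p (idfun : {linear N -> N}) w))).
  have := lift u; rewrite pu => uS; rewrite -[u]subr0 -[0]/(S [::]).
  rewrite -(subrKA (S (repr (0 : tensor M'' N)))); apply: imD uS _; apply: SP.
  by apply/tens_classP; rewrite tens_reprK.
rewrite -[w]tens_reprK; move: (repr w) => t; rewrite tens_mapE.
rewrite -(subrKA (S [seq (p q.1, q.2) | q <- t])); apply: (imD); last first.
  by apply/SP/tens_classP; rewrite tens_reprK.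
elim: t => [|[m n] t IHt]; first by rewrite subrr.
rewrite /S /= !tens_cons opprD addrACA; apply: imD IHt.
by rewrite pureN -pureDl; apply: im1; rewrite linearB sK subrr.
Qed.

(** The same argument in the other variable. *)
Lemma tens_right_exact_r (M : lmodType A^c) (N' N N'' : lmodType A)
    (i : {linear N' -> N}) (p : {linear N -> N''}) u :
  exact i p -> epi p -> tens_map (idfun : {linear M -> M}) p u = 0 ->
  exists v, tens_map (idfun : {linear M -> M}) i v = u.
Proof.
move=> ip pE; have [s sK] := choice pE.
pose im (w : tensor M N) := exists v, tens_map (idfun : {linear M -> M}) i v = w.
have im0 : im 0 by exists 0; rewrite raddf0.
have imD w w' : im w -> im w' -> im (w + w').
  by move=> [v <-] [v' <-]; exists (v + v'); rewrite raddfD.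
have imN w : im w -> im (- w) by move=> [v <-]; exists (- v); rewrite raddfN.
have im1 m n : p n = 0 -> im (pure m n).
  by move=> /ip[x <-]; exists (pure m x); rewrite tens_map_pure.
pose S (t : seq (M * N'')) : tensor M N := tens_class [seq (q.1, s q.2) | q <- t].
have pureN m n : - pure m n = pure m (- n) :> tensor M N.
  by apply/eqP; rewrite eq_sym -addr_eq0 -pureDr addNr pure0r.
have SP t t' : tens_rel t t' -> im (S t - S t').
  elim=> {t t'}.
  - by move=> t; rewrite subrr.
  - by move=> t t' _ /imN; rewrite opprB.
  - by move=> t t' t'' _ h _ h'; rewrite -(subrKA (S t')); apply: imD.
  - move=> t t' q q' _ h _ h'; rewrite /S !map_cat !tens_classD.
    by rewrite [X in im X](_ : _ = (S t - S t') + (S q - S q'));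
      [apply: imD | rewrite addrACA -opprD].
  - move=> t t'; rewrite /S !map_cat !tens_classD.
    by rewrite [X in im (X - _)]addrC subrr.
  - by move=> n; rewrite subr0 /S /= tens_class1 pure0l.
  - move=> m m' n; rewrite /S /= tens_class2 tens_class1 -pureDl.
    by rewrite subrr.
  - move=> m n n'; rewrite /S /= tens_class2 tens_class1 -pureDr.
    by rewrite pureN -pureDr; apply: im1; rewrite linearB linearD /= !sK subrr.
  - move=> a m n; rewrite /S /= !tens_class1 pure_bal pureN -pureDr.
    by apply: im1; rewrite linearB linearZ /= !sK subrr.
move=> pu; suff lift w : im (w - S (repr (tens_map (idfun : {linear M -> M}) p w))).
  have := lift u; rewrite pu => uS; rewrite -[u]subr0 -[0]/(S [::]).
  rewrite -(subrKA (S (repr (0 : tensor M N'')))); apply: imD uS _; apply: SP.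
  by apply/tens_classP; rewrite tens_reprK.
rewrite -[w]tens_reprK; move: (repr w) => t; rewrite tens_mapE.
rewrite -(subrKA (S [seq (q.1, p q.2) | q <- t])); apply: (imD); last first.
  by apply/SP/tens_classP; rewrite tens_reprK.
elim: t => [|[m n] t IHt]; first by rewrite subrr.
rewrite /S /= !tens_cons opprD addrACA; apply: imD IHt.
by rewrite pureN -pureDr; apply: im1; rewrite linearB sK subrr.
Qed.
End TensorMaps.

Notation tensl f := (tens_map f idfun).
Notation tensr g := (tens_map idfun g).

Section Flat.
Variable R : pzRingType.
Implicit Types (M N P : lmodType R) (X Y Z : lmodType R^c).

Lemma tens_map_swap X Y M N (f : {linear X -> Y}) (g : {linear M -> N}) u :
  tensl f (tensr g u) = tensr g (tensl f u).
Proof. by rewrite !tens_map_comp; apply: tens_map_eq. Qed.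

Lemma flat_ker P : flat P <->
  forall X Y (f : {linear X -> Y}), injective f ->
  forall u, tens_map f (idfun : {linear P -> P}) u = 0 -> u = 0.
Proof.
split=> [Pf X Y f /(Pf _ _)fI u u0|P0 X Y f fI].
  by apply: fI; rewrite u0 raddf0.
by apply: raddf_inj => u; apply: P0.
Qed.

(** A way to say that N is the direct sum of the N_ k without constructing direct
    sums; the coordinates are only asked to be finitely many locally. *)
Definition locally_sum (K : eqType) N (N_ : K -> lmodType R)
    (iota : forall k, {linear N_ k -> N}) (pi : forall k, {linear N -> N_ k}) :=
  forall n, exists s : seq K, forall t, uniq t -> {subset s <= t} ->
    n = \sum_(k <- t) iota k (pi k n).

(** A tensor involves finitely many coordinates, and flatness of each N_ k kills
    the corresponding coordinate of a tensor that dies in Y (x) N. *)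
Lemma locally_sum_flat (K : eqType) N (N_ : K -> lmodType R)
    (iota : forall k, {linear N_ k -> N}) (pi : forall k, {linear N -> N_ k}) :
  locally_sum iota pi -> (forall k, flat (N_ k)) -> flat N.
Proof.
move=> Nsum N_flat; apply/flat_ker => X Y f fI u fu.
have usum (w : tensor X N) : exists s : seq K, forall t, uniq t -> {subset s <= t} ->
    w = \sum_(k <- t) tensr (iota k) (tensr (pi k) w).
  elim/tensor_ind: w => [|m n w [s sP]].
    by exists [::] => t _ _; rewrite big1 // => k _; rewrite !raddf0.
  have [s' s'P] := Nsum n; exists (s ++ s') => t ut st.
  rewrite {1}(s'P t) // => [|k ks]; last by rewrite st // mem_cat ks orbT.
  rewrite {1}(sP t) // => [|k ks]; last by rewrite st // mem_cat ks.
  have -> : pure m (\sum_(k <- t) iota k (pi k n)) =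
            \sum_(k <- t) pure m (iota k (pi k n)).
    elim: (t) => [|k r IHr]; rewrite ?big_nil ?pure0r //.
    by rewrite !big_cons pureDr IHr.
  by rewrite -big_split; apply: eq_bigr => k _; rewrite !raddfD /= !tens_map_pure.
have [s sP] := usum u.
rewrite (sP (undup s)) ?undup_uniq // => [|k]; last by rewrite mem_undup.
rewrite big1 // => k _; suff -> : tensr (pi k) u = 0 by rewrite raddf0.
apply: ((flat_ker _).1 (N_flat k) _ _ _ fI); by rewrite tens_map_swap fu raddf0.
Qed.

Lemma flat_regular : flat R^o.
Proof.
move=> X Y f fI.
pose ev Z : {additive tensor Z R^o -> Z} :=
  @tens_lift R Z R^o Z (fun m a => (a : R^c) *: m)
    (fun m m' a => scalerDr _ _ _) (fun m a a' => scalerDl _ _ _)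
    (fun a m b => scalerA _ _ _).
have evP Z m a : ev Z (pure m a) = (a : R^c) *: m by apply: tens_lift_pure.
have evK Z (u : tensor Z R^o) : pure (ev Z u) (1 : R^o) = u.
  elim/tensor_ind: u => [|m a u IHu]; first by rewrite raddf0 pure0l.
  rewrite raddfD pureDl IHu; congr (_ + _).
  by rewrite evP pure_bal; congr pure; apply: mulr1.
have evE (u : tensor X R^o) : ev Y (tensl f u) = f (ev X u).
  elim/tensor_ind: u => [|m a u IHu]; first by rewrite !raddf0.
  rewrite !raddfD IHu; congr (_ + _).
  rewrite evP; transitivity ((a : R^c) *: f m); last exact: esym (linearZ_LR f a m).
  by rewrite -evP; congr (ev Y _); apply: tens_map_pure.
by move=> u v fuv; rewrite -[u]evK -[v]evK; congr pure; apply: fI; rewrite -!evE fuv.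
Qed.

Lemma flat_retract P N (i : {linear P -> N}) (p : {linear N -> P}) :
  (forall x, p (i x) = x) -> flat N -> flat P.
Proof.
move=> pi /flat_ker Nf; apply/flat_ker => X Y f fI u fu.
have iu : tensr i u = 0.
  apply: (Nf _ _ _ fI); by rewrite tens_map_swap fu raddf0.
have <- : tensr p (tensr i u) = u by rewrite tens_map_comp; apply: tens_map_id.
by rewrite iu raddf0.
Qed.

Lemma free_coefE (K : eqType) (f : free R K) :
  exists s : seq K, forall t, uniq t -> {subset s <= t} ->
    f = \sum_(k <- t) f k *: free_basis R k.
Proof.
have [s sP] := free_supp f; exists s => t ut st.
by apply: free_decomp => // k kt; apply/sP; apply: contra kt => /st.
Qed.

Lemma free_flat (K : eqType) : flat (free R K).
Proof.
have bl (k : K) : linear (fun a : R^o => (a : R) *: free_basis R k).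
  by move=> a x y; rewrite scalerDl scalerA.
apply: (@locally_sum_flat K _ (fun _ => R^o) (fun k => linear_map (bl k))
  (fun k => @free_coord R K k)) => [|_]; [exact: free_coefE | exact: flat_regular].
Qed.

(** A projective module is a summand of a free one, and free modules are sums of
    copies of R. *)
Lemma projective_flat P : projective P -> flat P.
Proof.
move=> Pp.
have pE : epi (free_eval (@id P)).
  by move=> y; exists (free_basis R y); rewrite free_evalE.
by have [s sP] := projective_split Pp pE; apply: flat_retract sP (@free_flat P).
Qed.

End Flat.

Section Purity.
Variable R : pzRingType.

(** A tensor in free (x) L is determined by its coordinates in L, and i acts on
    these coordinatewise. *)
Lemma free_right_flat (K : eqType) (L E : lmodType R) (i : {linear L -> E}) :
  injective i -> forall u, tens_map (idfun : {linear free R^c K -> _}) i u = 0 -> u = 0.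
Proof.
move=> iI u iu.
pose co (N : lmodType R) k : {additive tensor (free R^c K) N -> N} :=
  @tens_lift R (free R^c K) N N (fun f n => (f k : R) *: n)
    (fun f g n => scalerDl _ _ _) (fun f n n' => scalerDr _ _ _)
    (fun a f n => esym (scalerA _ _ _)).
have coP N k f n : co N k (pure f n) = (f k : R) *: n by apply: tens_lift_pure.
have coE k (w : tensor (free R^c K) L) : co E k (tensr i w) = i (co L k w).
  elim/tensor_ind: w => [|f n w IHw]; first by rewrite !raddf0.
  rewrite !raddfD IHw; congr (_ + _).
  rewrite coP; transitivity ((f k : R) *: i n); last exact: esym (linearZ_LR i _ n).
  by rewrite -coP; congr (co E k _); apply: tens_map_pure.
have usum (w : tensor (free R^c K) L) :
    exists s : seq K, forall t, uniq t -> {subset s <= t} ->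
    w = \sum_(k <- t) pure (free_basis R^c k) (co L k w).
  elim/tensor_ind: w => [|f n w [s sP]].
    by exists [::] => t _ _; rewrite big1 // => k _; rewrite raddf0 pure0r.
  have [s' s'P] := free_coefE f; exists (s ++ s') => t ut st.
  rewrite {1}(s'P t) // => [|k ks]; last by rewrite st // mem_cat ks orbT.
  rewrite {1}(sP t) // => [|k ks]; last by rewrite st // mem_cat ks.
  have -> : pure (\sum_(k <- t) f k *: free_basis R^c k) n =
            \sum_(k <- t) pure (free_basis R^c k) ((f k : R) *: n).
    elim: (t) => [|k r IHr]; rewrite ?big_nil ?pure0l //.
    by rewrite !big_cons pureDl IHr pure_bal.
  rewrite -big_split; apply: eq_bigr => k _; by rewrite raddfD coP pureDr.
have [s sP] := usum u.
rewrite (sP (undup s)) ?undup_uniq // => [|k]; last by rewrite mem_undup.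
rewrite big1 // => k _.
by rewrite (inj0 iI (_ : i (co L k u) = 0)) ?pure0r // -coE iu raddf0.
Qed.

(** Purity: present M as P / N with P a free right module, and lift a tensor in
    M (x) L to P (x) L. If it dies in M (x) E, its image in P (x) E comes from
    N (x) E, and that preimage dies in N (x) F because F is flat; so it comes from
    N (x) L. As P (x) L embeds into P (x) E, the lift itself comes from N (x) L
    and is zero in M (x) L. *)
Lemma flat_pure (L E F : lmodType R) (i : {linear L -> E}) (p : {linear E -> F})
    (M : lmodType R^c) u :
  short_exact i p -> flat F -> tens_map (idfun : {linear M -> M}) i u = 0 -> u = 0.
Proof.
move=> [iI ip pE] /flat_ker Ff iu.
pose q := free_eval (@id M).
have qE : epi q by move=> y; exists (free_basis R^c y); rewrite free_evalE.
pose j := kerv q.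
have [w wu] : exists w, tensl q w = u by apply: tens_map_epi => // y; exists y.
have [v vP] : exists v, tensl j v = tensr i w.
  apply: (tens_right_exact_l (p := q)) => //; first exact: kerv_exact.
  by rewrite tens_map_swap wu iu.
have pv : tensr p v = 0.
  apply: (Ff _ _ _ (@kerv_inj _ _ _ q)); rewrite -/j tens_map_swap vP tens_map_comp.
  elim/tensor_ind: (w) => [|m n x IHx].
    by rewrite raddf0.
  by rewrite raddfD /= IHx tens_map_pure /= (exact0 _ ip) pure0r addr0.
have [v' v'P] := tens_right_exact_r ip pE pv.
have wv : w = tensl j v'.
  apply/eqP; rewrite -subr_eq0; apply/eqP/(free_right_flat iI).
  by rewrite raddfB /= -vP -v'P tens_map_swap subrr.
rewrite -wu wv tens_map_comp; elim/tensor_ind: (v') => [|m n x IHx].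
  by rewrite raddf0.
rewrite raddfD /= IHx tens_map_pure addr0 -[RHS](pure0l M n); congr pure.
exact: (kervP m).
Qed.

(** By purity, M (x) L -> M (x) E is injective for every M as soon as F is flat;
    both closure properties are diagram chases from there. *)
Lemma resolving_flat : resolving (@flat R).
Proof.
split; first exact: projective_flat.
  move=> L E F i p ipe Lf Ff; have [iI ip pE] := ipe.
  apply/flat_ker => X Y f fI u fu.
  have pu : tensr p u = 0.
    apply: ((flat_ker F).1 Ff _ _ _ fI); by rewrite tens_map_swap fu raddf0.
  have [v vu] := tens_right_exact_r ip pE pu.
  suff v0 : v = 0 by rewrite -vu v0 raddf0.
  apply: ((flat_ker L).1 Lf _ _ _ fI); apply: (flat_pure ipe Ff).
  by rewrite -tens_map_swap vu.
move=> L E F i p ipe Ef Ff; have [iI ip pE] := ipe.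
apply/flat_ker => X Y f fI u fu; apply: (flat_pure ipe Ff).
apply: ((flat_ker E).1 Ef _ _ _ fI); by rewrite tens_map_swap fu raddf0.
Qed.

End Purity.

(** * Complexes and null homotopies *)

Lemma int_shift (P : int -> Prop) : (forall n, P (n + 1)) -> forall n, P n.
Proof. by move=> P1 n; rewrite -(subrK 1 n). Qed.

Lemma dep_choice (I : Type) (T : I -> Type) (P : forall i, T i -> Prop) :
  (forall i, exists x, P i x) -> exists f : forall i, T i, forall i, P i (f i).
Proof.
by move=> /(_ _)/cid h; exists (fun i => projT1 (h i)) => i; apply: projT2 (h i).
Qed.

(** Differentials are indexed by their target, so what is built from them lives in
    degrees of the form n + 1. Reindexing it here once avoids transport along
    (n - 1) + 1 = n everywhere else. *)
Lemma shift_choice (P : int -> Type) (Q : forall n, P (n + 1) -> Prop) :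
  (forall n, exists p, Q n p) -> exists g : forall m, P m, forall n, Q n (g (n + 1)).
Proof.
move=> /(_ _)/cid h; pose g0 n := projT1 (h n).
have g0P n : Q n (g0 n) := projT2 (h n).
exists (fun m => ecast k (P k) (subrK 1 m) (g0 (m - 1))) => n.
have castP k (e : k + 1 = n + 1) : Q n (ecast j (P j) e (g0 k)).
  by have kn := addIr 1 e; subst k; rewrite eq_axiomK.
exact: castP.
Qed.

Section Zmodule.
Variable V : zmodType.
Implicit Types a b : V.

Lemma addr0_opp a b : a + b = 0 -> b = - a.
Proof. by rewrite addrC => /eqP; rewrite addr_eq0 => /eqP. Qed.

Lemma addNr_cancel a b : - a + b + a - b = 0.
Proof. by rewrite addrAC addrK addNr. Qed.

Lemma addrACA3 a a' b b' c c' :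
  (a + a') + (b + b') + (c + c') = (a + b + c) + (a' + b' + c').
Proof. by rewrite (addrACA a) (addrACA (a + b)). Qed.

End Zmodule.

Section Complexes.
Variable R : pzRingType.
Implicit Types (X Y B C J Q : complex R) (F : int -> lmodType R).

Definition chain_comp X Y Z (g : chain_map Y Z) (f : chain_map X Y) : chain_map X Z.
Proof.
exists (fun n => g n \o f n).
by move=> n x; rewrite /= !cmapE.
Defined.

(** The suspension. *)
Definition sigma X : complex R.
Proof.
exists (fun n => X (n + 1)) (fun n => linear_map (f := fun x => - cdiff X (n + 1) x)
  (fun a x y => etrans (congr1 -%R (linearP _ a x y))
     (etrans (opprD _ _) (congr1 (+%R^~ _) (esym (scalerN _ _)))))).
by move=> n x; rewrite /= linearN cdiffK !oppr0.
Defined.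

Definition disk_mod F (n : int) : lmodType R := (F n * F (n + 1)%R)%type.

Lemma disk_diff_linear F n :
  linear (fun x : disk_mod F (n + 1) => (0, x.1) : disk_mod F n).
Proof. by move=> a x y; congr (_, _); rewrite /= scaler0 addr0. Qed.

(** The direct sum over n of the contractible complexes with F n in the
    degrees n and n - 1. *)
Definition disk F : complex R.
Proof.
exists (disk_mod F) (fun n => linear_map (@disk_diff_linear F n)).
by [].
Defined.

Lemma disk_homotopy_linear F (n : int) :
  linear (fun x : disk F n => (x.2, 0) : disk F (n + 1)).
Proof. by move=> a x y; congr (_, _); rewrite /= scaler0 addr0. Qed.

Definition disk_homotopy F n : {linear disk F n -> disk F (n + 1)} :=
  linear_map (@disk_homotopy_linear F n).

Lemma disk_homotopyE F n (x : disk F (n + 1)) :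
  cdiff (disk F) (n + 1) (disk_homotopy F (n + 1) x) + disk_homotopy F n (cdiff (disk F) n x) = x.
Proof. by case: x => a b; congr (_, _); rewrite /= ?add0r ?addr0. Qed.

Lemma null_to_disk F X (f : chain_map X (disk F)) : null_homotopic f.
Proof.
exists (fun n => @disk_homotopy F n \o f n) => n x.
by rewrite -[LHS]disk_homotopyE -cmapE.
Qed.

Lemma null_from_disk F X (f : chain_map (disk F) X) : null_homotopic f.
Proof.
exists (fun n => f (n + 1) \o @disk_homotopy F n) => n x.
by rewrite -[in LHS](disk_homotopyE x) linearD cmapE.
Qed.

(** The functor disk is left adjoint to forgetting the differential. *)
Definition from_disk F X (phi : forall n, {linear F n -> X n}) : chain_map (disk F) X.
Proof.
exists (fun n => copair (phi n) (cdiff X n \o phi (n + 1))).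
by move=> n x; rewrite /= linear0 add0r linearD cdiffK addr0.
Defined.

Lemma kerc_subproof X Y (f : chain_map X Y) n (x : ker (f (n + 1))) :
  f n ((cdiff X n \o kerv (f (n + 1))) x) = 0.
Proof. by rewrite cmapE kervP linear0. Qed.

Definition kerc X Y (f : chain_map X Y) : complex R.
Proof.
exists (fun n => ker (f n)) (fun n => ker_lift (@kerc_subproof X Y f n)).
by move=> n x; apply: val_inj; rewrite /= cdiffK.
Defined.

Definition kercv X Y (f : chain_map X Y) : chain_map (kerc f) X.
Proof. by exists (fun n => kerv (f n)). Defined.

(** Dimension shifting in the target. A map f : C -> B lifts degreewise to
    g : C -> Q. The failure d g - g d of g to be a chain map takes values in B' and
    is a chain map from the suspension of C; subtracting from g a null homotopy of
    it yields a chain map that lifts f. *)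
Lemma null_lift C B' Q B (i : chain_map B' Q) (p : chain_map Q B) :
  (forall n, short_exact (i n) (p n)) ->
  (forall n (f : {linear C n -> B n}),
     exists g : {linear C n -> Q n}, forall x, p n (g x) = f x) ->
  (forall g : chain_map C Q, null_homotopic g) ->
  (forall e : chain_map (sigma C) B', null_homotopic e) ->
  forall f : chain_map C B, null_homotopic f.
Proof.
move=> ip Clift Cnull Snull f.
have [g gP] := dep_choice (fun n => Clift n (f n)).
have iI n : injective (i n) by case: (ip n).
have pi n x : p n (i n x) = 0 by case: (ip n) => _ /exact0.
have /dep_choice[e eP] : forall n, exists e : {linear C (n + 1) -> B' n}, forall x,
    i n (e x) = cdiff Q n (g (n + 1) x) - g n (cdiff C n x).
  move=> n.
  have dl : linear (fun x => cdiff Q n (g (n + 1) x) - g n (cdiff C n x)).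
    by move=> a x y; rewrite !linearP scalerDr addrACA.
  apply: (@mono_factor _ _ _ _ (i n) (linear_map dl)) => // x.
  case: (ip n) => _ ipx _; apply/ipx.
  by rewrite /= linearB cmapE !gP cmapE subrr.
have eE n (x : sigma C (n + 1)) : e n (cdiff (sigma C) n x) = cdiff B' n (e (n + 1) x).
  apply: iI; rewrite cmapE !eP /= linearN linearB !linearN.
  by rewrite /= !cdiffK (linear0 (g n)) !oppr0 addr0 sub0r.
have [t tP] := Snull (ChainMap eE).
have [g' g'P] : exists g' : forall m, {linear C m -> Q m}, forall n x,
    g' (n + 1) x = g (n + 1) x - i (n + 1) (t n x).
  apply: (@shift_choice (fun m => {linear C m -> Q m})
    (fun n q => forall x, q x = g (n + 1) x - i (n + 1) (t n x))) => n.
  have dl : linear (fun x => g (n + 1) x - i (n + 1) (t n x)).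
    by move=> a x y; rewrite !linearP scalerDr addrACA.
  by exists (linear_map dl).
have g'E n x : g' n (cdiff C n x) = cdiff Q n (g' (n + 1) x).
  move: n x; apply: int_shift => n x.
  rewrite !g'P linearB -cmapE; have /(congr1 (i (n + 1))) := tP n x.
  rewrite /= eP linearN linearB => /(canRL (subrK _)) ->.
  by rewrite [RHS]addrAC [X in _ = X - _ + _]addrC [X in _ = X + _]addrK [LHS]addrC.
have [s sP] := Cnull (ChainMap g'E).
exists (fun n => p (n + 1) \o s n) => n x.
have := sP n x; rewrite /= => /(congr1 (p (n + 1))).
by rewrite g'P linearB pi subr0 gP linearD cmapE.
Qed.

(** Dimension shifting in the source. A null homotopy s of f p restricts to a chain
    map from X' to the suspension of B. A null homotopy of that, extended to C,
    corrects s by a boundary so that it vanishes on X' and factors through X. *)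
Lemma null_extend X' C X B (i : chain_map X' C) (p : chain_map C X) :
  (forall n, short_exact (i n) (p n)) ->
  (forall n (t : {linear X' n -> B (n + 1 + 1)}),
     exists t' : {linear C n -> B (n + 1 + 1)}, forall x, t' (i n x) = t x) ->
  (forall g : chain_map C B, null_homotopic g) ->
  (forall e : chain_map X' (sigma B), null_homotopic e) ->
  forall f : chain_map X B, null_homotopic f.
Proof.
move=> ip ext Cnull Snull f.
have pi n x : p n (i n x) = 0 by case: (ip n) => _ /exact0.
have pE n : epi (p n) by case: (ip n).
have [s sP] := Cnull (chain_comp f p).
have eE n x : s n (i n (cdiff X' n x)) = cdiff (sigma B) n (s (n + 1) (i (n + 1) x)).
  by have := sP n (i (n + 1) x); rewrite /= pi linear0 -cmapE => /esym/addr0_opp.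
have [t tP] := Snull (@ChainMap _ X' (sigma B) (fun n => s n \o i n) eE).
have [u uP] := dep_choice (fun n => ext n (t n)).
have [r rP] : exists r : forall m, {linear X m -> B (m + 1)}, forall n x,
    r (n + 1) (p (n + 1) x) =
    s (n + 1) x + cdiff B (n + 1 + 1) (u (n + 1) x) - u n (cdiff C n x).
  apply: (@shift_choice (fun m => {linear X m -> B (m + 1)})
    (fun n q => forall x, q (p (n + 1) x) =
      s (n + 1) x + cdiff B (n + 1 + 1) (u (n + 1) x) - u n (cdiff C n x))) => n.
  have dl : linear (fun x =>
      s (n + 1) x + cdiff B (n + 1 + 1) (u (n + 1) x) - u n (cdiff C n x)).
    by move=> a x y; rewrite !linearP !scalerDr; apply: addrACA3.
  apply: (@epi_factor _ _ _ _ (p (n + 1)) (linear_map dl)) => // x.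
  case: (ip (n + 1)) => _ ipx _ /ipx[y <-] /=.
  rewrite -cmapE !uP; have := tP n y; rewrite /= => ->.
  exact: addNr_cancel.
exists r; apply: int_shift => n x; have [y <-] := pE _ x.
have := sP (n + 1) y; rewrite /= => ->.
rewrite -cmapE !rP linearB linearD !cdiffK addr0 linear0 subr0 [s _ _ + _ in RHS]addrC.
by rewrite addrA subrK.
Qed.

(** The dual: a null homotopy s of i f composes to a chain map from Y to the
    suspension of X'', and a lift to J of a null homotopy of that corrects s by a
    boundary so that it takes values in X. *)
Lemma null_colift X J X'' Y (i : chain_map X J) (p : chain_map J X'') :
  (forall n, short_exact (i n) (p n)) ->
  (forall n (t : {linear Y n -> X'' (n + 1 + 1)}),
     exists t' : {linear Y n -> J (n + 1 + 1)}, forall x, p (n + 1 + 1) (t' x) = t x) ->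
  (forall g : chain_map Y J, null_homotopic g) ->
  (forall e : chain_map Y (sigma X''), null_homotopic e) ->
  forall f : chain_map Y X, null_homotopic f.
Proof.
move=> ip lift Jnull Snull f.
have iI n : injective (i n) by case: (ip n).
have pi n x : p n (i n x) = 0 by case: (ip n) => _ /exact0.
have [s sP] := Jnull (chain_comp i f).
have eE n x : p (n + 1) (s n (cdiff Y n x)) =
    cdiff (sigma X'') n (p (n + 1 + 1) (s (n + 1) x)).
  by have := congr1 (p (n + 1)) (sP n x); rewrite /= pi linearD cmapE => /esym/addr0_opp.
have [t tP] := Snull (@ChainMap _ Y (sigma X'') (fun n => p (n + 1) \o s n) eE).
have [u uP] := dep_choice (fun n => lift n (t n)).
have [r rP] : exists r : forall m, {linear Y m -> X (m + 1)}, forall n x,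
    i (n + 1 + 1) (r (n + 1) x) =
    s (n + 1) x + cdiff J (n + 1 + 1) (u (n + 1) x) - u n (cdiff Y n x).
  apply: (@shift_choice (fun m => {linear Y m -> X (m + 1)})
    (fun n q => forall x, i (n + 1 + 1) (q x) =
      s (n + 1) x + cdiff J (n + 1 + 1) (u (n + 1) x) - u n (cdiff Y n x))) => n.
  have dl : linear (fun x =>
      s (n + 1) x + cdiff J (n + 1 + 1) (u (n + 1) x) - u n (cdiff Y n x)).
    by move=> a x y; rewrite !linearP !scalerDr; apply: addrACA3.
  apply: (@mono_factor _ _ _ _ (i (n + 1 + 1)) (linear_map dl)) => // x.
  case: (ip (n + 1 + 1)) => _ ipx _; apply/ipx; rewrite /= linearB linearD cmapE !uP.
  have := tP n x; rewrite /= => ->.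
  exact: addNr_cancel.
exists r; apply: int_shift => n x; apply: iI.
have := sP (n + 1) x; rewrite /= => ->.
rewrite linearD cmapE !rP linearB linearD !cdiffK addr0 linear0 subr0 [s _ _ + _ in RHS]addrC.
by rewrite addrA subrK.
Qed.

End Complexes.

(** * Vanishing of Ext *)

Section Ext.
Variable R : pzRingType.
Implicit Types L M N E F P : lmodType R.

(** Vanishing of Ext^1(M, N), tested on the presentations of M by projectives. *)
Definition ext_proj M N := forall L P (i : {linear L -> P}) (p : {linear P -> M}),
  short_exact i p -> projective P ->
  forall g : {linear L -> N}, exists h : {linear P -> N}, forall x, h (i x) = g x.

(** Vanishing of Ext^1(M, N), tested on all extensions by M. *)
Definition ext_zero M N := forall L E (i : {linear L -> E}) (p : {linear E -> M}),
  short_exact i p ->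
  forall g : {linear L -> N}, exists h : {linear E -> N}, forall x, h (i x) = g x.

(** A presentation L -> P -> M, followed by a resolution of L, is a projective
    resolution of M. *)
Lemma Ext1_zero_proj k M N :
  (forall L, proj_dim_le k L) -> Ext1_zero M N -> ext_proj M N.
Proof.
move=> gl ext L P i p [iI ip pE] Pp g.
have [D [d [e [[eE de dd] Dp D0]]]] := gl L.
pose C j : lmodType R := if j is j'.+1 then D j' else P.
pose c j : {linear C j.+1 -> C j} :=
  match j with 0 => i \o e | j'.+1 => d j' end.
have Cp j : projective (C j).
  case: j => [|j] //=; have [/Dp//|/D0] := leqP j k; exact: trivial_projective.
have res : left_resolution c p.
  split=> //.
    move=> y; rewrite ip; split=> [[x <-]|[x <-]]; last by exists (e x).
    by have [z <-] := eE x; exists z.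
  case=> [|j] y; last exact: dd.
  apply: iff_trans (de y); rewrite /=.
  by split=> [/(inj0 iI)//|->]; rewrite linear0.
have [|h hP] := ext C c p res Cp (g \o e).
  by move=> x; rewrite /= (exact0 x de) linear0.
by exists h => x; have [y <-] := eE x; rewrite -[RHS]/((g \o e) y) hP.
Qed.

Lemma ext_proj_extension (M N' N N'' : lmodType R)
    (a : {linear N' -> N}) (b : {linear N -> N''}) :
  short_exact a b -> ext_proj M N' -> ext_proj M N'' -> ext_proj M N.
Proof.
move=> [aI ab bE] h1 h2 L P i p ip Pp g.
have [t tP] := h2 L P i p ip Pp (b \o g).
have [u uP] := Pp _ _ b t bE.
have dl : linear (fun x => g x - u (i x)).
  by move=> c x y; rewrite !linearP scalerDr addrACA.
have [v vP] : exists v : {linear L -> N'}, forall x, a (v x) = g x - u (i x).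
  apply: (@mono_factor _ _ _ _ a (linear_map dl)) => // x; apply/ab.
  by rewrite /= linearB uP tP subrr.
have [w wP] := h1 L P i p ip Pp v.
have hl : linear (fun x => u x + a (w x)).
  by move=> c x y; rewrite !linearP scalerDr addrACA.
by exists (linear_map hl) => x; rewrite /= wP vP addrC subrK.
Qed.

(** A projective cover P of M maps to E, and E becomes the pushout of P and L over
    the kernel of P -> M; so it is enough to extend to P. *)
Lemma ext_proj_zero M N : ext_proj M N -> ext_zero M N.
Proof.
move=> ext L E i p [iI ip pE] g.
have [P [q [Pp qE]]] := enough_projectives M.
have [h hP] := Pp _ _ p q pE.
have [u uP] : exists u : {linear ker q -> L}, forall x, i (u x) = (h \o kerv q) x.
  by apply: mono_factor => // x; apply/ip; rewrite /= hP; apply: (kervP x).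
have [t tP] := ext _ _ _ _ (short_exact_ker qE) Pp (g \o u).
have cE : epi (copair i h).
  move=> y; have [x xP] := qE (p y).
  have /ip[l lP] : p (y - h x) = 0 by rewrite linearB hP xP subrr.
  by exists (l, x); rewrite /= lP subrK.
have [|w wP] := epi_factor (f := copair g t) cE.
  move=> [l x] /= lx0.
  have /kerv_onto[z zP] : q x = 0.
    by rewrite -hP (addr0_opp lx0) linearN (exact0 _ ip) oppr0.
  have ->: l = - u z.
    by apply: iI; rewrite linearN uP -[(h \o _) z]/(h (kerv q z)) zP (addr0_opp lx0) opprK.
  by rewrite -zP tP linearN addNr.
exists w => x; have := wP (x, 0); rewrite /= !linear0 !addr0; apply.
Qed.

Lemma ext_zero_extension (Z Y Z' N : lmodType R)
    (a : {linear Z -> Y}) (b : {linear Y -> Z'}) :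
  short_exact a b -> ext_zero Z N -> ext_zero Z' N -> ext_zero Y N.
Proof.
move=> [aI ab bE] h1 h2 L E i p [iI ip pE] g.
have bpE : epi (b \o p).
  by move=> y; have [x <-] := bE y; have [z <-] := pE x; exists z.
have i0 x : (b \o p) (i x) = 0 by rewrite /= (exact0 _ ip) linear0.
have [p' p'P] : exists p' : {linear ker (b \o p) -> Z},
    forall x, a (p' x) = (p \o kerv (b \o p)) x.
  by apply: mono_factor => // x; apply/ab; apply: (kervP x).
have [|g' g'P] := h1 _ _ (ker_lift i0) p' _ g.
  split.
  - by move=> x y /(congr1 val)/iI.
  - move=> y; split=> [y0|[x <-]].
      have /ip[x xP] : p (kerv _ y) = 0 by rewrite -[LHS]p'P y0 linear0.
      by exists x; apply: kerv_inj.
    by apply: aI; rewrite p'P linear0 /= (exact0 _ ip).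
  - move=> y; have [x xP] := pE (a y).
    have /kerv_onto[z zP] : (b \o p) x = 0 by rewrite /= xP (exact0 _ ab).
    by exists z; apply: aI; rewrite p'P -xP -zP.
have [h hP] := h2 _ _ _ _ (short_exact_ker bpE) g'.
by exists h => x; rewrite -g'P -hP.
Qed.

(** The pullback of p along t is an extension of M by N, which splits. *)
Lemma ext_zero_lift (M N J N'' : lmodType R)
    (i : {linear N -> J}) (p : {linear J -> N''}) :
  short_exact i p -> ext_zero M N -> forall t : {linear M -> N''},
  exists t' : {linear M -> J}, forall x, p (t' x) = t x.
Proof.
move=> [iI ip pE] ext t.
have nl : linear (fun x => - t x).
  by move=> a x y; rewrite linearP opprD scalerN.
pose E := ker (copair p (linear_map nl)).
have i0 x : copair p (linear_map nl) ((linear_map (@inl_linear _ J M) \o i) x) = 0.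
  by rewrite /= (exact0 _ ip) linear0 oppr0 addr0.
pose q : {linear E -> M} := (snd : {linear (J * M)%type -> M}) \o kerv _.
have Et (y : E) : p (kerv _ y).1 = t (q y).
  by have /eqP := kervP y; rewrite /= subr_eq0 => /eqP.
have qE : epi q.
  move=> x; have [j jP] := pE (t x).
  have /kerv_onto[z zP] : copair p (linear_map nl) (j, x) = 0 by rewrite /= jP subrr.
  by exists z; apply: (congr1 snd zP).
have iq : exact (ker_lift i0) q.
  move=> y; split=> [/= y2|[x <-]//].
  have := Et y; rewrite /= y2 linear0 => /ip[x xP].
  by exists x; apply: kerv_inj; rewrite /= xP; case: (val y) y2 => a b /= ->.
have [|r rP] := ext _ E (ker_lift i0) q _ idfun.
  by split=> // x y /(congr1 val)[] /iI.
have dl : linear (fun y : E => (kerv _ y).1 - i (r y)).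
  by move=> a x y; rewrite !linearP scalerDr addrACA.
have [|t' t'P] := epi_factor (f := linear_map dl) qE.
  by move=> y /iq[x <-]; rewrite /= rP subrr.
exists t' => x; have [y <-] := qE x.
by rewrite t'P /= linearB (exact0 _ ip) subr0 Et.
Qed.

End Ext.

(** * Maps between complexes are null homotopic *)

Section Homotopy.
Variable R : pzRingType.
Implicit Types (X Y B C Q : complex R) (F : int -> lmodType R).

Lemma sigma_exact X : exact_complex X -> exact_complex (sigma X).
Proof.
move=> Xex n y; split=> [/eqP|[x <-]]; last by rewrite cdiffK.
rewrite oppr_eq0 => /eqP/Xex[x xP]; exists (- x).
by rewrite /= linearN opprK.
Qed.

Lemma cycles_short_exact X n : exact_complex X ->
  short_exact (kerv (cdiff X (n + 1))) (ker_lift (@cdiffK _ X n)).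
Proof.
move=> Xex; split; first exact: kerv_inj.
  move=> y; split=> [/(congr1 val)/= /kerv_onto//|[x <-]].
  by apply: val_inj; apply: (kervP x).
move=> y; have [x xP] := (Xex n (kerv _ y)).1 (kervP y).
by exists x; apply: val_inj.
Qed.

Lemma ext_proj_exact M X : exact_complex X ->
  (forall n, ext_proj M (ker (cdiff X n))) -> forall n, ext_proj M (X n).
Proof.
move=> Xex XM; apply: int_shift; apply: int_shift => n.
exact: ext_proj_extension (cycles_short_exact n Xex) (XM _) (XM _).
Qed.

Lemma ext_zero_exact N X : exact_complex X ->
  (forall n, ext_zero (ker (cdiff X n)) N) -> forall n, ext_zero (X n) N.
Proof.
move=> Xex XN; apply: int_shift; apply: int_shift => n.
exact: ext_zero_extension (cycles_short_exact n Xex) (XN _) (XN _).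
Qed.

(** Choosing the cover over the cycles of B rather than over its terms makes it
    surjective on cycles, which keeps the kernel exact; the cycles of the kernel
    are then the kernels of the chosen covers. *)
Lemma cover_exact (G : lmodType R -> Prop) B :
  (forall (U V : lmodType R) (f : {linear U -> V}), injective f -> epi f -> G V -> G U) ->
  exact_complex B ->
  (forall n, exists (P : lmodType R) (p : {linear P -> ker (cdiff B n)}),
     [/\ projective P, epi p & G (ker p)]) ->
  exists F (phi : forall n, {linear F n -> B n}),
  [/\ forall n, projective (F n), forall n, epi (from_disk phi n),
      exact_complex (kerc (from_disk phi))
    & forall n, G (ker (cdiff (kerc (from_disk phi)) n))].
Proof.
move=> Giso Bex cover.
pose T n := {F : lmodType R & {linear F -> B n}}.
pose good n (t : T (n + 1 + 1)) :=
  [/\ projective (projT1 t),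
      forall y, exists a, cdiff B (n + 1) (projT2 t a) = cdiff B (n + 1) y
    & G (ker (cdiff B (n + 1) \o projT2 t))].
have goodE n : exists t, @good n t.
  have [P [p [Pp pE Gp]]] := cover n.
  have [bI bk bE] := cycles_short_exact n Bex.
  have [psi psiP] := Pp _ _ _ p bE.
  have dpsi a : cdiff B (n + 1) (psi a) = kerv _ (p a) := congr1 val (psiP a).
  exists (existT _ P psi); split=> //=.
    move=> y; have [a aP] := pE (ker_lift (@cdiffK _ B n) y).
    by exists a; rewrite dpsi aP.
  have p0 x : p (kerv (cdiff B (n + 1) \o psi) x) = 0.
    by apply: kerv_inj; rewrite -dpsi; apply: (kervP x).
  apply: (Giso _ _ (ker_lift p0)) => //.
    by move=> x y /(congr1 val)/= e; apply: val_inj.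
  move=> y; have /kerv_onto[z zP] : (cdiff B (n + 1) \o psi) (kerv p y) = 0.
    by rewrite /= dpsi kervP linear0.
  by exists z; apply: kerv_inj.
(* The data lives in degrees n + 2, so it is reindexed twice. *)
have [t' t'P] := shift_choice (P := fun m => T (m + 1)) goodE.
have [t tP] := shift_choice (P := T) (fun n => ex_intro (fun s => s = t' n) _ erefl).
have {t' t'P tP} tP n : good n (t (n + 1 + 1)) by rewrite tP.
pose F n := projT1 (t n); pose phi n : {linear F n -> B n} := projT2 (t n).
exists F, phi.
have onto n y : exists a, cdiff B (n + 1) (phi (n + 1 + 1) a) = cdiff B (n + 1) y.
  by case: (tP n).
have epiF n : epi (from_disk phi n).
  move: n; apply: int_shift; apply: int_shift => ?; move=> y; have [a aP] := onto _ y.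
  have /Bex[y' y'P] : cdiff B _ (y - phi _ a) = 0 by rewrite linearB aP subrr.
  have [b bP] := onto _ y'.
  by exists (a, b); rewrite /= bP y'P [LHS]addrC subrK.
split=> //.
- by apply: int_shift; apply: int_shift => n; case: (tP n).
- move=> n y; split=> [y0|[x <-]]; last by rewrite cdiffK.
  have a0 : (kerv _ y).1 = 0 := congr1 snd (congr1 val y0).
  have := kervP y; rewrite /= a0 linear0 add0r => db.
  have [y' y'P] := (Bex _ (phi (n + 1 + 1) (kerv _ y).2)).1 db.
  have [c cP] := onto (n + 1) (- y').
  have /kerv_onto[z zP] : from_disk phi (n + 1 + 1) ((kerv _ y).2, c) = 0.
    by rewrite /= cP linearN y'P subrr.
  exists z; apply: kerv_inj.
  transitivity (cdiff (disk F) (n + 1) (kerv _ z)); first by [].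
  by rewrite zP [RHS]surjective_pairing a0.
move=> n; set K := kerc _.
have b0 (k : ker (cdiff K n)) :
    (cdiff B (n + 1) \o phi (n + 1 + 1)) (kerv _ (kerv _ k)).2 = 0.
  have a0 : (kerv _ (kerv _ k)).1 = 0 := congr1 snd (congr1 val (kervP k)).
  by have := kervP (kerv _ k); rewrite /= a0 linear0 add0r.
pose m : {linear ker (cdiff K n) -> F (n + 1 + 1)} :=
  (snd : {linear disk_mod F (n + 1) -> F (n + 1 + 1)})
  \o (kerv _ \o kerv _).
have {}b0 k : (cdiff B (n + 1) \o phi (n + 1 + 1)) (m k) = 0 by apply: b0.
apply: (Giso _ _ (ker_lift b0)); last by case: (tP n).
  apply: linear_inj0 => k /(congr1 val) k0; apply: kerv_inj; apply: kerv_inj.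
  have a0 : (kerv _ (kerv _ k)).1 = 0 := congr1 snd (congr1 val (kervP k)).
  by rewrite !linear0 [LHS]surjective_pairing a0 (k0 : (kerv _ (kerv _ k)).2 = 0).
move=> b; have /kerv_onto[x xP] : from_disk phi (n + 1) (0, kerv _ b) = 0.
  by rewrite /= linear0 add0r; apply: (kervP b).
have /kerv_onto[y yP] : cdiff K n x = 0.
  by apply: kerv_inj; rewrite -[LHS]/(cdiff (disk F) n (kerv _ x)) xP linear0.
exists y; apply: kerv_inj; transitivity (kerv _ (kerv _ y)).2; first by [].
by rewrite yP xP.
Qed.

Lemma null_trivial_source X Y (f : chain_map X Y) :
  (forall n, trivial_mod (X n)) -> null_homotopic f.
Proof.
move=> X0; exists (fun n => linear_map (@zero_linear _ (X n) (Y (n + 1)))) => n x.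
by rewrite [x]X0 !linear0 addr0.
Qed.

Lemma null_trivial_target X Y (f : chain_map X Y) :
  (forall n, trivial_mod (Y n)) -> null_homotopic f.
Proof.
move=> Y0; exists (fun n => linear_map (@zero_linear _ (X n) (Y (n + 1)))) => n x.
by rewrite [RHS]Y0 [LHS]Y0.
Qed.

(** Counting from the zero modules lets the inductions on dimension start at a
    zero complex, where nothing has to be contracted. *)
Definition pd_lt k (M : lmodType R) :=
  if k is k'.+1 then proj_dim_le k' M else trivial_mod M.

Lemma pd_lt_iso k (U V : lmodType R) (f : {linear U -> V}) :
  injective f -> epi f -> pd_lt k V -> pd_lt k U.
Proof.
case: k => [|k] fI fE; last exact: (left_dim_iso (resolving_projective R) fI fE).
by move=> V0 u; apply: fI; rewrite [LHS]V0 [RHS]V0.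
Qed.

Lemma pd_lt_cover k (M : lmodType R) : pd_lt k.+1 M ->
  exists (P : lmodType R) (p : {linear P -> M}),
  [/\ projective P, epi p & pd_lt k (ker p)].
Proof.
case: k => [|k] /=.
  move/(left_dim0 (resolving_projective R)) => Mp; exists M, idfun.
  split=> // [y|x]; first by exists y.
  by apply: val_inj; apply: (kervP x).
move=> /left_dimS_inv[N [P [i [p [[iI ip pE] Pp dN]]]]].
exists P, p; split=> //.
have [f fP] := mono_factor iI (fun x => (ip (kerv p x)).1 (kervP x)).
apply: (@pd_lt_iso k.+1 _ _ f) => //.
  by move=> x y e; apply: kerv_inj; rewrite -!fP e.
move=> y; have /kerv_onto[x xP] := exact0 y ip.
by exists x; apply: iI; rewrite fP.
Qed.

Lemma exact_trivial X : exact_complex X ->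
  (forall n, trivial_mod (ker (cdiff X n))) -> forall n, trivial_mod (X n).
Proof.
move=> Xex X0; apply: int_shift => n x.
have k0 m y : cdiff X m y = 0 -> y = 0.
  by move=> /kerv_onto[z <-]; rewrite [z]X0 linear0.
move: n x; apply: int_shift => n x.
by apply: (k0 (n + 1)); apply: (k0 n); rewrite cdiffK.
Qed.

(** The cover of B has a contractible middle term, and its kernel has cycles of
    smaller dimension. Maps from C lift along the cover because C has projective
    terms. *)
Lemma projective_to_exact k B : exact_complex B ->
  (forall n, pd_lt k (ker (cdiff B n))) ->
  forall C, (forall n, projective (C n)) ->
  forall f : chain_map C B, null_homotopic f.
Proof.
elim: k B => [|k IHk] B Bex Bk C Cp f.
  exact/null_trivial_target/exact_trivial.
have [F [phi [_ phiE Kex Kk]]] :=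
  cover_exact (@pd_lt_iso k) Bex (fun n => pd_lt_cover (Bk n)).
apply: (@null_lift _ C _ _ _ (kercv (from_disk phi)) (from_disk phi)).
- by move=> n; apply: short_exact_ker.
- by move=> n g; apply: (Cp n _ _ (from_disk phi n)).
- exact: null_to_disk.
- by apply: IHk => // n; apply: Cp.
Qed.

(** The same cover, now of the source: maps into X extend along the inclusion of
    the kernel because X has injective terms. *)
Lemma exact_to_injective k Y : exact_complex Y ->
  (forall n, pd_lt k (ker (cdiff Y n))) ->
  forall X, (forall n, injective_mod (X n)) ->
  forall f : chain_map Y X, null_homotopic f.
Proof.
elim: k Y => [|k IHk] Y Yex Yk X Xi f.
  exact/null_trivial_source/exact_trivial.
have [F [phi [_ phiE Kex Kk]]] :=
  cover_exact (@pd_lt_iso k) Yex (fun n => pd_lt_cover (Yk n)).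
apply: (@null_extend _ _ _ _ _ (kercv (from_disk phi)) (from_disk phi)).
- by move=> n; apply: short_exact_ker.
- by move=> n t; apply: (Xi _ _ _ (kercv (from_disk phi) n)); apply: kerv_inj.
- exact: null_from_disk.
- by apply: IHk => // n; apply: Xi.
Qed.

(** The kernel of this cover consists of first syzygies of the terms of X. *)
Lemma disk_cover X :
  exists F (phi : forall n, {linear F n -> X n}),
  (forall n, projective (disk F n)) /\ forall n, epi (from_disk phi n).
Proof.
have [F /dep_choice[phi phiP]] := dep_choice (fun n => enough_projectives (X n)).
exists F, phi; split=> n; first by apply: projective_prod; [case: (phiP n) | case: (phiP (n + 1))].
by move=> y; case: (phiP n) => _ /(_ y)[x <-]; exists (x, 0); rewrite /= !linear0 addr0.
Qed.

(** Ext^1(X_n, B_m) = 0 allows dimension shifting in the source: replacing X by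
    the kernel of its disk cover lowers the dimension of the terms until they are
    projective. The class G carries the orthogonality to B along the syzygies. *)
Lemma null_dg_left (G : lmodType R -> Prop) N0 k X B :
  (forall (L P M : lmodType R) (i : {linear L -> P}) (p : {linear P -> M}),
    short_exact i p -> projective P -> G M -> G L) ->
  (forall M : lmodType R, proj_dim_le N0 M) ->
  exact_complex B -> (forall M n, G M -> ext_proj M (B n)) ->
  (forall n, proj_dim_le k (X n)) -> (forall n, G (X n)) ->
  forall f : chain_map X B, null_homotopic f.
Proof.
move=> Gker gl; have pres := resolving_projective R.
elim: k X B => [|k IHk] X B Bex BG Xk XG f.
  apply: (@projective_to_exact N0.+1) => // n; first exact: gl.
  exact: ((left_dim0 pres (X n)).1 (Xk n)).
have [F [phi [Fp phiE]]] := disk_cover X.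
have ip n : short_exact (kercv (from_disk phi) n) (from_disk phi n).
  exact: short_exact_ker.
refine (null_extend ip _ _ _ f).
- by move=> n t; apply: (BG _ _ (XG n)) (ip n) (Fp n) t.
- exact: null_from_disk.
- apply: IHk => [|M n /BG|n|n]; [exact: sigma_exact | exact | |].
    exact: (left_dim_syzygy pres (ip n) (Fp n) (Xk n)).
  exact: (Gker _ _ _ _ _ (ip n) (Fp n) (XG n)).
Qed.

End Homotopy.

(** * Quotient modules *)

Section Cokernel.
Local Open Scope quotient_scope.
Variables (R : pzRingType) (U V : lmodType R) (i : {linear U -> V}).

Definition coker_rel : rel V := fun x y => `[< exists u, i u = x - y >].

Lemma coker_rel_refl : reflexive coker_rel.
Proof. by move=> x; apply/asboolP; exists 0; rewrite linear0 subrr. Qed.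

Lemma coker_rel_sym : symmetric coker_rel.
Proof.
by move=> x y; apply/asboolP/asboolP => -[u uP]; exists (- u);
  rewrite linearN uP opprB.
Qed.

Lemma coker_rel_trans : transitive coker_rel.
Proof.
move=> y x z /asboolP[u uP] /asboolP[v vP]; apply/asboolP; exists (u + v).
by rewrite linearD uP vP subrKA.
Qed.

Canonical coker_equiv :=
  EquivRel coker_rel coker_rel_refl coker_rel_sym coker_rel_trans.

Definition coker := {eq_quot coker_equiv}.
HB.instance Definition _ := Choice.on coker.

Definition coker_class (x : V) : coker := \pi_{eq_quot coker_equiv} x.

Lemma coker_classP x y : coker_class x = coker_class y <-> exists u, i u = x - y.
Proof.
split=> [/eqP|xy]; first by rewrite /coker_class eqmodE => /asboolP.
by apply/eqP; rewrite /coker_class eqmodE; apply/asboolP.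
Qed.

Lemma coker_reprK (q : coker) : coker_class (repr q) = q.
Proof. exact: reprK. Qed.

Lemma coker_repr_class x : exists u, i u = repr (coker_class x) - x.
Proof. by apply/coker_classP; rewrite coker_reprK. Qed.

Definition coker_add (p q : coker) := coker_class (repr p + repr q).
Definition coker_opp (p : coker) := coker_class (- repr p).
Definition coker_scale (a : R) (p : coker) := coker_class (a *: repr p).

Lemma coker_addE x y :
  coker_add (coker_class x) (coker_class y) = coker_class (x + y).
Proof.
have [u uP] := coker_repr_class x; have [v vP] := coker_repr_class y.
by apply/coker_classP; exists (u + v); rewrite linearD uP vP opprD addrACA.
Qed.

Lemma coker_oppE x : coker_opp (coker_class x) = coker_class (- x).
Proof.
have [u uP] := coker_repr_class x.
by apply/coker_classP; exists (- u); rewrite linearN uP opprD.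
Qed.

Lemma coker_scaleE a x : coker_scale a (coker_class x) = coker_class (a *: x).
Proof.
have [u uP] := coker_repr_class x.
by apply/coker_classP; exists (a *: u); rewrite linearZ_LR uP scalerBr.
Qed.

Fact coker_addA : associative coker_add.
Proof.
move=> p q r; rewrite -[p]coker_reprK -[q]coker_reprK -[r]coker_reprK.
by rewrite !coker_addE addrA.
Qed.
Fact coker_addC : commutative coker_add.
Proof. by move=> p q; rewrite /coker_add addrC. Qed.
Fact coker_add0 : left_id (coker_class 0) coker_add.
Proof. by move=> p; rewrite -[p]coker_reprK coker_addE add0r. Qed.
Fact coker_addN : left_inverse (coker_class 0) coker_opp coker_add.
Proof.
by move=> p; rewrite -[p]coker_reprK coker_oppE coker_addE addNr.
Qed.

HB.instance Definition _ :=
  GRing.isZmodule.Build coker coker_addA coker_addC coker_add0 coker_addN.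

Fact coker_scaleA a b p :
  coker_scale a (coker_scale b p) = coker_scale (a * b) p.
Proof. by rewrite -[p]coker_reprK !coker_scaleE scalerA. Qed.
Fact coker_scale1 : left_id 1 coker_scale.
Proof. by move=> p; rewrite -[p]coker_reprK coker_scaleE scale1r. Qed.
Fact coker_scaleDr : right_distributive coker_scale +%R.
Proof.
move=> a p q; rewrite -[p]coker_reprK -[q]coker_reprK.
rewrite [_ + _](coker_addE (repr p) (repr q)) !coker_scaleE scalerDr.
exact: esym (coker_addE _ _).
Qed.
Fact coker_scaleDl p : {morph coker_scale^~ p : a b / a + b}.
Proof.
move=> a b; rewrite -[p]coker_reprK !coker_scaleE scalerDl.
exact: esym (coker_addE _ _).
Qed.

HB.instance Definition _ := GRing.Zmodule_isLmodule.Build R coker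
  coker_scaleA coker_scale1 coker_scaleDr coker_scaleDl.

Lemma coker_class_linear : linear coker_class.
Proof.
move=> a x y; rewrite -[a *: coker_class x]/(coker_scale a _) coker_scaleE.
exact: esym (coker_addE _ _).
Qed.

Definition coker_map : {linear V -> coker} := linear_map coker_class_linear.

Lemma short_exact_coker : injective i -> short_exact i coker_map.
Proof.
move=> iI; split=> // [y|q]; last by exists (repr q); apply: coker_reprK.
by rewrite -[0]/(coker_class 0) /= coker_classP subr0.
Qed.

End Cokernel.

(** * Injective dimension *)

Section Injective.
Variable R : pzRingType.
Implicit Types L M N E F I : lmodType R.

Lemma injective_iso M N (f : {linear M -> N}) :
  injective f -> epi f -> injective_mod N -> injective_mod M.
Proof.
move=> fI fE Ni A B g h gI; have [k [kf fk]] := linear_inverse fI fE.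
have [u uP] := Ni _ _ g (f \o h) gI.
by exists (k \o u) => x; rewrite /= uP /= kf.
Qed.

Lemma injective_prod M N :
  injective_mod M -> injective_mod N -> injective_mod (M * N)%type.
Proof.
move=> Mi Ni A B g h gI.
have [u uP] := Mi _ _ g ((fst : {linear (M * N)%type -> M}) \o h) gI.
have [v vP] := Ni _ _ g ((snd : {linear (M * N)%type -> N}) \o h) gI.
by exists (pair_map u v) => x; rewrite /= uP vP [RHS]surjective_pairing.
Qed.

Lemma right_dim_inv k M : right_dim_le (@injective_mod R) k.+1 M ->
  exists I N (i : {linear M -> I}) (p : {linear I -> N}),
  [/\ short_exact i p, injective_mod I & right_dim_le (@injective_mod R) k N].
Proof.
move=> [D [d [e [[eI ed dd] Di D0]]]].
have d0 x : d 1%N (d 0%N x) = 0 := exact0 x (dd 0%N).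
exists (D 0%N), (ker (d 1%N)), e, (ker_lift d0); split; [split=> // | exact: Di | ].
- move=> y; apply: iff_trans (ed y).
  by split=> [/(congr1 val)//|y0]; apply: val_inj.
- move=> y; have [x xP] := (dd 0%N (kerv _ y)).1 (kervP y).
  by exists x; apply: kerv_inj.
exists (fun j => D j.+1), (fun j => d j.+1), (kerv (d 1%N)); split.
- by split=> [|y|j]; [apply: kerv_inj | apply: kerv_exact | apply: dd].
- by move=> j jk; apply: Di.
- by move=> j jk; apply: D0.
Qed.

Lemma right_dimS k M I N (i : {linear M -> I}) (p : {linear I -> N}) :
  short_exact i p -> injective_mod I -> right_dim_le (@injective_mod R) k N ->
  right_dim_le (@injective_mod R) k.+1 M.
Proof.
move=> [iI ip pE] Ii [D [d [e [[eI ed dd] Di D0]]]].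
pose D' j : lmodType R := if j is j'.+1 then D j' else I.
pose d' j : {linear D' j -> D' j.+1} :=
  match j with 0 => e \o p | j'.+1 => d j' end.
exists D', d', i; split; [split=> // | by case | by case].
- move=> y; apply: iff_trans (ip y); rewrite /=.
  by split=> [/(inj0 eI)//|->]; rewrite linear0.
- case=> [|j] y; last exact: dd.
  rewrite ed; split=> [[x <-]|[x <-]]; last by exists (p x).
  by have [z <-] := pE x; exists z.
Qed.

Lemma right_dim0 M : right_dim_le (@injective_mod R) 0 M <-> injective_mod M.
Proof.
split=> [[D [d [e [[eI ed dd] Di D0]]]]|Mi].
  apply: (injective_iso eI) (Di 0%N _) => // y; apply/ed; exact: (D0 1%N).
pose D j : lmodType R := if j is _.+1 then 'rV[R]_0 else M.
exists D, (fun j => linear_map (@zero_linear _ (D j) (D j.+1))), idfun.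
split; [split=> // | by case | by case=> // j _; apply: trivial_zero].
- by move=> y; split=> // _; exists y.
- by move=> j y; split=> // _; exists 0; rewrite [y]trivial_zero [LHS]trivial_zero.
Qed.

Lemma right_dimW k k' M : (k <= k')%N ->
  right_dim_le (@injective_mod R) k M -> right_dim_le (@injective_mod R) k' M.
Proof.
move=> kk [D [d [e [res Di D0]]]]; exists D, d, e; split=> // j jk.
  have [/Di//|/D0 Dj] := leqP j k.
  move=> A B g f gI; exists (linear_map (@zero_linear _ B (D j))) => x.
  by rewrite [RHS]Dj.
exact/D0/(leq_ltn_trans kk).
Qed.

Lemma right_dim_prod k F N : injective_mod F ->
  right_dim_le (@injective_mod R) k N -> right_dim_le (@injective_mod R) k (F * N)%type.
Proof.
case: k => [|k] Fi; first by rewrite !right_dim0; apply: injective_prod.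
move=> /right_dim_inv[I [N' [i [p [[iI ip pE] Ii dN']]]]].
pose i' := pair_map (fst : {linear (F * N)%type -> F})
  (i \o (snd : {linear (F * N)%type -> N})).
apply: (@right_dimS _ _ (F * I)%type _ i'
  (p \o (snd : {linear (F * I)%type -> I}))) dN'; last exact: injective_prod.
split.
- by move=> [a b] [c d] [/= -> /iI->].
- move=> [a b]; split=> [/ip[x xP]|[[c d] [_ <-]]]; last exact: (exact0 d ip).
  by exists (a, x); rewrite /= xP.
- by move=> y; have [x <-] := pE y; exists (0, x).
Qed.

(** Dimension shifting in both variables: Ext^1(M, N') = Ext^2(M, N), which is
    Ext^1(L, N) for the first syzygy L of M. Iterating it to the left along an
    unbounded exact complex of injectives kills Ext^1(M, -) on the cycles for all M
    of finite projective dimension. *)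
Lemma ext_proj_cosyzygy k N I N' (i : {linear N -> I}) (p : {linear I -> N'}) :
  injective_mod I -> short_exact i p ->
  (forall M, proj_dim_le k M -> ext_proj M N) ->
  forall M, proj_dim_le k.+1 M -> ext_proj M N'.
Proof.
move=> Ii [iI ip pE] kN M dM L P j q jq Pp g.
have dL : proj_dim_le k L := left_dim_syzygy (resolving_projective R) jq Pp dM.
have [Q [c [Qp cE]]] := enough_projectives L.
have [t tP] := Qp _ _ p (g \o c) pE.
have [u uP] : exists u : {linear ker c -> N}, forall x, i (u x) = (t \o kerv c) x.
  apply: mono_factor => // x; apply/ip.
  by rewrite tP -[RHS](linear0 g); congr (g _); apply: kervP.
have [v vP] := kN L dL _ _ _ _ (short_exact_ker cE) Qp u.
have dl : linear (fun x => t x - i (v x)).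
  by move=> a x y; rewrite !linearP scalerDr addrACA.
have [|w wP] := epi_factor (f := linear_map dl) cE.
  by move=> x /kerv_onto[z <-]; rewrite /= vP uP subrr.
case: jq => jI _ _; have [h hP] := Ii _ _ j w jI.
exists (p \o h) => x; have [y <-] := cE x.
by rewrite /= hP wP /= linearB tP (exact0 _ ip) subr0.
Qed.

(** A map on a submodule U of V extends because Ext^1(V / U, N) = 0. *)
Lemma ext_proj_injective N : (forall M, ext_proj M N) -> injective_mod N.
Proof.
move=> extN U V i f iI.
by apply: (ext_proj_zero (extN _)) (short_exact_coker iI) f.
Qed.
End Injective.

(** * Complexes of modules of finite injective dimension *)

Section InjectiveComplexes.
Variable R : pzRingType.
Implicit Types (X Y : complex R) (F : int -> lmodType R).
Notation id_le := (right_dim_le (@injective_mod R)).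

(** Extending u0 = psi d to e along psi splits the first factor off the quotient of
    disk F by X, whose terms therefore are F m * C m with C m the cokernel of psi m. *)
Lemma disk_envelope k X : (forall n, id_le k.+1 (X n)) ->
  exists F X'' (i : chain_map X (disk F)) (q : chain_map (disk F) X''),
  [/\ forall n, injective_mod (F n), forall n, short_exact (i n) (q n)
    & forall n, id_le k (X'' n)].
Proof.
move=> Xk.
have /dep_choice[I IP] : forall n, exists I : lmodType R, injective_mod I /\
    exists (N : lmodType R) (i : {linear X n -> I}) (p : {linear I -> N}),
      short_exact i p /\ id_le k N.
  move=> n; have [I [N [i [p [ip Ii dN]]]]] := right_dim_inv (Xk n).
  by exists I; split=> //; exists N, i, p.
pose F m := I (m - 1).
have Fi m : injective_mod (F m) by case: (IP (m - 1)).
have /dep_choice[C /dep_choice[psi /dep_choice[c cP]]] : forall n,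
    exists (N : lmodType R) (i : {linear X n -> F (n + 1)}) (p : {linear F (n + 1) -> N}),
      short_exact i p /\ id_le k N.
  by move=> n; rewrite /F addrK; case: (IP n).
have psiI n : injective (psi n) by case: (cP n) => -[].
have [u uP] : exists u : forall m, {linear X m -> F m},
    forall n x, u (n + 1) x = psi n (cdiff X n x).
  apply: (@shift_choice (fun m => {linear X m -> F m})
    (fun n v => forall x, v x = psi n (cdiff X n x))) => n.
  by exists (psi n \o cdiff X n).
have ud n x : u n (cdiff X n x) = 0.
  by move: n x; apply: int_shift => n x; rewrite uP cdiffK linear0.
(* e is not compatible with the differentials; it only serves to identify the
   terms of the quotient. *)
have [e eP] := dep_choice (fun n => Fi n _ _ (psi n) (u n) (psiI n)).
have iE n x : pair_map (u n) (psi n) (cdiff X n x) =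
    cdiff (disk F) n (pair_map (u (n + 1)) (psi (n + 1)) x).
  by rewrite /= ud uP.
pose i : chain_map X (disk F) :=
  @ChainMap _ X (disk F) (fun n => pair_map (u n) (psi n)) iE.
pose Z n : lmodType R := (F n * C n)%type.
have ql n : linear (fun x : disk F n => (x.1 - e n x.2, c n x.2) : Z n).
  by move=> a x y; congr (_, _); rewrite /= !linearP // scalerDr addrACA.
pose q n : {linear disk F n -> Z n} := linear_map (ql n).
have iq n : short_exact (i n) (q n).
  have [[_ pc cE] _] := cP n; split.
  - by move=> x y [_ /psiI].
  - move=> [a b]; split=> [[/eqP]|[x <-]]; last first.
      by rewrite /= eP subrr (exact0 _ pc).
    rewrite subr_eq0 => /eqP-> /pc[x <-]; exists x.
    by rewrite /= eP.
  - move=> [a y]; have [b <-] := cE y; exists (a + e n b, b).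
    by rewrite /= addrK.
have qE n : epi (q n) by case: (iq n).
have /dep_choice[d dP] : forall n, exists d : {linear Z (n + 1) -> Z n},
    forall x, d (q (n + 1) x) = q n (cdiff (disk F) n x).
  move=> n.
  apply: (@epi_factor _ _ _ _ (q (n + 1)) (q n \o cdiff (disk F) n)) => // x.
  case: (iq (n + 1)) => _ h _ /h[y <-].
  have : q n (i n (cdiff X n y)) = 0 by case: (iq n) => _ /exact0.
  by rewrite cmapE.
have dK n x : d n (d (n + 1) x) = 0.
  by have [y <-] := qE _ x; rewrite !dP cdiffK linear0.
exists F, (Complex dK), i, (@ChainMap _ (disk F) (Complex dK) q (fun n x => esym (dP n x))).
split=> // n; have [_ dC] := cP n; exact: right_dim_prod.
Qed.

(** Dual to the lemma for the left class: X is replaced by the cokernel of its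
    envelope until its terms are injective. *)
Lemma null_dg_right N0 k r X Y :
  (forall M : lmodType R, proj_dim_le N0 M) -> (k <= r)%N ->
  exact_complex Y -> (forall N n, id_le r N -> ext_zero (Y n) N) ->
  (forall n, id_le k (X n)) ->
  forall f : chain_map Y X, null_homotopic f.
Proof.
move=> gl; elim: k X => [|k IHk] X kr Yex YN Xk f.
  apply: (@exact_to_injective _ N0.+1) => // n; first exact: gl.
  exact: ((right_dim0 (X n)).1 (Xk n)).
have [F [X'' [i [q [_ iq dX'']]]]] := disk_envelope Xk.
refine (null_colift iq _ _ _ f).
- move=> n t; apply: ext_zero_lift (iq _) _ t.
  exact: YN (right_dimW kr (Xk _)).
- exact: null_to_disk.
- by apply: IHk => // [|n]; [apply: ltnW | apply: dX''].
Qed.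

End InjectiveComplexes.

(** * Gradings and homogeneous components *)

Lemma fsum_add (K : eqType) (V : zmodType) (c c' : K -> V) :
  finsupp c -> finsupp c' -> finsupp (fun k => c k + c' k).
Proof.
move=> [s sP] [t tP]; exists (s ++ t) => k.
by rewrite mem_cat negb_or => /andP[/sP-> /tP->]; rewrite addr0.
Qed.

Lemma finsupp_morph (K : eqType) (V W : zmodType) (f : {additive V -> W}) (c : K -> V) :
  finsupp c -> finsupp (fun k => f (c k)).
Proof. by move=> [s sP]; exists s => k /sP->; rewrite raddf0. Qed.

Lemma finsupp_shift (V : zmodType) (c : int -> V) i :
  finsupp c -> finsupp (fun k => c (k + i)).
Proof.
move=> [s sP]; exists [seq k - i | k <- s] => k ks; apply: sP; apply: contra ks => ks.
by apply/mapP; exists (k + i); rewrite ?addrK.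
Qed.

Lemma fsum_shift (V : zmodType) (c : int -> V) i :
  finsupp c -> fsum (fun k => c (k + i)) = fsum c.
Proof.
move=> [s sP]; have s0 k : k \notin undup s -> c k = 0 by rewrite mem_undup => /sP.
rewrite (fsumE (undup_uniq s) s0) (@fsumE _ _ _ [seq k - i | k <- undup s]).
- by rewrite big_map; apply: eq_bigr => k _; rewrite subrK.
- by rewrite map_inj_uniq ?undup_uniq //; apply: addIr.
- move=> k ks; apply: s0; apply: contra ks => ks.
  by apply/mapP; exists (k + i); rewrite ?addrK.
Qed.

Section Grading.
Variables (V : zmodType) (p : int -> {pred V}).

Definition homogeneous_family (c : int -> V) := finsupp c /\ forall n, c n \in p n.

Lemma grading_decomp v : is_grading p -> exists c, homogeneous_family c /\ fsum c = v.
Proof.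
move=> [pz pd _]; have [s [c [cP ->]]] := pd v.
elim: s => [|n s [c' [[c'f c'P] cs]]].
  exists (fun _ => 0); split; first by split; [exists [::] | move=> n; case: (pz n)].
  by rewrite big_nil (@fsumE _ _ _ [::]) // big_nil.
pose c1 k := if k == n then c n else 0.
have c1f : finsupp c1 by exists [:: n] => k; rewrite inE /c1 => /negPf->.
exists (fun k => c1 k + c' k); split.
  split=> [|k]; first exact: fsum_add.
  have [p0 pB] := pz k; rewrite -[c' k]opprK pB //; last by rewrite -sub0r pB.
  by rewrite /c1; case: eqP => [->|].
rewrite big_cons -cs fsumD // (@fsum_single _ _ n); first by rewrite /c1 eqxx.
by move=> k; rewrite /c1 => /negPf->.
Qed.

Lemma grading_uniq c c' : is_grading p ->
  homogeneous_family c -> homogeneous_family c' -> fsum c = fsum c' -> c =1 c'.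
Proof.
move=> [pz _ pu] [cf cP] [c'f c'P] cc k.
have bf : finsupp (fun k => c k - c' k).
  by apply: fsum_add => //; apply: (finsupp_morph (-%R)).
have s0 : fsum (fun k => c k - c' k) = 0.
  rewrite fsumD //; last exact: (finsupp_morph (-%R)).
  by rewrite (fsum_morph (-%R) c'f) /= cc subrr.
have [s sP] := bf; have s1 n : n \notin undup s -> c n - c' n = 0.
  by rewrite mem_undup => /sP.
have [ks|/s1/eqP] := boolP (k \in undup s); last by rewrite subr_eq0 => /eqP.
apply/eqP; rewrite -subr_eq0; apply/eqP.
apply: (pu (undup s) (fun k => c k - c' k)) ks; first exact: undup_uniq.
  by move=> n; case: (pz n) => _; apply.
by rewrite -(fsumE (undup_uniq s) s1).
Qed.

(** Families with finite support are easier to add, pair and shift than sums over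
    lists of degrees. *)
Lemma grading_intro :
  (forall n, zmod_closed (p n)) ->
  (forall v, exists c, homogeneous_family c /\ fsum c = v) ->
  (forall c, homogeneous_family c -> fsum c = 0 -> forall n, c n = 0) ->
  is_grading p.
Proof.
move=> pz pd pu; split=> // [v|s c us cP s0 n ns].
  have [c [[[s sP] cP] <-]] := pd v; exists (undup s), c; split=> //.
  by apply: fsumE; rewrite ?undup_uniq // => k; rewrite mem_undup => /sP.
pose c' k := if k \in s then c k else 0.
have c's k : k \notin s -> c' k = 0 by rewrite /c' => /negPf->.
suff : c' n = 0 by rewrite /c' ns.
apply: pu; first split.
- by exists s.
- by move=> k; rewrite /c'; case: ifP => // _; case: (pz k).
- rewrite (fsumE us c's) -[RHS]s0 big_seq [RHS]big_seq.
  by apply: eq_bigr => k ks; rewrite /c' ks.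
Qed.
End Grading.

Section Components.
Variables (A : gradedRing) (M : gradedModule A).

Definition gcomp (n : int) (v : M) : M :=
  projT1 (cid (grading_decomp v (mdeg_grading M))) n.

Lemma gcompP v : homogeneous_family (mdeg M) (gcomp^~ v) /\ fsum (gcomp^~ v) = v.
Proof. exact: projT2 (cid (grading_decomp v (mdeg_grading M))). Qed.

Lemma gcomp_deg n v : gcomp n v \in mdeg M n.
Proof. by case: (gcompP v) => -[]. Qed.

Lemma gcomp_supp v : finsupp (gcomp^~ v).
Proof. by case: (gcompP v) => -[]. Qed.

Lemma gcomp_eq c v : homogeneous_family (mdeg M) c -> fsum c = v ->
  forall n, gcomp n v = c n.
Proof.
move=> cP cv; have [gP gv] := gcompP v.
by apply: (grading_uniq (mdeg_grading M) gP cP); rewrite gv cv.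
Qed.

Lemma mdeg_closed n : zmod_closed (mdeg M n).
Proof. by case: (mdeg_grading M). Qed.

Lemma mdeg0 n : 0 \in mdeg M n. Proof. by case: (mdeg_closed n). Qed.

Lemma mdegN n v : v \in mdeg M n -> - v \in mdeg M n.
Proof. by move=> vn; case: (mdeg_closed n) => v0 vB; rewrite -sub0r vB. Qed.

Lemma mdegD n v w : v \in mdeg M n -> w \in mdeg M n -> v + w \in mdeg M n.
Proof.
by move=> vn /mdegN wn; case: (mdeg_closed n) => v0 vB; rewrite -[w]opprK vB.
Qed.

Lemma gcompD n v w : gcomp n (v + w) = gcomp n v + gcomp n w.
Proof.
have [[vf vP] vE] := gcompP v; have [[wf wP] wE] := gcompP w.
apply: (gcomp_eq (c := fun n => gcomp n v + gcomp n w)); last by rewrite fsumD ?vE ?wE.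
by split=> [|k]; [apply: fsum_add | apply: mdegD].
Qed.

Lemma gcomp_homog n v : v \in mdeg M n -> forall m, gcomp m v = if m == n then v else 0.
Proof.
move=> vn; apply: (gcomp_eq (c := fun m => if m == n then v else 0)).
  split; first by exists [:: n] => k; rewrite inE => /negPf->.
  by move=> k; case: eqP => [->//|_]; apply: mdeg0.
by rewrite (@fsum_single _ _ n) ?eqxx // => k /negPf->.
Qed.

Lemma gcomp_id n v : v \in mdeg M n -> gcomp n v = v.
Proof. by move=> /gcomp_homog->; rewrite eqxx. Qed.

Lemma gcomp_ind (P : M -> Prop) :
  P 0 -> (forall v w, P v -> P w -> P (v + w)) ->
  (forall n v, v \in mdeg M n -> P v) -> forall v, P v.
Proof.
move=> P0 PD Ph v; have [[[s sP] vP] <-] := gcompP v.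
rewrite (@fsumE _ _ _ (undup s)) ?undup_uniq //.
  by apply: big_ind => // n _; apply: Ph (vP n).
by move=> k; rewrite mem_undup => /sP.
Qed.

Lemma gcompZ i a n v : a \in rdeg A i -> gcomp (i + n) (a *: v) = a *: gcomp n v.
Proof.
move=> ai; have [[vf vP] vE] := gcompP v.
rewrite (@gcomp_eq (fun k => a *: gcomp (k - i) v)); first by rewrite /= addrAC subrr add0r.
  split; last by move=> k; have := mdegZ ai (gcomp_deg (k - i) v); rewrite [i + _]addrC subrK.
  exact/(finsupp_morph ( *:%R a))/finsupp_shift.
rewrite (fsum_morph ( *:%R a) (finsupp_shift (- i) vf)).
by rewrite (fsum_shift (- i) vf) vE.
Qed.
End Components.

Lemma gcomp_hom (A : gradedRing) (M N : gradedModule A) (f : gradedHom M N) n v :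
  gcomp n (f v) = f (gcomp n v).
Proof.
have [[vf vP] vE] := gcompP v; apply: (gcomp_eq (c := fun n => f (gcomp n v))).
  by split=> [|k]; [apply: finsupp_morph | apply: ghom_deg].
by rewrite (fsum_morph f vf) vE.
Qed.

(** * Graded dual numbers *)

(** A graded ring A that is R[x]/(x^2) with x in degree -1, the element a being
    co0 a + co1 a x. Left and right modules over the dual numbers are both
    covered: the opposite of the dual numbers over R is of this form over the
    opposite of R, its product differing from that of the dual numbers over R^c by
    the order of the summands. *)
Record dual_over (R : pzRingType) (A : gradedRing) := DualOver {
  cst : R -> A; dx : A; co0 : A -> R; co1 : A -> R;
  co_decomp : forall a, a = cst (co0 a) + cst (co1 a) * dx;
  co0D : {morph co0 : a b / a + b};
  co1D : {morph co1 : a b / a + b};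
  co01 : co0 1 = 1; co11 : co1 1 = 0;
  co0M : {morph co0 : a b / a * b};
  co1M : forall a b, co1 (a * b) = co0 a * co1 b + co1 a * co0 b;
  cst1 : cst 1 = 1;
  cstD : {morph cst : r s / r + s};
  cstM : {morph cst : r s / r * s};
  dxC : forall r, dx * cst r = cst r * dx;
  dxx : dx * dx = 0;
  co0_cst : cancel cst co0; co1_cst : forall r, co1 (cst r) = 0;
  co0_dx : co0 dx = 0; co1_dx : co1 dx = 1;
  cst_deg : forall r, cst r \in rdeg A 0;
  dx_deg : dx \in rdeg A (-1);
  co0_deg : forall i a, a \in rdeg A i -> i != 0 -> co0 a = 0;
  co1_deg : forall i a, a \in rdeg A i -> i != -1 -> co1 a = 0 }.

Section DualNumbers.
Variable R : pzRingType.

Lemma dn_deg0 i (a : dnum R) : a \in @dn_deg R i -> i != 0 -> a.1 = 0.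
Proof. by rewrite inE => /andP[h _] /negPf i0; move: h; rewrite i0 => /eqP. Qed.

Lemma dn_deg1 i (a : dnum R) : a \in @dn_deg R i -> i != -1 -> a.2 = 0.
Proof. by rewrite inE => /andP[_ h] /negPf i0; move: h; rewrite i0 => /eqP. Qed.

Definition dn_dual : dual_over R (dn_gring R).
Proof.
apply: (@DualOver R (dn_gring R) (@dn_const R) (dn_x R) fst snd) => //.
- exact: dn_decomp.
- exact: dn_constD.
- exact: dn_constM.
- exact: dn_xC.
- exact: dn_xx.
- exact: dn_const_deg.
- exact: dn_x_deg.
- exact: dn_deg0.
- exact: dn_deg1.
Defined.

Definition opp_dual : dual_over R^c (opp_gring (dn_gring R)).
Proof.
apply: (@DualOver R^c (opp_gring (dn_gring R)) (@dn_const R) (dn_x R) fst snd) => //.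
- by move=> a; rewrite {1}(dn_decomp a); congr (_ + _); apply: esym (dn_xC _).
- by move=> a b; rewrite /= addrC.
- exact: dn_constD.
- by move=> a b; apply: dn_constM.
- by move=> r; apply/esym/dn_xC.
- exact: dn_xx.
- exact: dn_const_deg.
- exact: dn_x_deg.
- exact: dn_deg0.
- exact: dn_deg1.
Defined.
End DualNumbers.

(** Restriction of scalars from A to R; D is an argument so that the R-module
    structure can be found from the type. *)
Definition res (R : pzRingType) (A : gradedRing) (D : dual_over R A)
  (M : lmodType A) : Type := M.

(** V * V with x (v, w) = (0, v): both the induced and the coinduced module. *)
Definition dbl (R : pzRingType) (A : gradedRing) (D : dual_over R A)
  (V : lmodType R) : Type := (V * V)%type.

Section Restriction.
Variables (R : pzRingType) (A : gradedRing) (D : dual_over R A).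

Local Notation res := (res D).
Local Notation dbl := (dbl D).

Section Res.
Variable M : lmodType A.
HB.instance Definition _ := GRing.Zmodule.copy (res M) M.

Definition res_scale (r : R) (m : res M) : res M := cst D r *: (m : M).

Fact res_scaleA a b m : res_scale a (res_scale b m) = res_scale (a * b) m.
Proof. by rewrite /res_scale scalerA cstM. Qed.
Fact res_scale1 : left_id 1 res_scale.
Proof. by move=> m; rewrite /res_scale cst1 scale1r. Qed.
Fact res_scaleDr : right_distributive res_scale +%R.
Proof. by move=> a m m'; apply: scalerDr. Qed.
Fact res_scaleDl m : {morph res_scale^~ m : a b / a + b}.
Proof. by move=> a b; rewrite /res_scale cstD; apply: scalerDl. Qed.

HB.instance Definition _ := GRing.Zmodule_isLmodule.Build R (res M)
  res_scaleA res_scale1 res_scaleDr res_scaleDl.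
End Res.

Lemma res_linear (M N : lmodType A) (f : {linear M -> N}) :
  linear (f : res M -> res N).
Proof. by move=> a x y; apply: (linearP f (cst D a)). Qed.

Definition resl (M N : lmodType A) (f : {linear M -> N}) : {linear res M -> res N} :=
  linear_map (res_linear f).

Lemma xact_linear (M : lmodType A) : linear (fun m : res M => dx D *: (m : M) : res M).
Proof.
move=> a x y; rewrite scalerDr; congr (_ + _).
by rewrite -![a *: _]/(cst D a *: (_ : M)) !scalerA dxC.
Qed.

Definition xact (M : lmodType A) : {linear res M -> res M} := linear_map (@xact_linear M).

Lemma xactK (M : lmodType A) (m : M) : xact M (xact M m) = 0.
Proof. by rewrite /= scalerA dxx scale0r. Qed.

Lemma scale_dual (M : lmodType A) (a : A) (m : M) :
  a *: m = (co0 D a *: (m : res M)) + co1 D a *: xact M m.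
Proof. by rewrite {1}(co_decomp D a) scalerDl -scalerA. Qed.

Lemma hom_x (M N : lmodType A) (f : {linear M -> N}) m : f (xact M m) = xact N (f m).
Proof. exact: linearZ_LR. Qed.

(** The ring A is generated by R and x. *)
Lemma dual_linear (M N : lmodType A) (f : {linear res M -> res N}) :
  (forall m, f (xact M m) = xact N (f m)) -> linear (f : M -> N).
Proof.
move=> fx a u v; rewrite [a *: u]scale_dual [a *: f u]scale_dual.
by rewrite !linearD !linearZ_LR fx.
Qed.

Lemma xact_deg (M : gradedModule A) n (m : M) :
  m \in mdeg M (n + 1) -> xact M m \in mdeg M n.
Proof. by move=> /(mdegZ (dx_deg D)); rewrite addrC addrK. Qed.

Lemma xact_deg1 (M : gradedModule A) n (m : M) :
  m \in mdeg M n -> xact M m \in mdeg M (n - 1).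
Proof. by move=> mn; apply: xact_deg; rewrite subrK. Qed.

Lemma cst_mdeg (M : gradedModule A) n r (m : M) :
  m \in mdeg M n -> r *: (m : res M) \in mdeg M n.
Proof. by move=> mn; have := mdegZ (cst_deg D r) mn; rewrite add0r. Qed.


Section Dbl.
Variable V : lmodType R.
HB.instance Definition _ := GRing.Zmodule.copy (dbl V) (V * V)%type.

Definition dbl_scale (a : A) (u : dbl V) : dbl V :=
  (co0 D a *: u.1, co0 D a *: u.2 + co1 D a *: u.1).

Fact dbl_scaleA a b u : dbl_scale a (dbl_scale b u) = dbl_scale (a * b) u.
Proof.
rewrite /dbl_scale /= co0M co1M !scalerA scalerDr !scalerA scalerDl.
by rewrite addrA.
Qed.
Fact dbl_scale1 : left_id 1 dbl_scale.
Proof. by case=> u v; rewrite /dbl_scale co01 co11 !scale1r scale0r addr0. Qed.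
Fact dbl_scaleDr : right_distributive dbl_scale +%R.
Proof. by move=> a u v; congr (_, _); rewrite /= !scalerDr // addrACA. Qed.
Fact dbl_scaleDl u : {morph dbl_scale^~ u : a b / a + b}.
Proof.
by move=> a b; congr (_, _); rewrite /= co0D ?co1D !scalerDl // addrACA.
Qed.

HB.instance Definition _ := GRing.Zmodule_isLmodule.Build A (dbl V)
  dbl_scaleA dbl_scale1 dbl_scaleDr dbl_scaleDl.

Lemma dbl_x (u : dbl V) : xact (dbl V) u = (0, u.1).
Proof.
by rewrite /= -[LHS]/(dbl_scale _ _) /dbl_scale co0_dx co1_dx !scale0r scale1r add0r.
Qed.

Lemma dbl_cst r (u : dbl V) : r *: (u : res (dbl V)) = (r *: u.1, r *: u.2).
Proof.
by rewrite -[LHS]/(dbl_scale _ _) /dbl_scale co0_cst co1_cst scale0r addr0.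
Qed.
End Dbl.
End Restriction.

Lemma fsum_pair (K : eqType) (V W : zmodType) (c : K -> V) (c' : K -> W) :
  finsupp c -> finsupp c' ->
  finsupp (fun k => (c k, c' k)) /\ fsum (fun k => (c k, c' k)) = (fsum c, fsum c').
Proof.
move=> [s sP] [t tP].
have cf : finsupp (fun k => (c k, c' k)).
  by exists (s ++ t) => k; rewrite mem_cat negb_or => /andP[/sP-> /tP->].
split=> //; rewrite [LHS]surjective_pairing.
rewrite -(fsum_morph (fst : {additive (V * W)%type -> V}) cf).
by rewrite -(fsum_morph (snd : {additive (V * W)%type -> W}) cf).
Qed.

(** * Cones and cells *)

Section GradedConstructions.
Variables (R : pzRingType) (A : gradedRing) (D : dual_over R A).
Local Notation res := (res D).
Local Notation dbl := (dbl D).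
Local Notation x_ := (xact D _).
Implicit Types M N P : gradedModule A.

(** The mapping cone of the identity of M, shifted by i. *)
Section Cone.
Variables (M : gradedModule A) (i : int).

Definition cone_deg (k : int) : {pred dbl (res M)} :=
  [pred u : dbl (res M) | (u.1 \in mdeg M (k + i)) && (u.2 \in mdeg M (k + 1 + i))].

Lemma cone_deg_grading : is_grading cone_deg.
Proof.
apply: grading_intro.
- move=> k; split=> [|u v]; rewrite !inE /=; first by rewrite !mdeg0.
  by move=> /andP[u1 u2] /andP[v1 v2]; rewrite !mdegD ?mdegN.
- move=> u.
  have f1 := finsupp_shift i (gcomp_supp u.1).
  have f2 := finsupp_shift (1 + i) (gcomp_supp u.2).
  have [cf cs] := fsum_pair f1 f2.
  exists (fun k => (gcomp (k + i) u.1, gcomp (k + (1 + i)) u.2)); split.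
    by split=> // k; rewrite inE /= -addrA !gcomp_deg.
  apply: etrans cs _; rewrite (fsum_shift _ (gcomp_supp _)) (fsum_shift _ (gcomp_supp _)).
  by rewrite !(gcompP _).2; case: u {f1 f2 cf}.
move=> c [cf cP] c0 k.
have fam0 : homogeneous_family (mdeg M) (fun _ => 0).
  by split; [exists [::] | move=> ?; apply: mdeg0].
have sum0 : fsum (fun _ : int => 0 : M) = 0 by rewrite (@fsumE _ _ _ [::]) ?big_nil.
pose c1 n : M := (c n).1; pose c2 n : M := (c n).2.
have c1f : finsupp c1 by case: cf => s sP; exists s => n; rewrite /c1 => /sP->.
have c2f : finsupp c2 by case: cf => s sP; exists s => n; rewrite /c2 => /sP->.
have s1 : fsum c1 = 0.
  rewrite -[RHS]/((0 : (M * M)%type).1) -c0.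
  exact: (fsum_morph (fst : {additive (M * M)%type -> M}) cf).
have s2 : fsum c2 = 0.
  rewrite -[RHS]/((0 : (M * M)%type).2) -c0.
  exact: (fsum_morph (snd : {additive (M * M)%type -> M}) cf).
have z1 : c1 k = 0.
  have := grading_uniq (mdeg_grading M) (c := fun n => c1 (n - i)) _ fam0.
  move=> /(_ _ _ (k + i)) /=; rewrite addrK; apply.
    split; first exact: finsupp_shift.
    by move=> n; have /andP[+ _] := cP (n - i); rewrite subrK.
  by rewrite sum0 (fsum_shift _ c1f).
have z2 : c2 k = 0.
  have := grading_uniq (mdeg_grading M) (c := fun n => c2 (n - (1 + i))) _ fam0.
  move=> /(_ _ _ (k + (1 + i))) /=; rewrite addrK; apply.
    split; first exact: finsupp_shift.
    by move=> n; have /andP[_] := cP (n - (1 + i)); rewrite -addrA subrK.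
  by rewrite sum0 (fsum_shift _ c2f).
by rewrite [c k]surjective_pairing -/(c1 k) -/(c2 k) z1 z2.
Qed.

Lemma cone_degZ j k a (u : dbl (res M)) :
  a \in rdeg A j -> u \in cone_deg k -> a *: u \in cone_deg (j + k).
Proof.
move=> aj; rewrite !inE => /andP[u1 u2].
rewrite -[a *: u]/(dbl_scale a u) /=.
have [j0|j0] := eqVneq j 0.
  rewrite (co1_deg D aj) ?j0 // scale0r addr0 add0r.
  by rewrite !cst_mdeg.
rewrite (co0_deg D aj) // !scale0r add0r mdeg0 /=.
have [j1|j1] := eqVneq j (-1); last by rewrite (co1_deg D aj) // scale0r mdeg0.
by rewrite cst_mdeg // j1; have -> : -1 + k + 1 + i = k + i by lia.
Qed.

Definition cone : gradedModule A := GradedModule cone_deg_grading cone_degZ.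
End Cone.

(** The induced and coinduced modules of a module V that sits in one degree. *)
Section Cell.
Variables (V : lmodType R) (n : int).

Definition cell_deg (k : int) : {pred dbl V} :=
  [pred u : dbl V | ((k == n + 1) || (u.1 == 0)) && ((k == n) || (u.2 == 0))].

Lemma cell_deg_grading : is_grading cell_deg.
Proof.
apply: grading_intro.
- move=> k; split=> [|u v]; rewrite !inE /= ?eqxx ?orbT //.
  move=> /andP[u1 u2] /andP[v1 v2]; apply/andP; split.
    by case: (k == n + 1) u1 v1 => //= /eqP-> /eqP->; rewrite subr0.
  by case: (k == n) u2 v2 => //= /eqP-> /eqP->; rewrite subr0.
- move=> u.
  have f1 : finsupp (fun k => if k == n + 1 then u.1 else 0).
    by exists [:: n + 1] => k; rewrite inE => /negPf->.
  have f2 : finsupp (fun k => if k == n then u.2 else 0).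
    by exists [:: n] => k; rewrite inE => /negPf->.
  have [cf cs] := fsum_pair f1 f2.
  exists (fun k => (if k == n + 1 then u.1 else 0, if k == n then u.2 else 0)); split.
    by split=> // k; rewrite inE /=; case: (k == n + 1); case: (k == n); rewrite ?eqxx ?orbT.
  apply: etrans cs _; rewrite (@fsum_single _ _ (n + 1)); last by move=> k /negPf->.
  rewrite (@fsum_single _ _ n); last by move=> k /negPf->.
  by rewrite !eqxx; case: u {f1 f2 cf}.
move=> c [cf cP] c0 k.
have z1 : (c k).1 = 0.
  have [kn|kn] := eqVneq k (n + 1); last first.
    by have := cP k; rewrite inE (negPf kn) => /andP[/eqP].
  rewrite -[RHS]/((0 : (V * V)%type).1) -c0.
  rewrite -[RHS](fsum_morph (fst : {additive (V * V)%type -> V}) cf) kn.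
  apply/esym; apply: (fsum_single (c := fun k => (c k).1)) => m mn.
  by have := cP m; rewrite inE (negPf mn) => /andP[/eqP].
have z2 : (c k).2 = 0.
  have [kn|kn] := eqVneq k n; last first.
    by have := cP k; rewrite inE (negPf kn) => /andP[_ /eqP].
  rewrite -[RHS]/((0 : (V * V)%type).2) -c0.
  rewrite -[RHS](fsum_morph (snd : {additive (V * V)%type -> V}) cf) kn.
  apply/esym; apply: (fsum_single (c := fun k => (c k).2)) => m mn.
  by have := cP m; rewrite inE (negPf mn) => /andP[_ /eqP].
by rewrite [c k]surjective_pairing z1 z2.
Qed.

Lemma cell_degZ j k a (u : dbl V) :
  a \in rdeg A j -> u \in cell_deg k -> a *: u \in cell_deg (j + k).
Proof.
move=> aj; rewrite !inE => /andP[u1 u2].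
rewrite -[a *: u]/(dbl_scale a u) /=.
have [j0|j0] := eqVneq j 0.
  rewrite (co1_deg D aj) ?j0 // scale0r addr0 add0r; apply/andP; split.
    by case: eqP u1 => //= _ /eqP->; rewrite scaler0.
  by case: eqP u2 => //= _ /eqP->; rewrite scaler0.
rewrite (co0_deg D aj) // !scale0r add0r eqxx orbT /=.
have [j1|j1] := eqVneq j (-1); last by rewrite (co1_deg D aj) // scale0r eqxx orbT.
have -> : (j + k == n) = (k == n + 1) by lia.
by case: eqP u1 => //= _ /eqP->; rewrite scaler0.
Qed.

Definition cell : gradedModule A := GradedModule cell_deg_grading cell_degZ.
End Cell.

Lemma cell_map_linear (V W : lmodType R) (f : {linear V -> W}) :
  linear (fun u : dbl V => (f u.1, f u.2) : dbl W).
Proof.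
move=> a u v; congr (_, _); first by rewrite /= linearP.
by rewrite /= !linearD !linearZ_LR.
Qed.

Lemma cell_map_deg (V W : lmodType R) n (f : {linear V -> W}) k (u : cell V n) :
  u \in mdeg (cell V n) k ->
  (linear_map (cell_map_linear f) u : cell W n) \in mdeg (cell W n) k.
Proof.
rewrite !inE /= => /andP[u1 u2]; apply/andP; split.
  by case: eqP u1 => //= _ /eqP->; rewrite linear0.
by case: eqP u2 => //= _ /eqP->; rewrite linear0.
Qed.

Definition cell_map (V W : lmodType R) n (f : {linear V -> W}) :
  gradedHom (cell V n) (cell W n) := GradedHom (@cell_map_deg V W n f).

Section DualHom.
Variables (M N : gradedModule A) (f : {linear res M -> res N}).
Hypothesis fx : forall m, f (x_ m) = x_ (f m).
Hypothesis f_deg : forall n m, m \in mdeg M n -> f m \in mdeg N n.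

Definition dual_hom : gradedHom M N :=
  @GradedHom A M N (linear_map (dual_linear fx)) f_deg.
End DualHom.

Lemma dbl_scaleE (V : lmodType R) a (u : dbl V) :
  a *: u = (co0 D a *: u.1, co0 D a *: u.2 + co1 D a *: u.1).
Proof. by []. Qed.

Lemma from_dbl_linear (M : lmodType A) (V : lmodType R) (phi : {linear V -> res M}) :
  linear (fun u : dbl V => phi u.1 + x_ (phi u.2) : M).
Proof.
move=> a u v; rewrite dbl_scaleE [X in _ = X + _](scale_dual D).
rewrite !(linearD, linearZ_LR) xactK addr0 scalerDr addrACA.
by congr (_ + _); rewrite addrA.
Qed.

Lemma to_dbl_linear (M : lmodType A) (V : lmodType R) (psi : {linear res M -> V}) :
  linear (fun m : M => (psi (x_ m), psi m) : dbl V).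
Proof.
move=> a u v; rewrite dbl_scaleE [a *: u](scale_dual D).
rewrite !(linearD, linearZ_LR) xactK (linear0 psi) scaler0 addr0.
by [].
Qed.

Lemma dbl_fst_linear (V : lmodType R) : linear (fun u : res (dbl V) => u.1 : V).
Proof. by move=> a u v; rewrite dbl_cst. Qed.

Lemma dbl_snd_linear (V : lmodType R) : linear (fun u : res (dbl V) => u.2 : V).
Proof. by move=> a u v; rewrite dbl_cst. Qed.

Definition dbl_fst V : {linear res (dbl V) -> V} := linear_map (@dbl_fst_linear V).
Definition dbl_snd V : {linear res (dbl V) -> V} := linear_map (@dbl_snd_linear V).

(** Linear maps out of the induced module, and into the coinduced one, are
    R-linear maps on the generating, respectively cogenerating, copy of V. *)
Definition from_dbl (M : lmodType A) (V : lmodType R) (phi : {linear V -> res M}) :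
  {linear dbl V -> M} := linear_map (from_dbl_linear phi).

Definition to_dbl (M : lmodType A) (V : lmodType R) (psi : {linear res M -> V}) :
  {linear M -> dbl V} := linear_map (to_dbl_linear psi).

Lemma from_cone_deg M N i (phi : {linear res M -> res N}) :
  (forall k m, m \in mdeg M (k + i) -> phi m \in mdeg N k) ->
  forall k (u : cone M i), u \in mdeg (cone M i) k -> from_dbl phi u \in mdeg N k.
Proof.
move=> phi_deg k u /andP[u1 u2]; apply: mdegD; first exact: phi_deg.
by apply: xact_deg; apply: phi_deg.
Qed.

Lemma to_cone_deg M N i (psi : {linear res N -> res M}) :
  (forall k m, m \in mdeg N k -> psi m \in mdeg M (k + 1 + i)) ->
  forall k (m : N), m \in mdeg N k -> (to_dbl psi m : cone M i) \in mdeg (cone M i) k.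
Proof.
move=> psi_deg k m mk; apply/andP; split; last exact: psi_deg.
have /psi_deg := xact_deg1 D mk.
by have -> : k - 1 + 1 + i = k + i by lia.
Qed.

(** * Contractions *)

(** An R-linear contraction of M, regarded as a complex. *)
Definition contractible M := exists s : {linear res M -> res M},
  (forall n m, m \in mdeg M n -> s m \in mdeg M (n + 1)) /\
  forall m, x_ (s m) + s (x_ m) = m.

(** A graded projective P is a quotient, hence a summand, of the cone of its
    identity. The contraction (a, b) |-> (b, 0) of the cone induces one on P. *)
Lemma gr_projective_contractible P : gr_projective P -> contractible P.
Proof.
move=> Pp.
have deg0 k m : m \in mdeg P (k + 0) -> (idfun : {linear res P -> res P}) m \in mdeg P k.
  by rewrite addr0.
pose p : gradedHom (cone P 0) P := GradedHom (from_cone_deg deg0).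
have pE : epi p by move=> y; exists (y, 0); rewrite /= scaler0 addr0.
have [s sP] := Pp _ _ p (@GradedHom A P P idfun (fun _ _ h => h)) pE.
have s2l : linear (fun m : res P => (s m : dbl (res P)).2 : res P).
  by move=> a u v; rewrite (res_linear (D := D) s) dbl_cst.
exists (linear_map s2l); split.
  by move=> n m /(ghom_deg s)/andP[_]; rewrite addr0.
move=> m; rewrite [X in _ + X]/= -/(x_ m) (hom_x (D := D) s) dbl_x addrC.
exact: (sP m).
Qed.

(** Dually, I embeds into a cone by m |-> (x m, m) and is therefore a summand. *)
Lemma gr_injective_contractible I : gr_injective I -> contractible I.
Proof.
move=> Ii.
have deg0 k m : m \in mdeg I k -> (idfun : {linear res I -> res I}) m \in mdeg I (k + 1 - 1).
  by rewrite addrK.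
pose j : gradedHom I (cone I (-1)) := GradedHom (to_cone_deg deg0).
have jI : injective j by move=> u v [_].
have [r rP] := Ii _ _ j (@GradedHom A I I idfun (fun _ _ h => h)) jI.
have sl : linear (fun m : res I => r (m, 0) : res I).
  move=> a u v; rewrite -(res_linear (D := D) r) dbl_cst /=; congr (r (_, _)).
  by rewrite scaler0 addr0.
exists (linear_map sl); split.
  by move=> n m mn; apply: (ghom_deg r); apply/andP; rewrite mdeg0 addrK.
move=> m; rewrite /= -/(x_ _) -(hom_x (D := D) r) dbl_x -linearD -[RHS]rP /=.
by congr (r (_, _)); rewrite /= ?add0r ?addr0.
Qed.

End GradedConstructions.

(** * Complete resolutions by cones *)

Section CompleteResolution.
Variables (R : pzRingType) (A : gradedRing) (D : dual_over R A) (M : gradedModule A).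
Local Notation res := (res D).
Local Notation dbl := (dbl D).
Local Notation x_ := (xact D _).

(** Consecutive maps of the resolution below must carry opposite signs for their
    composite to vanish. *)
Definition alt_sign (n : int) (V : zmodType) (v : V) : V :=
  if odd (absz n) then v else - v.

Lemma alt_signS n (V : zmodType) (v : V) : alt_sign (n + 1) v = - alt_sign n v.
Proof.
rewrite /alt_sign; have -> : odd (absz (n + 1)) = ~~ odd (absz n) by lia.
by case: (odd _); rewrite ?opprK.
Qed.

Lemma alt_sign_linear n : linear (fun m : res M => alt_sign n m).
Proof.
by move=> a u v; rewrite /alt_sign; case: ifP => // _; rewrite opprD scalerN.
Qed.

Lemma alt_sign_deg n k (m : M) : m \in mdeg M k -> alt_sign n m \in mdeg M k.
Proof. by rewrite /alt_sign; case: ifP => // _; apply: mdegN. Qed.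

Definition alt_signl n : {linear res M -> res M} := linear_map (alt_sign_linear n).

Lemma cres_psi_linear n :
  linear (fun u : res (dbl (res M)) =>
    dbl_fst D (res M) u + alt_signl n (x_ (dbl_snd D (res M) u)) : res M).
Proof. by move=> a u v; rewrite !linearP scalerDr addrACA. Qed.

Definition cres_psi n : {linear res (dbl (res M)) -> res M} :=
  linear_map (cres_psi_linear n).

Definition cres n : gradedModule A := cone D M (- n - 1).

Lemma cres_psi_deg n k (u : cres n) : u \in mdeg (cres n) k ->
  cres_psi n u \in mdeg M (k + 1 + (- (n + 1) - 1)).
Proof.
have -> : k + 1 + (- (n + 1) - 1) = k + (- n - 1) by lia.
move=> /andP[u1 u2]; apply: mdegD => //; apply: alt_sign_deg; apply: xact_deg.
by have <- : k + 1 + (- n - 1) = k + (- n - 1) + 1 by lia.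
Qed.

(** Up to the sign, (a, b) is sent to (x a, a + x b): this is the composite of the
    projection (a, b) |-> a + x b onto M and the inclusion m |-> (x m, m) of M. *)
Definition cres_diff n : gradedHom (cres n) (cres (n + 1)) :=
  @GradedHom A (cres n) (cres (n + 1))
    (to_dbl (cres_psi n)) (to_cone_deg (cres_psi_deg (n := n))).

Lemma cres_diffE n (u : dbl (res M)) :
  cres_diff n u = (alt_sign n (x_ u.1), u.1 + alt_sign n (x_ u.2)).
Proof.
rewrite -[LHS]/(cres_psi n (xact D (dbl (res M)) u), cres_psi n u) dbl_x.
by congr (_, _); apply: add0r.
Qed.

Lemma cres_diffK n (u : dbl (res M)) : cres_diff (n + 1) (cres_diff n u) = 0.
Proof.
have sx m : x_ (alt_signl n (x_ m)) = 0.
  rewrite -[alt_signl n _]/(alt_sign n _) /alt_sign.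
  by case: ifP => _; rewrite ?(linearN (xact D M)) xactK ?oppr0.
transitivity (- alt_signl n (x_ (alt_signl n (x_ u.1))),
    alt_signl n (x_ u.1) - alt_signl n (x_ (u.1 + alt_signl n (x_ u.2)))).
  by rewrite !cres_diffE !alt_signS.
by rewrite (linearD (xact D M)) !sx addr0 subrr linear0 oppr0.
Qed.

Lemma cres_rho_linear : linear (fun u : res (dbl (res M)) => (u.2, 0) : res (dbl (res M))).
Proof.
move=> a u v; rewrite !dbl_cst; congr (_, _).
by rewrite /= scaler0 addr0.
Qed.

Definition cres_rho : {linear res (dbl (res M)) -> res (dbl (res M))} :=
  linear_map cres_rho_linear.

Lemma cres_rho_deg n k (u : cres (n + 1)) :
  u \in mdeg (cres (n + 1)) k -> (cres_rho u : cres n) \in mdeg (cres n) k.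
Proof.
move=> /andP[_ u2]; apply/andP; split; last exact: mdeg0.
by have -> : k + (- n - 1) = k + 1 + (- (n + 1) - 1) by lia.
Qed.

(** The map rho contracts the sequence of cones, but only R-linearly. *)
Lemma cres_rhoE n (u : dbl (res M)) :
  cres_rho (cres_diff (n + 1) u) + cres_diff n (cres_rho u) = u.
Proof.
transitivity (u.1 - alt_signl n (x_ u.2) + alt_signl n (x_ u.2),
    0 + (u.2 + alt_signl n (x_ 0))).
  by rewrite !cres_diffE !alt_signS.
by rewrite subrK !linear0 addr0 add0r -surjective_pairing.
Qed.

Lemma cres_exact : gr_exact cres_diff.
Proof.
move=> n y; split=> [y0|[u <-]]; last exact: cres_diffK.
by exists (cres_rho y); rewrite -[RHS](cres_rhoE n) y0 linear0 add0r.
Qed.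

Lemma cres_inc_deg k (m : M) :
  m \in mdeg M k -> (idfun : {linear res M -> res M}) m \in mdeg M (k + 1 + (- 0 - 1)).
Proof. by have -> : k + 1 + (- 0 - 1) = k by lia. Qed.

Lemma cres_kernel : exists i : gradedHom M (cres 0), is_kernel i (cres_diff 0).
Proof.
pose i : gradedHom M (cres 0) := GradedHom (to_cone_deg cres_inc_deg).
exists i; split=> [u v [_ //]|u]; split.
  rewrite cres_diffE => -[_ /eqP]; rewrite subr_eq0 => /eqP u1; exists u.2.
  by rewrite [RHS]surjective_pairing u1.
move=> [m <-]; rewrite -[i m]/(x_ (m : res M), m) cres_diffE; congr (_, _).
  by rewrite /alt_sign [LHS]/= xactK oppr0.
exact: subrr.
Qed.

(** Averaging an R-linear map f against a contraction of its source makes it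
    A-linear: x kills the first summand of x f s + f s x on the left and the second
    on the right. If f is A-linear already, it is unchanged, as x s + s x = 1. *)
Lemma average_source (P N : gradedModule A) (s : {linear res P -> res P})
    (f : {linear res P -> res N}) :
  (forall n m, m \in mdeg P n -> s m \in mdeg P (n + 1)) ->
  (forall n m, m \in mdeg P n -> f m \in mdeg N n) ->
  exists h : gradedHom P N, forall m, h m = x_ (f (s m)) + f (s (x_ m)).
Proof.
move=> s_deg f_deg.
have hl : linear (fun m : res P => x_ (f (s m)) + f (s (x_ m))).
  by move=> a u v; rewrite !linearP scalerDr addrACA.
have hx m : linear_map hl (x_ m) = x_ (linear_map hl m).
  transitivity (x_ (f (s (x_ m))) + f (s (x_ (x_ m)))); first by [].
  transitivity (x_ (x_ (f (s m)) + f (s (x_ m)))); last by [].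
  by rewrite (linearD (xact D N)) !xactK !linear0 addr0 add0r.
have hd n m : m \in mdeg P n -> linear_map hl m \in mdeg N n.
  move=> mn; apply: mdegD; first by apply: xact_deg; apply/f_deg/s_deg.
  by apply: f_deg; rewrite -(subrK 1 n); apply/s_deg/xact_deg1.
by exists (dual_hom hx hd).
Qed.

(** Here the contraction is one of the target. *)
Lemma average_target (P N : gradedModule A) (s : {linear res P -> res P})
    (f : {linear res N -> res P}) :
  (forall n m, m \in mdeg P n -> s m \in mdeg P (n + 1)) ->
  (forall n m, m \in mdeg N n -> f m \in mdeg P n) ->
  exists h : gradedHom N P, forall m, h m = x_ (s (f m)) + s (f (x_ m)).
Proof.
move=> s_deg f_deg.
have hl : linear (fun m : res N => x_ (s (f m)) + s (f (x_ m))).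
  by move=> a u v; rewrite !linearP scalerDr addrACA.
have hx m : linear_map hl (x_ m) = x_ (linear_map hl m).
  transitivity (x_ (s (f (x_ m))) + s (f (x_ (x_ m)))); first by [].
  transitivity (x_ (x_ (s (f m)) + s (f (x_ m)))); last by [].
  by rewrite (linearD (xact D P)) !xactK !linear0 addr0 add0r.
have hd n m : m \in mdeg N n -> linear_map hl m \in mdeg P n.
  move=> mn; apply: mdegD; first by apply: xact_deg; apply/s_deg/f_deg.
  by rewrite -(subrK 1 n); apply/s_deg/f_deg/xact_deg1.
by exists (dual_hom hx hd).
Qed.

(** A map g that vanishes on the image of the differential d satisfies g rho d = g;
    averaging g rho keeps this and makes it A-linear. *)
Lemma cres_hom_to P : contractible D P -> forall n (g : gradedHom (cres (n + 1)) P),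
  (forall u, g (cres_diff n u) = 0) <->
  exists h : gradedHom (cres (n + 1 + 1)) P, forall u, h (cres_diff (n + 1) u) = g u.
Proof.
move=> [s [s_deg sx]] n g; split=> [g0|[h hg] u]; last by rewrite -hg cres_diffK linear0.
pose f : {linear res (cres (n + 1 + 1)) -> res P} := resl D g \o cres_rho.
have f_deg k m : m \in mdeg (cres (n + 1 + 1)) k -> f m \in mdeg P k.
  by move=> /cres_rho_deg/(ghom_deg g).
have [h hP] := average_target s_deg f_deg; exists h => u.
have fd v : f (cres_diff (n + 1) v) = g v.
  have /(congr1 g) := cres_rhoE n v; rewrite linearD g0 addr0; exact.
rewrite hP fd -(hom_x (D := D) (cres_diff (n + 1))) fd (hom_x (D := D) g).
exact: sx.
Qed.

(** Here d rho g = g for g with values in the kernel of d, and rho g is averaged. *)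
Lemma cres_hom_from P : contractible D P -> forall n (g : gradedHom P (cres (n + 1))),
  (forall u, cres_diff (n + 1) (g u) = 0) <->
  exists h : gradedHom P (cres n), forall u, cres_diff n (h u) = g u.
Proof.
move=> [s [s_deg sx]] n g; split=> [g0|[h hg] u]; last by rewrite -hg cres_diffK.
pose f : {linear res P -> res (cres n)} := cres_rho \o resl D g.
have f_deg k m : m \in mdeg P k -> f m \in mdeg (cres n) k.
  by move=> /(ghom_deg g)/cres_rho_deg.
have [h hP] := average_source s_deg f_deg; exists h => u.
have df v : cres_diff n (f v) = g v.
  by rewrite -[RHS](cres_rhoE n) g0 (linear0 cres_rho) add0r.
rewrite hP linearD (hom_x (D := D) (cres_diff n)) !df -(hom_x (D := D) g) -linearD.
by rewrite sx.
Qed.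

End CompleteResolution.

(** * Gorenstein modules over the dual numbers *)

Section Homogeneous.
Variable R : pzRingType.
Local Notation A := (dn_gring R).
Local Notation D := (dn_dual R).
Local Notation res := (res D).
Local Notation dbl := (dbl D).
Implicit Types M N P : gradedModule A.

Lemma homogv_linear M n : linear (fun u : homog M n => homog_val u : res M).
Proof. by []. Qed.

Definition homogv M n : {linear homog M n -> res M} := linear_map (@homogv_linear M n).

Lemma homogv_deg M n (u : homog M n) : homogv M n u \in mdeg M n.
Proof. exact: homog_valP u. Qed.

Lemma homogv_onto M n v : v \in mdeg M n -> exists u, homogv M n u = v.
Proof. by move=> vn; exists (Homog (vn : v \in homog_pred n)). Qed.

Definition hcomp_fun M n (v : res M) : homog M n :=
  Homog (gcomp_deg n v : gcomp n v \in homog_pred n).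

Lemma hcomp_linear M n : linear (@hcomp_fun M n).
Proof.
move=> a u v; apply: val_inj; rewrite /= gcompD; congr (_ + _).
by have := gcompZ n u (cst_deg D a); rewrite add0r.
Qed.

Definition hcomp M n : {linear res M -> homog M n} := linear_map (@hcomp_linear M n).

Lemma hcompK M n (u : homog M n) : hcomp M n (homogv M n u) = u.
Proof. by apply: val_inj; apply: gcomp_id; apply: homogv_deg. Qed.

Lemma hcomp_neq M m n (u : homog M n) : m != n -> hcomp M m (homogv M n u) = 0.
Proof.
by move=> mn; apply: val_inj; rewrite /= (gcomp_homog (homogv_deg u)) (negPf mn).
Qed.

Lemma graded_rec M (V : lmodType R) (h : forall k, {linear homog M k -> V}) :
  exists H : {linear res M -> V}, forall k u, H (homogv M k u) = h k u.
Proof.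
have hf (v : res M) : finsupp (fun k => h k (hcomp M k v)).
  have [s sP] := gcomp_supp v; exists s => k /sP v0.
  by rewrite (_ : hcomp M k v = 0) ?linear0 //; apply: val_inj.
have Hl : linear (fun v : res M => fsum (fun k => h k (hcomp M k v))).
  move=> a u v; rewrite -(fsum_morph ( *:%R a) (hf u)).
  rewrite -fsumD //; last exact: (finsupp_morph ( *:%R a)).
  by congr fsum; apply: functional_extensionality_dep => k; rewrite !linearP.
exists (linear_map Hl) => k u; apply: etrans (fsum_single (k := k) _) _.
  by move=> j jk; rewrite hcomp_neq ?linear0.
by rewrite hcompK.
Qed.

Lemma graded_ext M (V : lmodType R) (f g : {linear res M -> V}) :
  (forall k u, f (homogv M k u) = g (homogv M k u)) -> forall v, f v = g v.
Proof.
move=> fg; apply: gcomp_ind => [|v w fv fw|n v /homogv_onto[u <-] //].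
  by rewrite !linear0.
by rewrite (linearD f) (linearD g) fv fw.
Qed.

Lemma gr_epi_homog M N (g : gradedHom M N) n : epi g -> epi (@Phi_map_fun R M N g n).
Proof.
move=> gE y; have [x xP] := gE (homogv N n y).
exists (hcomp M n x); apply: val_inj; rewrite /= -gcomp_hom xP.
by apply: gcomp_id; apply: homogv_deg.
Qed.

(** The cone is an induced module: a graded map out of it is a degree-preserving
    R-linear map out of M, which can be lifted one component at a time. *)
Lemma cone_gr_projective M i :
  (forall n, projective (homog M n)) -> gr_projective (cone D M i).
Proof.
move=> Mp N' N g f gE.
have f_deg j (u : homog M j) : f (homogv M j u, 0) \in homog_pred (M := N) (j - i).
  by apply: (ghom_deg f); apply/andP; rewrite /= subrK mdeg0 homogv_deg.
have fl j : linear (fun u => Homog (f_deg j u)).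
  move=> a u v; apply: val_inj; rewrite -[RHS]/(a *: (f (homogv M j u, 0) : res N) +
    (f (homogv M j v, 0) : res N)) -(res_linear (D := D) f) dbl_cst /=.
  by congr (f (_, _)); rewrite /= scaler0 addr0.
have /dep_choice[h hP] : forall j, exists h : {linear homog M j -> homog N' (j - i)},
    forall u, Phi_map_fun g (h u) = linear_map (fl j) u.
  by move=> j; apply: (Mp j _ _ (Phi_map g (j - i))); apply: gr_epi_homog.
have [H HP] := graded_rec (fun j => homogv N' (j - i) \o h j).
have H_deg k m : m \in mdeg M (k + i) -> H m \in mdeg N' k.
  move=> /homogv_onto[u <-].
  have -> : H (homogv M (k + i) u) = homogv _ _ (h (k + i) u) by rewrite HP.
  by move: (homogv _ _ _) (homogv_deg (h (k + i) u)) => w; rewrite addrK.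
exists (GradedHom (from_cone_deg H_deg)).
have gH m : g (H m) = f (m, 0).
  have fl0 : linear (fun m : res M => f (m, 0) : res N).
    move=> a u v; rewrite -(res_linear (D := D) f) dbl_cst /=.
    by congr (f (_, _)); rewrite /= scaler0 addr0.
  move: m; apply: (@graded_ext _ _ (resl D g \o H) (linear_map fl0)) => k u.
  rewrite [LHS]/= HP; have := congr1 val (hP k u); exact.
move=> u; rewrite [LHS]linearD gH (hom_x (D := D) g) gH.
rewrite -(hom_x (D := D) f) dbl_x -linearD [in RHS](surjective_pairing u).
by congr (f (_, _)); rewrite /= ?addr0 ?add0r.
Qed.

(** The cone is also a coinduced module: a graded map into it is a
    degree-preserving R-linear map into M, up to a shift. *)
Lemma cone_gr_injective M i :
  (forall n, injective_mod (homog M n)) -> gr_injective (cone D M i).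
Proof.
move=> Mi N N' g f gI.
have f_deg k (u : homog N k) :
    (f (homogv N k u) : dbl _).2 \in homog_pred (M := M) (k + 1 + i).
  by have /andP[] := ghom_deg f (homogv_deg u).
have fl k : linear (fun u => Homog (f_deg k u)).
  by move=> a u v; apply: val_inj; rewrite /= (res_linear (D := D) f) dbl_cst.
have gI' k : injective (Phi_map g k).
  by move=> u v /(congr1 val)/gI; apply: val_inj.
have /dep_choice[h hP] : forall k, exists h : {linear homog N' k -> homog M (k + 1 + i)},
    forall u, h (Phi_map g k u) = linear_map (fl k) u.
  by move=> k; apply: (Mi (k + 1 + i) _ _ (Phi_map g k)).
have [H HP] := graded_rec (fun k => homogv M (k + 1 + i) \o h k).
have H_deg k m : m \in mdeg N' k -> H m \in mdeg M (k + 1 + i).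
  by move=> /homogv_onto[u <-]; rewrite HP; apply: homogv_deg.
exists (GradedHom (to_cone_deg H_deg)).
have Hg m : H (g m) = (f m : dbl _).2.
  have fl0 : linear (fun m : res N => (f m : dbl _).2 : res M).
    by move=> a u v; rewrite (res_linear (D := D) f) dbl_cst.
  move: m; apply: (@graded_ext _ _ (H \o resl D g) (linear_map fl0)) => k u.
  have gu : g (homogv N k u) = homogv N' k (Phi_map g k u) by [].
  by rewrite [LHS]/= gu HP [LHS]/= hP.
move=> m; rewrite -[LHS]/(H (xact D N' (g m)), H (g m)) -(hom_x (D := D) g) !Hg.
by rewrite (hom_x (D := D) f) dbl_x -surjective_pairing.
Qed.

Lemma res_locally_sum M : locally_sum (homogv M) (hcomp M).
Proof.
move=> v; have [[[s sP] vP] vE] := gcompP v; exists s => t ut st.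
rewrite -[LHS]vE; apply: fsumE => // k kt; apply: sP.
by apply: contra kt => /st.
Qed.

Lemma res_flat M : (forall n, flat (homog M n)) -> flat (res M).
Proof. exact: locally_sum_flat (@res_locally_sum M). Qed.

Lemma Gorenstein_projective_of_terms M :
  (forall n, projective (homog M n)) -> Gorenstein_projective M.
Proof.
move=> Mp; exists (cres D M), (cres_diff D M); split.
- by move=> n; apply: cone_gr_projective.
- exact: cres_exact.
- by move=> P /(gr_projective_contractible D) Pc n g; apply: cres_hom_to.
- exact: cres_kernel.
Qed.

Lemma Gorenstein_injective_of_terms M :
  (forall n, injective_mod (homog M n)) -> Gorenstein_injective M.
Proof.
move=> Mi; exists (cres D M), (cres_diff D M); split.
- by move=> n; apply: cone_gr_injective.
- exact: cres_exact.
- by move=> P /(gr_injective_contractible D) Pc n g; apply: cres_hom_from.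
- exact: cres_kernel.
Qed.

End Homogeneous.

Section GorensteinFlat.
Variable R : pzRingType.
Local Notation A := (dn_gring R).
Local Notation D := (dn_dual R).
Local Notation D' := (opp_dual R).
Implicit Types (M N P : gradedModule A) (U V I : gradedModule (opp_gring A)).

(** Moving scalars of R and the element x across the tensor sign over A. *)
Lemma pure_cst (U : lmodType A^c) (N : lmodType A) (r : R) (u : U) (n : N) :
  pure ((r : R^c) *: (u : res D' U) : U) n = pure u (r *: (n : res D N) : N).
Proof. exact: pure_bal. Qed.

Lemma pure_x (U : lmodType A^c) (N : lmodType A) (u : U) (n : N) :
  pure (xact D' U u : U) n = pure u (xact D N n : N).
Proof. exact: pure_bal. Qed.

(** As M * M is the induced module of M, tensoring U with it over A amounts to
    tensoring U with M over R. *)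
Section ToR.
Variables (U : lmodType A^c) (M : lmodType R).

Let b (u : U) (v : dbl D M) : tensor (res D' U) M :=
  pure (u : res D' U) v.1 + pure (xact D' U u) v.2.

Fact toR_Dl u u' v : b (u + u') v = b u v + b u' v.
Proof. by rewrite /b (linearD (xact D' U)) !pureDl addrACA. Qed.

Fact toR_Dr u v v' : b u (v + v') = b u v + b u v'.
Proof. by rewrite /b !pureDr addrACA. Qed.

Fact toR_bal (a : A) u v : b ((a : A^c) *: u) v = b u (a *: v).
Proof.
rewrite /b dbl_scaleE (scale_dual D') !pureDr.
rewrite [X in pure X v.2](_ : _ = (co0 D a : R^c) *: xact D' U u); last first.
  by rewrite (linearD (xact D' U)) !(linearZ_LR (xact D' U)) xactK scaler0 addr0.
rewrite [X in X + _](pureDl (M := res D' U)).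
by rewrite !(pure_bal (M := res D' U)) addrAC addrA.
Qed.

Definition toR : {additive tensor U (dbl D M) -> tensor (res D' U) M} :=
  tens_lift toR_Dl toR_Dr toR_bal.

Lemma toR_pure u v : toR (pure u v) = b u v.
Proof. exact: tens_lift_pure. Qed.

Let c (u : res D' U) (m : M) : tensor U (dbl D M) := pure (u : U) ((m, 0) : dbl D M).

Fact ofR_Dl u u' m : c (u + u') m = c u m + c u' m.
Proof. exact: pureDl. Qed.

Fact ofR_Dr u m m' : c u (m + m') = c u m + c u m'.
Proof. by rewrite /c -pureDr; congr pure; congr (_, _); rewrite /= addr0. Qed.

Fact ofR_bal (r : R) u m : c ((r : R^c) *: u) m = c u (r *: m).
Proof.
by rewrite /c pure_cst dbl_cst; congr pure; congr (_, _); rewrite /= scaler0.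
Qed.

Definition ofR : {additive tensor (res D' U) M -> tensor U (dbl D M)} :=
  tens_lift ofR_Dl ofR_Dr ofR_bal.

Lemma toRK w : ofR (toR w) = w.
Proof.
elim/tensor_ind: w => [|u v w IHw]; first by rewrite !raddf0.
rewrite !raddfD IHw toR_pure /b raddfD; congr (_ + _).
have ofR_pure (u' : res D' U) m : ofR (pure u' m) = c u' m by apply: tens_lift_pure.
rewrite !ofR_pure /c pure_x dbl_x -pureDr; congr pure.
by rewrite [RHS]surjective_pairing; congr (_, _); rewrite /= ?addr0 ?add0r.
Qed.
End ToR.

Lemma cone_gr_flat M i : flat (res D M) -> gr_flat (cone D M i).
Proof.
move=> /flat_ker Mf U V f fI; apply: raddf_inj => w fw.
rewrite -(@toRK U (res D M) w); suff -> : toR U (res D M) w = 0 by rewrite raddf0.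
have fI' : injective (resl D' f) by [].
have toRf v : tens_map (resl D' f) idfun (toR U (res D M) v) =
              toR V (res D M) (tens_map f idfun v).
  elim/tensor_ind: v => [|u v t IHt]; first by rewrite !raddf0.
  rewrite (raddfD (toR U _)) (raddfD (tens_map (resl D' f) _)).
  rewrite (raddfD (tens_map f _)) (raddfD (toR V _)); congr (_ + _); last exact: IHt.
  rewrite [X in toR V _ X]tens_map_pure !toR_pure raddfD /= !tens_map_pure.
  by rewrite -(hom_x (D := D') f).
by apply: (Mf _ _ _ fI'); rewrite toRf [X in toR V _ X]fw raddf0.
Qed.

(** The tensor version of averaging: although f is only R-linear, the map
    u (x) n |-> s (u x) (x) f n + s u (x) f (x n) is balanced over A. *)
Section TensorAverage.
Variables (U : lmodType A^c) (N : lmodType A).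
Variables (s : {linear res D' U -> res D' U}) (f : {linear res D N -> res D N}).

Let b (u : U) (n : N) : tensor U N :=
  pure (s (xact D' U u) : U) (f n : N) + pure (s u : U) (f (xact D N n) : N).

Fact tens_average_Dl u u' n : b (u + u') n = b u n + b u' n.
Proof.
by rewrite /b (linearD (xact D' U)) !(linearD s) !(pureDl (M := U)) addrACA.
Qed.

Fact tens_average_Dr u n n' : b u (n + n') = b u n + b u n'.
Proof.
by rewrite /b (linearD (xact D N)) !(linearD f) !(pureDr (N := N)) addrACA.
Qed.

Fact tens_average_bal (a : A) u n : b ((a : A^c) *: u) n = b u (a *: n).
Proof.
rewrite /b (scale_dual D') [a *: n](scale_dual D).
rewrite (linearD (xact D' U)) (linearD (xact D N)) !(linearZ_LR (xact D' U))
  !(linearZ_LR (xact D N)) !xactK !scaler0 !addr0.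
rewrite !(linearD s) !(linearD f) !(linearZ_LR s) !(linearZ_LR f).
rewrite (pureDl (M := U)) (pureDr (N := N)) !pure_cst.
by rewrite addrA addrAC.
Qed.

Definition tens_average : {additive tensor U N -> tensor U N} :=
  tens_lift tens_average_Dl tens_average_Dr tens_average_bal.

Lemma tens_average_pure u n : tens_average (pure u n) =
  pure (s (xact D' U u) : U) (f n : N) + pure (s u : U) (f (xact D N n) : N).
Proof. exact: tens_lift_pure. Qed.
End TensorAverage.

(** Averaging rho gives an additive contraction of I (x) T, where T is the
    resolution by cones. *)
Lemma cres_tens_exact M I : contractible D' I -> forall n,
  exact (tens_map (idfun : {linear I -> I}) (cres_diff D M n))
        (tens_map (idfun : {linear I -> I}) (cres_diff D M (n + 1))).
Proof.
move=> [s [_ sx]] n y; split=> [y0|[w <-]]; last first.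
  rewrite tens_map_comp; elim/tensor_ind: w => [|u v w IHw]; first by rewrite raddf0.
  rewrite raddfD /= IHw addr0 tens_map_pure /=.
  by rewrite -[RHS](pure0r (dbl D (res D M)) u); congr pure; apply: cres_diffK.
pose N : lmodType A := dbl D (res D M).
pose t := tens_average s (cres_rho D M : {linear res D N -> res D N}).
suff homotopy w : t (tens_map (idfun : {linear I -> I}) (cres_diff D M (n + 1)) w) +
    tens_map (idfun : {linear I -> I}) (cres_diff D M n) (t w) = w.
  by exists (t y); rewrite -[RHS]homotopy y0 raddf0 add0r.
elim/tensor_ind: w => [|u v w IHw]; first by rewrite !raddf0 addr0.
rewrite (raddfD (tens_map _ (cres_diff D M (n + 1)))) !(raddfD t).
rewrite (raddfD (tens_map _ (cres_diff D M n))) addrACA; congr (_ + _); last exact: IHw.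
rewrite [X in t X + _]tens_map_pure !tens_average_pure.
rewrite (raddfD (tens_map _ (cres_diff D M n))) addrACA.
rewrite [X in _ + X + _]tens_map_pure [X in _ + (_ + X)]tens_map_pure.
rewrite -!(pureDr (N := N)) -(hom_x (D := D) (cres_diff D M (n + 1))) !cres_rhoE.
rewrite -pure_x -(pureDl (M := I)); congr pure.
by rewrite addrC; apply: sx.
Qed.

Lemma Gorenstein_flat_of_terms M :
  (forall n, flat (homog M n)) -> Gorenstein_flat M.
Proof.
move=> Mf; exists (cres D M), (cres_diff D M); split.
- by move=> n; apply: cone_gr_flat; apply: res_flat.
- exact: cres_exact.
- by move=> I /(gr_injective_contractible D') Ic n; apply: cres_tens_exact.
- exact: cres_kernel.
Qed.

End GorensteinFlat.

(** * From complexes to graded modules *)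

Section GradedDimension.
Variables (A : gradedRing) (K : gradedModule A -> Prop).
Implicit Types M N C : gradedModule A.

Definition gr_short_exact M N C (i : gradedHom M N) (p : gradedHom N C) :=
  [/\ injective i, exact i p & epi p].

Definition gr_comp M N C (g : gradedHom N C) (f : gradedHom M N) : gradedHom M C :=
  @GradedHom A M C (g \o f) (fun n x xn => ghom_deg g (ghom_deg f xn)).

Definition gr_id M : gradedHom M M := @GradedHom A M M idfun (fun _ _ xn => xn).

Lemma zero_grading : is_grading (fun _ : int => predT : {pred 'rV[A]_0}).
Proof.
split=> // [v|s c _ _ _ n _]; last exact: trivial_zero.
by exists [::], (fun _ => 0); split=> //; rewrite big_nil; apply: trivial_zero.
Qed.

Definition gr_zero : gradedModule A := @GradedModule A 'rV[A]_0 _ zero_grading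
  (fun _ _ _ _ _ _ => isT).

Definition gr_zero_hom M N : gradedHom M N :=
  @GradedHom A M N (linear_map (@zero_linear _ M N)) (fun n _ _ => mdeg0 N n).

Lemma gr_left_dimS k M C N (i : gradedHom M C) (p : gradedHom C N) :
  gr_short_exact i p -> K C -> gr_left_dim_le K k M -> gr_left_dim_le K k.+1 N.
Proof.
move=> [iI ip pE] KC [E [d [e [[eE de dd] KE E0]]]].
pose E' j : gradedModule A := if j is j'.+1 then E j' else C.
pose d' j : gradedHom (E' j.+1) (E' j) :=
  match j with 0 => gr_comp i e | j'.+1 => d j' end.
exists E', d', p; split; [split=> // | by case | by case].
- move=> y; rewrite ip; split=> [[x <-]|[x <-]]; last by exists (e x).
  by have [z <-] := eE x; exists z.
- case=> [|j] y; last exact: dd.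
  apply: iff_trans (de y); rewrite /=.
  by split=> [/(inj0 iI)//|->]; rewrite linear0.
Qed.

Lemma gr_left_dim0 M : K M -> gr_left_dim_le K 0 M.
Proof.
move=> KM; pose C j : gradedModule A := if j is _.+1 then gr_zero else M.
exists C, (fun j => gr_zero_hom (C j.+1) (C j)), (gr_id M).
split; [split | by case | by case=> // j _; apply: trivial_zero].
- by move=> y; exists y.
- by move=> y; split=> [y0|[_ <-]//]; exists 0.
- by move=> j y; split=> // _; exists 0; rewrite [y]trivial_zero.
Qed.

Lemma gr_right_dimS k M C N (i : gradedHom M C) (p : gradedHom C N) :
  gr_short_exact i p -> K C -> gr_right_dim_le K k N -> gr_right_dim_le K k.+1 M.
Proof.
move=> [iI ip pE] KC [E [d [e [[eI ed dd] KE E0]]]].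
pose E' j : gradedModule A := if j is j'.+1 then E j' else C.
pose d' j : gradedHom (E' j) (E' j.+1) :=
  match j with 0 => gr_comp e p | j'.+1 => d j' end.
exists E', d', i; split; [split=> // | by case | by case].
- move=> y; apply: iff_trans (ip y); rewrite /=.
  by split=> [/(inj0 eI)//|->]; rewrite linear0.
- case=> [|j] y; last exact: dd.
  rewrite ed; split=> [[x <-]|[x <-]]; last by exists (p x).
  by have [z <-] := pE x; exists z.
Qed.

Lemma gr_right_dim0 M : K M -> gr_right_dim_le K 0 M.
Proof.
move=> KM; pose C j : gradedModule A := if j is _.+1 then gr_zero else M.
exists C, (fun j => gr_zero_hom (C j) (C j.+1)), (gr_id M).
split; [split=> // | by case | by case=> // j _; apply: trivial_zero].
- by move=> y; split=> // _; exists y.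
- by move=> j y; split=> // _; exists 0; rewrite [y]trivial_zero [LHS]trivial_zero.
Qed.
End GradedDimension.

Section PsiFunctor.
Variable R : pzRingType.
Implicit Types X Y Z : complex R.

Section PsiMap.
Variables (X Y : complex R) (f : chain_map X Y).

Fact Psi_map_supp (u : dsum X) :
  exists s : seq int, forall n, n \notin s -> f n (u n) = 0.
Proof. by case: (dsum_supp u) => s sP; exists s => n /sP->; rewrite linear0. Qed.

Definition Psi_map_fun (u : Psi X) : Psi Y := DSum (Psi_map_supp u).

Fact Psi_map_linear : linear Psi_map_fun.
Proof.
by move=> a u v; apply: dsumP => n /=; rewrite !linearD !linearZ_LR cmapE.
Qed.

Fact Psi_map_deg n (u : Psi X) : u \in mdeg (Psi X) n ->
  linear_map Psi_map_linear u \in mdeg (Psi Y) n.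
Proof.
by rewrite !inE => /asboolP un; apply/asboolP => m mn /=; rewrite un ?linear0.
Qed.

Definition Psi_map : gradedHom (Psi X) (Psi Y) := GradedHom Psi_map_deg.
End PsiMap.

(** Preimages are chosen to vanish where v does, so that they have finite support. *)
Lemma Psi_lift X Y (f : chain_map X Y) (v : dsum Y) :
  (forall n, exists x, f n x = v n) -> exists u, Psi_map f u = v.
Proof.
move=> fv; have /dep_choice[u uP] : forall n, exists x : X n,
    f n x = v n /\ (v n = 0 -> x = 0).
  move=> n; have [x xP] := fv n; have [v0|v0] := eqVneq (v n) 0.
    by exists 0; rewrite v0 linear0.
  by exists x; split=> // e; rewrite e eqxx in v0.
have us : exists s : seq int, forall n, n \notin s -> u n = 0.
  by have [s sP] := dsum_supp v; exists s => n /sP v0; case: (uP n) => _; apply.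
by exists (DSum us); apply: dsumP => n; case: (uP n).
Qed.

Lemma Psi_short_exact X Y Z (i : chain_map X Y) (p : chain_map Y Z) :
  (forall n, short_exact (i n) (p n)) -> gr_short_exact (Psi_map i) (Psi_map p).
Proof.
move=> ip; split.
- move=> u v uv; apply: dsumP => n; case: (ip n) => iI _ _; apply: iI.
  exact: (congr1 (fun w : dsum Y => w n) uv).
- move=> v; split=> [v0|[u <-]].
    apply: Psi_lift => n; case: (ip n) => _ ipn _; apply/ipn.
    exact: (congr1 (fun w : dsum Z => w n) v0).
  by apply: dsumP => n; case: (ip n) => _ h _; apply: (exact0 (u n : X n) h).
- by move=> v; apply: Psi_lift => n; case: (ip n).
Qed.

Lemma homog_Psi_iso X n :
  exists f : {linear homog (Psi X) n -> X n}, injective f /\ epi f.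
Proof.
have [f fb] := Phi_PsiK X; exists (f n); case: (fb n) => g gf fg.
by split=> [|y]; [apply: can_inj gf | exists (g y)].
Qed.

(** The disk covers supply the first k terms of the resolution, and the last
    syzygy has terms in K. *)
Lemma Psi_left_dim (K : lmodType R -> Prop) (G : gradedModule (dn_gring R) -> Prop) k :
  resolving K -> (forall X, (forall n, K (X n)) -> G (Psi X)) ->
  forall X, (forall n, left_dim_le K k (X n)) -> gr_left_dim_le G k (Psi X).
Proof.
move=> Kres KG; elim: k => [|k IHk] X Xk.
  by apply/gr_left_dim0/KG => n; apply/(left_dim0 Kres).
have [F [phi [Fp phiE]]] := disk_cover X.
have FK n : K (disk F n) by case: Kres => Kp _ _; apply: Kp.
have ip n : short_exact (kercv (from_disk phi) n) (from_disk phi n).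
  exact: short_exact_ker.
apply: gr_left_dimS (Psi_short_exact ip) (KG _ FK) _.
by apply: IHk => n; apply: (left_dim_syzygy Kres (ip n) (FK n) (Xk n)).
Qed.

Lemma Psi_right_dim (G : gradedModule (dn_gring R) -> Prop) k :
  (forall X, (forall n, injective_mod (X n)) -> G (Psi X)) ->
  forall X, (forall n, inj_dim_le k (X n)) -> gr_right_dim_le G k (Psi X).
Proof.
move=> IG; elim: k => [|k IHk] X Xk.
  by apply/gr_right_dim0/IG => n; apply/right_dim0/Xk.
have [F [X'' [i [q [Fi iq dX'']]]]] := disk_envelope Xk.
apply: gr_right_dimS (Psi_short_exact iq) (IG _ _) (IHk _ dX'') => n.
exact: injective_prod.
Qed.

Lemma Psi_Gorenstein_projective X :
  (forall n, projective (X n)) -> Gorenstein_projective (Psi X).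
Proof.
move=> Xp; apply: Gorenstein_projective_of_terms => n.
have [f [fI fE]] := homog_Psi_iso X n.
exact: (resolving_iso (resolving_projective R) fI fE).
Qed.

Lemma Psi_Gorenstein_injective X :
  (forall n, injective_mod (X n)) -> Gorenstein_injective (Psi X).
Proof.
move=> Xi; apply: Gorenstein_injective_of_terms => n.
by have [f [fI fE]] := homog_Psi_iso X n; apply: (injective_iso fI fE).
Qed.

Lemma Psi_Gorenstein_flat X :
  (forall n, flat (X n)) -> Gorenstein_flat (Psi X).
Proof.
move=> Xf; apply: Gorenstein_flat_of_terms => n.
have [f [fI fE]] := homog_Psi_iso X n.
exact: (resolving_iso (resolving_flat R) fI fE).
Qed.

End PsiFunctor.

(** * From graded modules to complexes *)

Section Terms.
Variable R : pzRingType.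
Local Notation A := (dn_gring R).
Local Notation D := (dn_dual R).
Local Notation D' := (opp_dual R).
Local Notation res := (res D).
Implicit Types M N P X : gradedModule A.

(** A linear map P_k -> N is a graded map from P to the coinduced module of N
    placed in the degrees k + 1 and k. *)
Lemma gr_projective_homog P k : gr_projective P -> projective (homog P k).
Proof.
move=> Pp M N g f gE.
pose phi : {linear res P -> N} := f \o hcomp P k.
have phi_deg j (p : P) : p \in mdeg P j -> j != k -> phi p = 0.
  move=> /homogv_onto[u <-] jk; rewrite -[LHS]/(f (hcomp P k (homogv P j u))).
  by rewrite hcomp_neq ?linear0 // eq_sym.
have f_deg j (p : P) : p \in mdeg P j ->
    (to_dbl phi p : cell D N k) \in mdeg (cell D N k) j.
  move=> pj; apply/andP; split; rewrite -implyNb; apply/implyP => jk; apply/eqP.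
    apply: (phi_deg (j - 1)); first exact: xact_deg1.
    by apply: contra jk => /eqP <-; rewrite subrK.
  exact: phi_deg pj jk.
have gE' : epi (cell_map D k g).
  move=> [y1 y2]; have [x1 <-] := gE y1; have [x2 <-] := gE y2.
  by exists (x1, x2).
have [h hP] := Pp _ _ (cell_map D k g) (GradedHom f_deg) gE'.
exists (dbl_snd D M \o (resl D h \o homogv P k)) => u.
transitivity (phi (homogv P k u)); last first.
  by rewrite -[LHS]/(f (hcomp P k (homogv P k u))) hcompK.
exact: (congr1 snd (hP (homogv P k u))).
Qed.

(** Dually, a linear map M -> I_k is a graded map from the induced module. *)
Lemma gr_injective_homog (I : gradedModule A) k :
  gr_injective I -> injective_mod (homog I k).
Proof.
move=> Ii M N g f gI.
pose phi : {linear M -> res I} := homogv I k \o f.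
have f_deg j (u : cell D M (k - 1)) :
    u \in mdeg (cell D M (k - 1)) j -> from_dbl phi u \in mdeg I j.
  rewrite /= inE subrK => /andP[u1 u2]; apply: mdegD.
    case: eqP u1 => [-> _|_ /eqP->]; first exact: homogv_deg.
    by rewrite linear0; apply: mdeg0.
  case: eqP u2 => [-> _|_ /eqP->]; first by exact: (xact_deg1 D (homogv_deg (f u.2))).
  by rewrite linear0 (linear0 (xact D I)); apply: mdeg0.
have gI' : injective (cell_map D (k - 1) g).
  by move=> [x1 x2] [y1 y2] [/gI-> /gI->].
have [h hP] := Ii _ _ (cell_map D (k - 1) g) (GradedHom f_deg) gI'.
have hl : linear (fun y : N => hcomp I k (h (y, 0))).
  move=> a u v; rewrite -linearP -(res_linear (D := D) h) dbl_cst.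
  by congr (hcomp _ _ (h (_, _))); rewrite /= scaler0 addr0.
exists (linear_map hl) => x; rewrite -[RHS]hcompK -[LHS]/(hcomp I k (h (g x, 0))).
congr (hcomp I k _).
have e1 : cell_map D (k - 1) g (x, 0) = (g x, 0) by congr (_, _); apply: linear0.
rewrite -e1 hP -[LHS]/(phi x + xact D I (phi 0)).
by rewrite (linear0 phi) linear0 addr0.
Qed.

(** The right A-module induced from U. *)
Definition dblr (U : lmodType R^c) : lmodType A^c :=
  (dbl D' U : lmodType (opp_gring A)).

(** U (x)_R P is a summand of U' (x)_A P for the module U' induced from U; the
    retraction is the second map below. *)
Section Induced.
Variables (U : lmodType R^c) (P : lmodType A).

Let b (u : U) (p : res P) : tensor (dblr U) P := pure ((u, 0) : dblr U) (p : P).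

Fact induce_Dl u u' p : b (u + u') p = b u p + b u' p.
Proof. by rewrite /b -pureDl; congr pure; congr (_, _); rewrite /= addr0. Qed.

Fact induce_Dr u p p' : b u (p + p') = b u p + b u p'.
Proof. exact: pureDr. Qed.

Fact induce_bal (r : R) u p : b ((r : R^c) *: u) p = b u (r *: p).
Proof.
by rewrite /b -pure_cst dbl_cst; congr pure; congr (_, _); rewrite /= scaler0.
Qed.

Definition induce : {additive tensor U (res P) -> tensor (dblr U) P} :=
  tens_lift induce_Dl induce_Dr induce_bal.

Lemma induce_pure u p : induce (pure u p) = b u p.
Proof. exact: tens_lift_pure. Qed.

Let c (u : dblr U) (p : P) : tensor U (res P) :=
  pure u.1 (p : res P) + pure u.2 (xact D P p).

Fact uninduce_Dl u u' p : c (u + u') p = c u p + c u' p.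
Proof. by rewrite /c !pureDl addrACA. Qed.

Fact uninduce_Dr u p p' : c u (p + p') = c u p + c u p'.
Proof. by rewrite /c (linearD (xact D P)) !pureDr addrACA. Qed.

Fact uninduce_bal (a : A) u p : c ((a : A^c) *: u) p = c u (a *: p).
Proof.
rewrite /c (dbl_scaleE (D := D')) [a *: p](scale_dual D).
rewrite (linearD (xact D P)) !(linearZ_LR (xact D P)) xactK scaler0 addr0.
rewrite !pureDl (pureDr (N := res P)) !(pure_bal (N := res P)).
by rewrite [_ + pure u.1 _ in LHS]addrC addrA.
Qed.

Definition uninduce : {additive tensor (dblr U) P -> tensor U (res P)} :=
  tens_lift uninduce_Dl uninduce_Dr uninduce_bal.

Lemma induceK w : uninduce (induce w) = w.
Proof.
elim/tensor_ind: w => [|u p w IHw]; first by rewrite !raddf0.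
rewrite (raddfD induce) (raddfD uninduce) IHw induce_pure; congr (_ + _).
by rewrite [LHS]tens_lift_pure /c /= pure0l addr0.
Qed.
End Induced.

Lemma gr_flat_res P : gr_flat P -> flat (res P).
Proof.
move=> Pf; apply/flat_ker => U V f fI w fw.
have fI' : injective (cell_map D' (-1) f).
  by move=> [x1 x2] [y1 y2] [/fI-> /fI->].
rewrite -[w]induceK; suff -> : induce U P w = 0 by rewrite raddf0.
apply: (Pf _ _ _ fI').
suff induce_nat v : tens_map (cell_map D' (-1) f) (idfun : {linear P -> P}) (induce U P v) =
    induce V P (tens_map f (idfun : {linear res P -> res P}) v).
  by rewrite [LHS]induce_nat fw !raddf0.
elim/tensor_ind: v => [|u p v IHv]; first by rewrite !raddf0.
rewrite (raddfD (induce U P)) (raddfD (tens_map (cell_map D' (-1) f) _)).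
rewrite (raddfD (tens_map f _)) (raddfD (induce V P)); congr (_ + _); last exact: IHv.
rewrite [X in induce V P X]tens_map_pure !induce_pure [LHS]tens_map_pure.
by congr pure; congr (_, _); rewrite linear0.
Qed.

Lemma gr_flat_homog P k : gr_flat P -> flat (homog P k).
Proof. by move=> /gr_flat_res; apply: flat_retract (@hcompK R P k). Qed.

Lemma homog_exact (M N P : gradedModule A) (f : gradedHom M N) (g : gradedHom N P) k :
  exact f g -> exact (Phi_map f k) (Phi_map g k).
Proof.
move=> fg y; split=> [/(congr1 val)/fg[x xP]|[x <-]]; last first.
  by apply: val_inj; apply: (exact0 _ fg).
exists (hcomp M k x); apply: val_inj.
rewrite /= -gcomp_hom xP; apply: gcomp_id; apply: homogv_deg.
Qed.

Section Syzygies.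
Variables (t : int -> lmodType R) (d : forall n, {linear t n -> t (n + 1)}).
Hypothesis t_exact : forall n, exact (d n) (d (n + 1)).

Lemma syzygy_exact n :
  short_exact (kerv (d n)) (ker_lift (fun x => exact0 x (@t_exact n))).
Proof.
split; first exact: kerv_inj.
  move=> y; split=> [/(congr1 val)/= /kerv_onto//|[x <-]].
  by apply: val_inj; apply: (kervP x).
move=> y; have [x xP] := (t_exact (kerv _ y)).1 (kervP y).
by exists x; apply: kerv_inj.
Qed.

(** The cycles of an unbounded exact complex of modules in K are syzygies of
    arbitrarily high order, hence lie in K if all dimensions are bounded. *)
Lemma syzygy_left K k : resolving K -> (forall n, K (t n)) ->
  (forall n, left_dim_le K k (ker (d n))) -> forall n, K (ker (d n)).
Proof.
move=> Kres Kt; elim: k => [|k IHk] dk n; first exact/(left_dim0 Kres).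
apply: IHk => j.
exact: (left_dim_syzygy Kres (syzygy_exact j) (Kt j) (dk (j + 1))).
Qed.

(** Here Ext^1 into the cycles is shifted down the complex until the projective
    dimension of the first argument is used up. *)
Lemma syzygy_injective k : (forall n, injective_mod (t n)) ->
  (forall M : lmodType R, proj_dim_le k M) -> forall n, injective_mod (ker (d n)).
Proof.
move=> ti gl n; apply: ext_proj_injective => M; move: (M) (gl M) n.
elim: {gl M}k => [|k IHk] M dM.
  have Mp : projective M by apply/(left_dim0 (resolving_projective R)).
  move=> n L P i p [iI ip pE] Pp g; have [s sP] := projective_split Mp pE.
  have [r rP] := split_retraction iI ip sP; exists (g \o r) => x /=.
  by congr (g _); apply: iI; rewrite rP (exact0 _ ip) linear0 subr0.
apply: int_shift => n.
exact: (ext_proj_cosyzygy (ti n) (syzygy_exact n) (fun (N : lmodType R) dN => IHk N dN n) dM).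
Qed.
End Syzygies.

Lemma kernel_homog (M N P : gradedModule A) (i : gradedHom M N) (f : gradedHom N P) k :
  is_kernel i f -> exists g : {linear homog M k -> ker (Phi_map f k)},
    injective g /\ epi g.
Proof.
move=> [iI iex]; have ik := homog_exact (k := k) iex.
exists (ker_lift (fun x => exact0 x ik)); split.
  by move=> x y /(congr1 val)/(congr1 val)/iI; apply: val_inj.
by move=> y; have [x xP] := (ik (kerv _ y)).1 (kervP y); exists x; apply: kerv_inj.
Qed.

Lemma Gorenstein_projective_homog l X k :
  (forall M : lmodType R, proj_dim_le l M) ->
  Gorenstein_projective X -> projective (homog X k).
Proof.
move=> gl [T [d [Tp dex _ [i iP]]]]; have [g [gI gE]] := kernel_homog k iP.
have Kres := resolving_projective R; apply: (resolving_iso Kres gI gE).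
apply: (@syzygy_left (fun n => homog (T n) k) (fun n => Phi_map (d n) k) _ _ l) => //.
- by move=> n; apply: homog_exact.
- by move=> n; apply: gr_projective_homog.
- by move=> n; apply: gl.
Qed.

Lemma Gorenstein_flat_homog l X k :
  (forall M : lmodType R, flat_dim_le l M) ->
  Gorenstein_flat X -> flat (homog X k).
Proof.
move=> gl [T [d [Tp dex _ [i iP]]]]; have [g [gI gE]] := kernel_homog k iP.
have Kres := resolving_flat R; apply: (resolving_iso Kres gI gE).
apply: (@syzygy_left (fun n => homog (T n) k) (fun n => Phi_map (d n) k) _ _ l) => //.
- by move=> n; apply: homog_exact.
- by move=> n; apply: gr_flat_homog.
- by move=> n; apply: gl.
Qed.

Lemma Gorenstein_injective_homog l X k :
  (forall M : lmodType R, proj_dim_le l M) ->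
  Gorenstein_injective X -> injective_mod (homog X k).
Proof.
move=> gl [T [d [Ti dex _ [i iP]]]]; have [g [gI gE]] := kernel_homog k iP.
apply: (injective_iso gI gE).
apply: (@syzygy_injective (fun n => homog (T n) k) (fun n => Phi_map (d n) k) _ l) => //.
- by move=> n; apply: homog_exact.
- by move=> n; apply: gr_injective_homog.
Qed.

Lemma left_dim_homog (G : gradedModule A -> Prop) (K : lmodType R -> Prop) r M k :
  (forall X, G X -> K (homog X k)) -> gr_left_dim_le G r M ->
  left_dim_le K r (homog M k).
Proof.
move=> GK [C [d [e [[eE de dd] GC C0]]]].
exists (fun j => homog (C j) k), (fun j => Phi_map (d j) k), (Phi_map e k).
split; first split.
- exact: gr_epi_homog.
- exact: homog_exact.
- by move=> j; apply: homog_exact.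
- by move=> j /GC/GK.
- by move=> j /C0 Cj x; apply: val_inj; apply: Cj.
Qed.

Lemma right_dim_homog (G : gradedModule A -> Prop) (K : lmodType R -> Prop) r M k :
  (forall X, G X -> K (homog X k)) -> gr_right_dim_le G r M ->
  right_dim_le K r (homog M k).
Proof.
move=> GK [C [d [e [[eI ed dd] GC C0]]]].
exists (fun j => homog (C j) k), (fun j => Phi_map (d j) k), (Phi_map e k).
split; first split.
- by move=> x y /(congr1 val)/eI; apply: val_inj.
- exact: homog_exact.
- by move=> j; apply: homog_exact.
- by move=> j /GC/GK.
- by move=> j /C0 Cj x; apply: val_inj; apply: Cj.
Qed.

End Terms.

(** An exact complex with cycles in the orthogonal class has its terms there as
    well, being extensions of cycles; this is what dimension shifting requires. *)
Section Dg.
Variables (R : pzRingType) (l : nat).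
Hypothesis gl : forall M : lmodType R, proj_dim_le l M.
Implicit Types X : complex R.

Lemma dg_left_of_terms (K : lmodType R -> Prop) r X : resolving K ->
  (forall n, left_dim_le K r (X n)) ->
  dg_left (left_dim_le K r) (right_perp (left_dim_le K r)) X.
Proof.
move=> Kres Xr; split=> // Y [Yex Yperp].
apply: (@null_dg_left _ (left_dim_le K r) l l) => //.
- move=> L P M i p ip Pp dM; have KP : K P by case: Kres => + _ _; apply.
  apply: (left_dim_syzygy Kres ip KP).
  by apply: left_dimW dM => // N; apply: resolving_trivial.
- move=> M n dM; apply: (ext_proj_exact Yex) => m.
  exact: (Ext1_zero_proj gl (Yperp m M dM)).
Qed.

Lemma dg_injective_of_terms r X :
  (forall n, inj_dim_le r (X n)) -> dg_injective r X.
Proof.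
move=> Xr; split=> // Y [Yex Yperp].
apply: (@null_dg_right _ l r r) => // N n dN.
apply: (ext_zero_exact Yex) => m.
exact: (ext_proj_zero (Ext1_zero_proj gl (Yperp m N dN))).
Qed.

End Dg.

Theorem theorem6p1 (R : pzRingType) (r : nat) (r_gt0 : (0 < r)%N) :
  [/\ forall X : complex R, dg_projective r X -> Gorenstein_r_projective r (Psi X),
      forall X : complex R, dg_injective r X -> Gorenstein_r_injective r (Psi X)
    & forall X : complex R, dg_flat r X -> Gorenstein_r_flat r (Psi X)]
  /\
  (left_noetherian R -> right_noetherian R -> finite_left_gldim R ->
   [/\ forall M : gradedModule (dn_gring R),
         Gorenstein_r_projective r M -> dg_projective r (Phi M),
       forall M : gradedModule (dn_gring R),
         Gorenstein_r_injective r M -> dg_injective r (Phi M)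
     & forall M : gradedModule (dn_gring R),
         Gorenstein_r_flat r M -> dg_flat r (Phi M)]).
Proof.
split=> [|_ _ [l gl]].
  split=> X [Xr _].
  - exact: Psi_left_dim (resolving_projective R) (@Psi_Gorenstein_projective R) X Xr.
  - exact: Psi_right_dim (@Psi_Gorenstein_injective R) X Xr.
  - exact: Psi_left_dim (resolving_flat R) (@Psi_Gorenstein_flat R) X Xr.
split=> M Mr.
- apply: (dg_left_of_terms gl (resolving_projective R)) => n.
  by apply: left_dim_homog Mr => X; apply: Gorenstein_projective_homog gl.
- apply: (dg_injective_of_terms gl) => n.
  by apply: right_dim_homog Mr => X; apply: Gorenstein_injective_homog gl.
- apply: (dg_left_of_terms gl (resolving_flat R)) => n.
  apply: left_dim_homog Mr => X; apply: Gorenstein_flat_homog => N.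
  exact: left_dim_sub (@projective_flat R) (gl N).
Qed.
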